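(* Let $\Omega\subseteq\mathbb{R}^n$ be open. Let $u\colon\Omega\to\mathbb{R}$ be a viscosity solution to the system $$\begin{cases}\operatorname{sgn}(g(u))\big(f(u)-|\nabla u|\big)=0,\\ \Delta u - g(u) = 0,\end{cases}\qquad\text{in }\Omega,$$ where $f>0$ and $g$ are continuous real-valued functions on an interval containing $u(\Omega)$. Then $u\in C^2(\Omega)$ and $$|\nabla u(x)| = f(u(x)),\qquad \Delta u(x) = g(u(x))$$ hold pointwise for all $x\in\Omega$.
   Context: The sign function is defined by $\operatorname{sgn}(t)=1$ for $t\geq 0$ and $\operatorname{sgn}(t)=-1$ for $t<0$. Viscosity solutions: for an equation $\mathcal{F}(u,\nabla u, \mathcal{H}u)=0$ in $\Omega$ ($\mathcal{H}u$ being the Hessian matrix), a continuous function $u\colon\Omega\to\mathbb{R}$ is a viscosity solution if, for every $x_0\in\Omega$ and every $C^2$ function $\phi$ defined near $x_0$: (a) if $\phi$ touches $u$ from below at $x_0$ (i.e. $\phi(x_0)=u(x_0)$ and $\phi\leq u$ near $x_0$), then $\mathcal{F}(\phi(x_0),\nabla\phi(x_0),\mathcal{H}\phi(x_0))\leq 0$; (b) if $\phi$ touches $u$ from above at $x_0$ (i.e. $\phi(x_0)=u(x_0)$ and $\phi\geq u$ near $x_0$), then $\mathcal{F}(\phi(x_0),\nabla\phi(x_0),\mathcal{H}\phi(x_0))\geq 0$. A viscosity solution of the system is a continuous function that is a viscosity solution of each of the two equations, i.e. with $\mathcal{F}=\operatorname{sgn}(g(u))(f(u)-|\nabla u|)$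 and with $\mathcal{F}=\Delta u-g(u)$. *)

(* Defs.v *)
From HB Require Import structures.
From mathcomp Require Import all_boot all_order all_algebra.
From mathcomp Require Import all_classical all_reals all_analysis.

Set Implicit Arguments.
Unset Strict Implicit.
Unset Printing Implicit Defensive.

Import Order.TTheory GRing.Theory Num.Theory.
Import numFieldNormedType.Exports.

Local Open Scope classical_set_scope.
Local Open Scope ring_scope.

(* Unlike [Num.sg], this sign function takes the value 1 at 0. *)
Definition sgn (R : realType) (t : R) : R := if 0 <= t then 1 else -1.

(* The library norm on ['rV[R]_n] is the sup norm. *)
Definition enorm (R : realType) (n : nat) (p : 'rV[R]_n) : R :=
  Num.sqrt (\sum_(i < n) p 0 i ^+ 2).

Definition partial (R : realType) (n : nat) (i : 'I_n) (h : 'rV[R]_n -> R)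
    (x : 'rV[R]_n) : R :=
  'D_(delta_mx 0 i) h x.

Definition gradient (R : realType) (n : nat) (h : 'rV[R]_n -> R)
    (x : 'rV[R]_n) : 'rV[R]_n :=
  \row_(i < n) partial i h x.

Definition hessian (R : realType) (n : nat) (h : 'rV[R]_n -> R)
    (x : 'rV[R]_n) : 'M[R]_n :=
  \matrix_(i < n, j < n) partial j (partial i h) x.

Definition laplacian (R : realType) (n : nat) (h : 'rV[R]_n -> R)
    (x : 'rV[R]_n) : R :=
  \sum_(i < n) partial i (partial i h) x.

(* [Ck k U h], for [U] open: all partial derivatives of [h] of order at most
   [k] exist and are continuous on [U]. *)
Fixpoint Ck (R : realType) (n : nat) (k : nat) (U : set 'rV[R]_n)
    (h : 'rV[R]_n -> R) : Prop :=
  {within U, continuous h} /\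
  match k with
  | 0 => True
  | k'.+1 => forall i : 'I_n,
      (forall x, U x -> derivable h x (delta_mx 0 i)) /\ Ck k' U (partial i h)
  end.

Definition C2_near (R : realType) (n : nat) (x0 : 'rV[R]_n)
    (phi : 'rV[R]_n -> R) : Prop :=
  exists2 U : set 'rV[R]_n, open_nbhs x0 U & Ck 2 U phi.

Definition touches_below (R : realType) (n : nat) (phi u : 'rV[R]_n -> R)
    (x0 : 'rV[R]_n) : Prop :=
  phi x0 = u x0 /\ \forall x \near x0, phi x <= u x.

Definition touches_above (R : realType) (n : nat) (phi u : 'rV[R]_n -> R)
    (x0 : 'rV[R]_n) : Prop :=
  phi x0 = u x0 /\ \forall x \near x0, u x <= phi x.

(* A function on [Omega] is a total function whose values outside the open set
   [Omega] are irrelevant. *)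
Definition viscosity_solution (R : realType) (n : nat)
    (F : R -> 'rV[R]_n -> 'M[R]_n -> R) (Omega : set 'rV[R]_n)
    (u : 'rV[R]_n -> R) : Prop :=
  {within Omega, continuous u} /\
  forall (x0 : 'rV[R]_n) (phi : 'rV[R]_n -> R), Omega x0 -> C2_near x0 phi ->
    (touches_below phi u x0 ->
       F (phi x0) (gradient phi x0) (hessian phi x0) <= 0) /\
    (touches_above phi u x0 ->
       0 <= F (phi x0) (gradient phi x0) (hessian phi x0)).

Definition eikonal_op (R : realType) (n : nat) (f g : R -> R)
    (r : R) (p : 'rV[R]_n) (X : 'M[R]_n) : R :=
  sgn (g r) * (f r - enorm p).

(* The trace of the Hessian is the Laplacian. *)
Definition poisson_op (R : realType) (n : nat) (g : R -> R)
    (r : R) (p : 'rV[R]_n) (X : 'M[R]_n) : R :=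
  \tr X - g r.

(* Main.v *)
(* Polynomial test functions suffice throughout.  On a ball the Dirichlet problem with
   polynomial data has polynomial solutions, so by the comparison principle a viscosity
   solution of [lap u = H] is a uniform limit of polynomials whose Laplacians converge
   uniformly to [H]; an interior gradient estimate then makes [u] of class C^1, and of
   class C^2 when [H] is Lipschitz.  Hence [u] is C^1, and [|grad u| = f u] follows by
   touching [u] at a dense set of points.

   Locally put [v := Phi o u] with [Phi' = 1 / f], so that [|grad v| = 1] and [u = Psi o v]
   with [Psi' = f o Psi].  Along the line through [x] with direction [grad v x], the
   gradient of [v] is constant and [v] grows at unit speed.  Quadratic tests of [v] from
   above or below can be transported along these lines, with a loss in the trace linear in
   the distance, to any level set of [v], where they meet the same one-dimensional bounds,
   coming from [lap u = g u], on the second derivative of [Psi].  Comparing them produces a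
   Lipschitz function [h] with [lap v = h v] in the viscosity sense.  Therefore [v] is C^2;
   the tests of [Psi] then show that [Psi'' = g Psi - f Psi * lap v] is continuous, so
   [u = Psi o v] is C^2. *)

Require Import Defs.
From HB Require Import structures.
From mathcomp Require Import all_boot all_order all_algebra.
From mathcomp Require Import all_classical all_reals all_analysis.
From mathcomp Require Import ring lra.

Set Implicit Arguments.
Unset Strict Implicit.
Unset Printing Implicit Defensive.

Import Order.TTheory GRing.Theory Num.Theory.
Import numFieldNormedType.Exports.

Local Open Scope classical_set_scope.
Local Open Scope ring_scope.

(** The obstacle is that [f] and [g] are merely continuous: the equations cannot be differentiated,
    and a Poisson equation with continuous right-hand side need not have C^2 solutions. The missing
    regularity comes from the geometry of [v]. If everything were smooth, the Hessian D of [v] would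
    satisfy the Riccati equation D' = - D^2 along the gradient lines, while lap u = Psi''(v) +
    Psi'(v) lap v would make [lap v] a function of [v] alone; the Riccati equation then bounds the
    rate of change of that function, however rough [f] and [g] are. The proof replaces Hessians by
    quadratic tests: moving a test along a gradient line costs nothing in one direction and an
    amount linear in the distance in the other, and this stands for the Riccati equation. At that
    stage Psi'' is not known to exist, so it is never computed: a lower and an upper bound for it,
    obtained from tests of [v] at unrelated points, are compared, and it drops out. *)

Lemma filter_forall (T : Type) (I : finType) (F : set_system T) (P : I -> set T) :
  Filter F -> (forall i, F (P i)) -> F [set x | forall i, P i x].
Proof.
move=> FF FP.
have : F [set x | forall i, i \in enum I -> P i x].
  elim: (enum I) => [|j s IH]; first by apply: filterS filterT => x _ i.
  apply: filterS (filterI (FP j) IH) => x [Pj Ps] i.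
  by rewrite inE => /predU1P[->|/Ps].
by apply: filterS => x h i; apply: h; rewrite mem_enum.
Qed.

(** * Euclidean geometry *)

Section Euclid.
Variables (R : realType) (n : nat).
Implicit Types (x y z : 'rV[R]_n) (a b e : R).

Definition dot x y : R := \sum_(i < n) x 0 i * y 0 i.

Lemma dotC x y : dot x y = dot y x.
Proof. by apply: eq_bigr => i _; rewrite mulrC. Qed.

Lemma dotDl x y z : dot (x + y) z = dot x z + dot y z.
Proof. by rewrite -big_split; apply: eq_bigr => i _; rewrite mxE mulrDl. Qed.

Lemma dotDr x y z : dot x (y + z) = dot x y + dot x z.
Proof. by rewrite dotC dotDl !(dotC x). Qed.

Lemma dotZl a x y : dot (a *: x) y = a * dot x y.
Proof. by rewrite mulr_sumr; apply: eq_bigr => i _; rewrite mxE mulrA. Qed.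

Lemma dotZr a x y : dot x (a *: y) = a * dot x y.
Proof. by rewrite dotC dotZl dotC. Qed.

Lemma dotNl x y : dot (- x) y = - dot x y.
Proof. by rewrite -scaleN1r dotZl mulN1r. Qed.

Lemma dotNr x y : dot x (- y) = - dot x y.
Proof. by rewrite dotC dotNl dotC. Qed.

Lemma dot0l x : dot 0 x = 0.
Proof. by rewrite -(scale0r x) dotZl mul0r. Qed.

Lemma dot0r x : dot x 0 = 0.
Proof. by rewrite dotC dot0l. Qed.

Definition dotE := (dotDl, dotDr, dotNl, dotNr, dotZl, dotZr, dot0l, dot0r).

Lemma dot_delta x i : dot x (delta_mx 0 i) = x 0 i.
Proof.
rewrite /dot (bigD1 i) //= mxE !eqxx mulr1 big1 ?addr0 // => j ji.
by rewrite mxE eqxx (negPf ji) mulr0.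
Qed.

Lemma dot_ge0 x : 0 <= dot x x.
Proof. by apply: sumr_ge0 => i _; rewrite -expr2 sqr_ge0. Qed.

Lemma enormE x : enorm x = Num.sqrt (dot x x).
Proof. by congr Num.sqrt; apply: eq_bigr => i _; rewrite expr2. Qed.

Lemma enorm_ge0 x : 0 <= enorm x.
Proof. exact: sqrtr_ge0. Qed.

Lemma enorm_sqr x : enorm x ^+ 2 = dot x x.
Proof. by rewrite enormE sqr_sqrtr // dot_ge0. Qed.

Lemma enorm_leE x e : 0 <= e -> (enorm x <= e) = (dot x x <= e ^+ 2).
Proof.
by move=> e0; rewrite -enorm_sqr -[RHS]ler_sqrt ?sqr_ge0 // !sqrtr_sqr !ger0_norm ?enorm_ge0.
Qed.

Lemma enorm0 : enorm (0 : 'rV[R]_n) = 0.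
Proof. by rewrite enormE dot0l sqrtr0. Qed.

Lemma enorm_eq0 x : enorm x = 0 -> x = 0.
Proof.
move=> x0; have /eqP := enorm_sqr x; rewrite x0 expr0n eq_sym /=.
rewrite psumr_eq0 => [/allP h|i _]; last by rewrite -expr2 sqr_ge0.
apply/rowP => i; have := h i (mem_index_enum i).
by rewrite -expr2 sqrf_eq0 mxE => /eqP.
Qed.

Lemma enormZ a x : enorm (a *: x) = `|a| * enorm x.
Proof.
by rewrite !enormE dotZl dotZr mulrA sqrtrM -?expr2 ?sqr_ge0 // sqrtr_sqr.
Qed.

Lemma enormN x : enorm (- x) = enorm x.
Proof. by rewrite -scaleN1r enormZ normrN normr1 mul1r. Qed.

Lemma dot_le_enorm x y : dot x y <= enorm x * enorm y.
Proof.
have [x0|x0] := eqVneq (enorm x) 0.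
  by rewrite (enorm_eq0 x0) dot0l enorm0 mul0r.
have [y0|y0] := eqVneq (enorm y) 0.
  by rewrite (enorm_eq0 y0) dot0r enorm0 mulr0.
have xy0 : 0 < enorm x * enorm y.
  by rewrite mulr_gt0 // lt_def ?x0 ?y0 enorm_ge0.
have := dot_ge0 (enorm y *: x - enorm x *: y).
rewrite !dotE (dotC y x) -!enorm_sqr => h.
rewrite -(ler_pM2l xy0); nra.
Qed.

Lemma dot_norm_le x y : `|dot x y| <= enorm x * enorm y.
Proof.
rewrite ler_norml dot_le_enorm andbT lerNl -dotNl.
by rewrite (le_trans (dot_le_enorm _ _)) // enormN.
Qed.

Lemma enormD x y : enorm (x + y) <= enorm x + enorm y.
Proof.
rewrite enorm_leE ?addr_ge0 ?enorm_ge0 // !dotE (dotC y x).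
rewrite -!enorm_sqr; have := dot_le_enorm x y; nra.
Qed.

Lemma enormB x y : enorm (x - y) = enorm (y - x).
Proof. by rewrite -enormN opprB. Qed.

Lemma enorm_delta (i : 'I_n) : enorm (delta_mx 0 i : 'rV[R]_n) = 1.
Proof. by rewrite enormE dot_delta mxE !eqxx sqrtr1. Qed.

Lemma coord_le_enorm x i : `|x 0 i| <= enorm x.
Proof.
by rewrite -dot_delta (le_trans (dot_norm_le _ _)) // enorm_delta mulr1.
Qed.

Lemma row_sum x : x = \sum_i x 0 i *: delta_mx 0 i.
Proof. exact: row_sum_delta. Qed.

Lemma enorm_sum_le x : enorm x <= \sum_i `|x 0 i|.
Proof.
rewrite {1}[x]row_sum.
elim/big_ind2 : _ => [|a b c d ab cd|i _]; first by rewrite enorm0.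
  by rewrite (le_trans (enormD _ _)) // lerD.
by rewrite enormZ enorm_delta mulr1.
Qed.

Lemma sum_le_enorm x : \sum_i `|x 0 i| <= n%:R * enorm x.
Proof.
rewrite mulr_natl -[X in _ *+ X]card_ord -sumr_const.
by apply: ler_sum => i _; rewrite coord_le_enorm.
Qed.

Lemma unit_dot_eq x y : enorm x = 1 -> enorm y = 1 -> dot x y = 1 -> x = y.
Proof.
move=> x1 y1 xy; apply/eqP; rewrite -subr_eq0; apply/eqP/enorm_eq0.
rewrite enormE !dotE (dotC y x) -!enorm_sqr x1 y1 xy expr1n.
by rewrite (_ : _ + _ = 0) ?sqrtr0 //; ring.
Qed.

Definition eball x e : set 'rV[R]_n := [set y | enorm (y - x) < e].
Definition ceball x e : set 'rV[R]_n := [set y | enorm (y - x) <= e].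

Lemma nbhs_enormP x (P : set 'rV[R]_n) :
  nbhs x P <-> exists2 e, 0 < e & eball x e `<=` P.
Proof.
split=> [/nbhs_ballP[e /= e0 eP]|[e e0 eP]].
  exists e => // y xy; apply: eP; split=> // i j.
  rewrite [i]ord1 /ball /= -normrN opprB.
  by have := coord_le_enorm (y - x) j; rewrite !mxE => /le_lt_trans; apply.
(* Dividing by [n.+1] rather than by [n] keeps the sum of [n] coordinates strictly below [e] and
   makes sense in dimension zero. *)
apply/nbhs_ballP; exists (e / n.+1%:R) => /=; first by rewrite divr_gt0.
move=> y [_ xy]; apply: eP; rewrite /eball /=.
apply: le_lt_trans (enorm_sum_le _) _.
have : \sum_i `|(y - x) 0 i| <= \sum_(i < n) e / n.+1%:R.
  apply: ler_sum => i _; have := xy 0 i; rewrite /ball /= => /ltW.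
  by rewrite -normrN opprB !mxE.
rewrite sumr_const card_ord => /le_lt_trans; apply.
rewrite -[ltLHS]mulr_natr -mulrA -[ltRHS]mulr1 ltr_pM2l //.
by rewrite mulrC ltr_pdivrMr // mul1r ltr_nat.
Qed.

Lemma cont_enormP (f : 'rV[R]_n -> R) x : {for x, continuous f} <->
  forall e, 0 < e -> exists2 d, 0 < d & forall y, enorm (y - x) < d ->
    `|f y - f x| < e.
Proof.
split=> [/cvgrPdist_lt h e e0|h].
  have /nbhs_enormP[d d0 dP] := h e e0; exists d => // y yd.
  by rewrite distrC; apply: dP.
apply/(@cvgrPdist_lt _ _ _ (nbhs x) _) => e /h[d d0 dP]; apply/nbhs_enormP; exists d => // y yd.
by rewrite /= distrC; apply: dP.
Qed.

Lemma eball_center x e : 0 < e -> eball x e x.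
Proof. by rewrite /eball /= subrr enorm0. Qed.

Lemma eball_sub x y d e : enorm (y - x) + d <= e -> eball y d `<=` eball x e.
Proof.
move=> h z; rewrite /eball /= => zy; apply: lt_le_trans h.
have -> : z - x = (y - x) + (z - y) by rewrite [RHS]addrC addrA subrK.
by apply: le_lt_trans (enormD _ _) _; rewrite ltrD2l.
Qed.

Lemma ceball_sub x y d e : enorm (y - x) + d <= e ->
  ceball y d `<=` ceball x e.
Proof.
move=> h z; rewrite /ceball /= => zy; apply: le_trans h.
have -> : z - x = (y - x) + (z - y) by rewrite [RHS]addrC addrA subrK.
by apply: le_trans (enormD _ _) _; rewrite lerD2l.
Qed.

Lemma eball_ceball x e : eball x e `<=` ceball x e.
Proof. by move=> y /ltW. Qed.

Lemma nbhs_eball x e : 0 < e -> nbhs x (eball x e).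
Proof. by move=> e0; apply/nbhs_enormP; exists e. Qed.

Lemma open_eball x e : open (eball x e).
Proof.
rewrite openE => y xy; apply/nbhs_enormP; exists (e - enorm (y - x)).
  by rewrite subr_gt0.
by apply: eball_sub; rewrite addrC subrK.
Qed.

Lemma closed_ceball x e : closed (ceball x e).
Proof.
have -> : ceball x e = ~` [set y | e < enorm (y - x)].
  by apply/seteqP; split=> y; rewrite /ceball /= leNgt => /negP.
apply: open_closedC; rewrite openE => y /= xy.
apply/nbhs_enormP; exists (enorm (y - x) - e); first by rewrite subr_gt0.
move=> z; rewrite /eball /= => zy.
have := enormD (y - z) (z - x); rewrite addrA subrK (enormB y z) => h.
by move: zy xy h; lra.
Qed.

Lemma bounded_ceball x e : bounded_set (ceball x e).
Proof.
exists (e + enorm x); split; first exact: num_real.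
move=> M eM y /= xy; have M0 : 0 <= M.
  by apply: le_trans (ltW eM); rewrite addr_ge0 ?enorm_ge0 //
     (le_trans (enorm_ge0 _) xy).
rewrite [leLHS]/Num.norm /= mx_normrE; apply/bigmax_leP; split=> // -[i j] _ /=.
rewrite [i]ord1; apply: le_trans (coord_le_enorm _ _) _.
rewrite -[y](subrK x); apply: le_trans (enormD _ _) _.
by apply: le_trans (ltW eM); rewrite lerD2r.
Qed.

Lemma compact_ceball x e : compact (ceball x e).
Proof.
by apply: bounded_closed_compact; [exact: bounded_ceball|exact: closed_ceball].
Qed.

Lemma compact_max (A : set 'rV[R]_n) (f : 'rV[R]_n -> R) x0 : A x0 ->
    compact A -> (forall x, A x -> {for x, continuous f}) ->
  exists2 c, A c & forall x, A x -> f x <= f c.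
Proof.
move=> Ax0 cA cf; have [||c] := @compact_EVT_max _ _ f A _ cA.
- by exists x0.
- apply: continuous_in_subspaceT => x; rewrite inE; exact: cf.
by rewrite inE => Ac h; exists c => // x Ax; apply: h; rewrite inE.
Qed.

End Euclid.

(** * Differential calculus *)

Section Directional.
Variables (R : realType) (V : normedModType R).
Implicit Types (f g : V -> R) (x v : V).

(** A first-order expansion whose error bound is non-strict, so that it also holds at [t = 0]; it
    spares the later computations the limits over punctured neighbourhoods. *)
Lemma is_derive_epsP f x v (d : R) : is_derive x v f d <->
  forall e, 0 < e -> exists2 r, 0 < r & forall t, `|t| < r ->
    `|f (x + t *: v) - f x - t * d| <= e * `|t|.
Proof.
split=> [[fd fE] e e0|h].
  have : h^-1 *: ((f \o shift x) (h *: v) - f x) @[h --> 0^'] --> d.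
    by rewrite -fE; exact: fd.
  move=> /cvgrPdist_le /(_ e e0) /nbhs_ballP[r /= r0 rP].
  exists r => // t tr; have [->|t0] := eqVneq t 0.
    by rewrite scale0r addr0 mul0r !subrr normr0 mulr0.
  have := rP t; rewrite /ball /= sub0r normrN => /(_ tr t0).
  rewrite -(ler_pM2r (_ : 0 < `|t|)) ?normr_gt0 // -normrM => H; apply: le_trans H.
  rewrite (_ : (d - _) * t = - (f (x + t *: v) - f x - t * d)) ?normrN //.
  rewrite /= /GRing.scale /= [t *: v + x]addrC mulrBl mulrC opprB; congr (_ - _).
  by rewrite mulrAC mulVf // mul1r.
have cv : h^-1 *: ((f \o shift x) (h *: v) - f x) @[h --> 0^'] --> d.
  apply/cvgrPdist_le => e e0; have [r r0 rP] := h e e0.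
  apply/nbhs_ballP; exists r => //= t; rewrite /ball /= sub0r normrN => tr t0.
  rewrite -(ler_pM2r (_ : 0 < `|t|)) ?normr_gt0 // -normrM.
  apply: le_trans (rP t tr); rewrite -normrN.
  rewrite (_ : - ((d - _) * t) = (f (x + t *: v) - f x - t * d)) //.
  rewrite /= /GRing.scale /= [t *: v + x]addrC mulrBl opprB [d * t]mulrC.
  by congr (_ - _); rewrite mulrAC mulVf // mul1r.
by split; [apply/cvg_ex; exists d|apply/cvg_lim].
Qed.

Lemma is_deriveZv f x v d a : is_derive x v f d -> is_derive x (a *: v) f (a * d).
Proof.
move=> /is_derive_epsP h; apply/is_derive_epsP => e e0.
have a1 : 0 < `|a| + 1 by rewrite ltr_pwDr.
have [|r r0 rP] := h (e / (`|a| + 1)); first exact: divr_gt0.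
exists (r / (`|a| + 1)) => [|t tr]; first exact: divr_gt0.
have ta : `|t * a| < r.
  rewrite normrM; apply: le_lt_trans (_ : `|t| * (`|a| + 1) < r).
    by rewrite ler_wpM2l // lerDl.
  by rewrite -ltr_pdivlMr.
rewrite scalerA mulrA; apply: le_trans (rP _ ta) _.
rewrite normrM mulrA -[leLHS]mulrAC ler_wpM2r // -mulrA ler_piMr //; first exact: ltW.
by rewrite mulrC ler_pdivrMr // mul1r lerDl.
Qed.

End Directional.

Section Lines.
Variables (R : realType) (V : normedModType R).
Implicit Types (f g : V -> R) (x v : V).

Lemma is_derive_line f x v d t :
  is_derive (x + t *: v) v f d <-> is_derive t 1 (fun s => f (x + s *: v)) d.
Proof.
split=> /is_derive_epsP h; apply/is_derive_epsP => e /h[r r0 rP];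
  exists r => // s /rP; by rewrite [s *: 1]mulr1 scalerDl addrA.
Qed.

Lemma derive_eq f x v d : is_derive x v f d -> 'D_v f x = d.
Proof. by move=> h; rewrite derive_val. Qed.

End Lines.

Lemma is_derive_cont1 (R : realType) (f : R -> R) (x d : R) :
  is_derive x 1 f d -> {for x, continuous f}.
Proof.
by case=> fd _; apply: differentiable_continuous; apply/derivable1_diffP.
Qed.

Lemma MVT_line (R : realType) (V : normedModType R) (f : V -> R) (x v : V)
    (df : R -> R) (a b : R) : a < b ->
  (forall t, a <= t <= b -> is_derive (x + t *: v) v f (df t)) ->
  exists2 c, a < c < b & f (x + b *: v) - f (x + a *: v) = df c * (b - a).
Proof.
move=> ab fd; have [||c] := @MVT R (fun s => f (x + s *: v)) df a b ab.
- move=> t; rewrite in_itv /= => /andP[at_ tb].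
  apply: (@is_derive_line _ _ f x v (df t) t).1; apply: fd.
  by rewrite (ltW at_) (ltW tb).
- apply: continuous_in_subspaceT => t; rewrite inE /= in_itv /= => tab.
  apply: (@is_derive_cont1 _ _ t (df t)).
  by apply: (@is_derive_line _ _ f x v (df t) t).1; apply: fd.
- by rewrite in_itv /=; exists c.
Qed.

Lemma MVT1 (R : realType) (f df : R -> R) (a b : R) : a < b ->
  (forall t, a <= t <= b -> is_derive t 1 f (df t)) ->
  exists2 c, a < c < b & f b - f a = df c * (b - a).
Proof.
move=> ab fd; have [|c cab] := @MVT_line R _ f 0 (1 : R) df a b ab.
  by move=> t tab; rewrite add0r [_ *: _]mulr1; apply: fd.
by rewrite !add0r ![_ *: _]mulr1; exists c.
Qed.

Lemma is_derive_quad (R : realType) (a b c t0 t : R) :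
  is_derive t 1 (fun s => a + b * (s - t0) + c * (s - t0) ^+ 2)
    (b + 2 * c * (t - t0)).
Proof.
apply/is_derive_epsP => e e0; have c1 : 0 < `|c| + 1 by rewrite ltr_pwDr.
exists (e / (`|c| + 1)) => [|u ue]; first exact: divr_gt0.
rewrite [u *: 1]mulr1 (_ : _ - _ = u * u * c); last by ring.
rewrite !normrM mulrAC ler_wpM2r //.
move: ue; rewrite ltr_pdivlMr // => /ltW; apply: le_trans.
by rewrite ler_wpM2l // lerDl.
Qed.

(** * First- and second-order expansions of functions with continuous partial derivatives *)

Section Differential.
Variables (R : realType) (n : nat).
Implicit Types (f h : 'rV[R]_n -> R) (x y z v : 'rV[R]_n) (U : set 'rV[R]_n).

Lemma derive_max0 f x v d r : is_derive x v f d -> 0 < r ->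
  (forall y, enorm (y - x) < r -> f y <= f x) -> d = 0.
Proof.
move=> /is_derive_epsP fd r0 fmax.
have le e : 0 < e -> `|d| <= e.
  move=> /fd[s s0 sP].
  have v1 : 0 < enorm v + 1 by rewrite ltr_pwDr // enorm_ge0.
  pose t := Num.min (s / 2) (r / (enorm v + 1)).
  have t0 : 0 < t by rewrite lt_min !divr_gt0.
  have ts : t < s.
    apply: le_lt_trans (_ : s / 2 < s); first by rewrite ge_min lexx.
    by rewrite ltr_pdivrMr // ltr_pMr // ltr1n.
  have tv : t * enorm v < r.
    apply: lt_le_trans (_ : t * (enorm v + 1) <= r).
      by rewrite ltr_pM2l // ltrDl.
    by rewrite -ler_pdivlMr // ge_min lexx orbT.
  have := sP t; have := sP (- t).
  rewrite normrN gtr0_norm // => /(_ ts) + /(_ ts).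
  have := fmax (x + t *: v); have := fmax (x + (- t) *: v).
  rewrite ![x + _]addrC !addrK !enormZ normrN gtr0_norm // => /(_ tv) + /(_ tv).
  rewrite !ler_norml => h1 h2 /andP[h3 _] /andP[h4 _].
  have : t * d <= t * e by lra.
  have : - (t * d) <= t * e by lra.
  by rewrite -mulrN !ler_pM2l // lerNl => -> ->.
apply/eqP; rewrite -normr_eq0 eq_le normr_ge0 andbT.
by apply/ler_addgt0Pr => e /le; rewrite add0r.
Qed.

Lemma derive_min0 f x v d r : is_derive x v f d -> 0 < r ->
  (forall y, enorm (y - x) < r -> f x <= f y) -> d = 0.
Proof.
move=> fd r0 fmin; apply/eqP; rewrite -oppr_eq0; apply/eqP.
apply: (@derive_max0 (- f) x v _ r) => // y /fmin.
by rewrite lerN2.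
Qed.

(** A pointwise form of [Ck 1]: each clause concerns one point and full continuity there, so it can
    be proved one point at a time and restricts to subsets at once. [Ck2P] links the second-order
    version with [Ck] on open sets. *)
Definition C1on U h := forall x, U x -> {for x, continuous h} /\
  forall i, derivable h x (delta_mx 0 i) /\ {for x, continuous (partial i h)}.

Definition C2on U h := C1on U h /\ forall i, C1on U (partial i h).

Lemma within_open_cont U h : open U ->
  {within U, continuous h} <-> forall x, U x -> {for x, continuous h}.
Proof.
move=> oU; rewrite continuous_open_subspace //; split=> H x.
  by move=> Ux; apply: H; rewrite inE.
by rewrite inE => Ux; apply: H.
Qed.

Lemma Ck2P U h : open U -> Ck 2 U h <-> C2on U h.
Proof.
move=> oU; split.
  move=> /= [/within_open_cont ch hC]; split.
    move=> x Ux; split=> [|i]; first exact: ch.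
    have [dh [/within_open_cont cph _]] := hC i; split; [exact: dh|exact: cph].
  move=> i x Ux; have [dh [/within_open_cont cph hC']] := hC i.
  split=> [|j]; first exact: cph.
  have [dph [/within_open_cont cpph _]] := hC' j; split; [exact: dph|exact: cpph].
move=> [h1 h2] /=; split; first by apply/within_open_cont => // x /h1[].
move=> i; split; first by move=> x /h1[_ /(_ i)[]].
split; first by apply/within_open_cont => // x /h1[_ /(_ i)[]].
move=> j; split; first by move=> x /h2 -/(_ i)[_ /(_ j)[]].
by split=> //; apply/within_open_cont => // x /h2 -/(_ i)[_ /(_ j)[]].
Qed.

Lemma C1_partial U h x i : C1on U h -> U x ->
  is_derive x (delta_mx 0 i) h (gradient h x 0 i).
Proof.
move=> hC Ux; rewrite mxE; have [_ /(_ i)[dh _]] := hC _ Ux.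
exact: derivableP.
Qed.

Definition trunc (k : nat) z : 'rV[R]_n := \row_i (if (i < k)%N then z 0 i else 0).

Lemma truncS (k : 'I_n) z : trunc k.+1 z = trunc k z + z 0 k *: delta_mx 0 k.
Proof.
apply/rowP => i; rewrite !mxE eqxx /= ltnS leq_eqVlt.
have [ik|ik] := eqVneq i k; first by rewrite ik eqxx ltnn add0r mulr1.
by rewrite (_ : (i == k :> nat) = false) ?mulr0 ?addr0 //; apply/negbTE.
Qed.

Lemma dot_mono y z : (forall i, `|y 0 i| <= `|z 0 i|) -> enorm y <= enorm z.
Proof.
move=> yz; rewrite enorm_leE ?enorm_ge0 // enorm_sqr; apply: ler_sum => i _.
by rewrite -!expr2 -[y 0 i ^+ 2]real_normK ?num_real // -[z 0 i ^+ 2]real_normK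
  ?num_real // lerXn2r ?nnegrE.
Qed.

(** The walk from [x] to [x + z] through the points [x + trunc k z] changes one coordinate at a
    time. Each leg is a mean value step for a single partial derivative, and it stays in the ball
    because truncation does not increase the norm ([dot_mono]). *)
Lemma C1_frechet U h x e : open U -> C1on U h -> U x -> 0 < e ->
  exists2 r, 0 < r & forall z, enorm z < r ->
    `|h (x + z) - h x - dot (gradient h x) z| <= e * enorm z.
Proof.
move=> oU hC Ux e0; have n1 : (0 : R) < n.+1%:R by [].
have [r r0 rP] : exists2 r, 0 < r & forall y, enorm (y - x) < r -> U y /\
    forall i, `|gradient h y 0 i - gradient h x 0 i| <= e / n.+1%:R.
  have /nbhs_enormP[r1 r10 r1P] : nbhs x U by apply: open_nbhs_nbhs.
  have /nbhs_enormP[r2 r20 r2P] : \forall y \near x, forall i : 'I_n,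
      `|gradient h y 0 i - gradient h x 0 i| <= e / n.+1%:R.
    apply: filter_forall => i; have [_ /(_ i)[_ ch]] := hC _ Ux.
    have /cont_enormP/(_ _ (divr_gt0 e0 n1))[r r0 rP] := ch.
    by apply/nbhs_enormP; exists r => // y /rP /ltW; rewrite !mxE.
  exists (Num.min r1 r2); first by rewrite lt_min r10.
  by move=> y; rewrite lt_min => /andP[/r1P ? /r2P].
exists r => // z zr.
have step (k : nat) : (k <= n)%N -> `|h (x + trunc k z) - h x -
    \sum_(i < n | (i < k)%N) gradient h x 0 i * z 0 i| <=
    (e / n.+1%:R) * \sum_(i < n | (i < k)%N) `|z 0 i|.
  elim: k => [|k IH] kn.
    rewrite !big1 // subr0 mulr0 (_ : trunc 0 z = 0) ?addr0 ?subrr ?normr0 //.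
    by apply/rowP => i; rewrite !mxE.
  have {IH} IH := IH (ltnW kn); pose K := Ordinal kn.
  have sumS (F : 'I_n -> R) :
      \sum_(i < n | (i < k.+1)%N) F i = \sum_(i < n | (i < k)%N) F i + F K.
    rewrite (bigD1 K) /=; last by rewrite ltnS.
    rewrite addrC; congr (_ + _); apply: eq_bigl => i.
    by rewrite ltnS leq_eqVlt -val_eqE /=; case: ltngtP.
  have inb s : 0 <= s <= 1 -> enorm (trunc k z + s *: (z 0 K *: delta_mx 0 K)) < r.
    move=> /andP[s0 s1]; apply: le_lt_trans zr; apply: dot_mono => i.
    rewrite !mxE eqxx /=; have [->|iK] := eqVneq i K.
      by rewrite ltnn add0r mulr1 normrM ger0_norm // ler_piMl.
    by rewrite !mulr0 addr0; case: ifP => _ //; rewrite normr0.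
  have [t t01|c c01] := @MVT_line R _ h (x + trunc k z) (z 0 K *: delta_mx 0 K)
     (fun t => z 0 K * gradient h (x + trunc k z + t *: (z 0 K *: delta_mx 0 K)) 0 K)
     0 1 ltr01.
    apply: is_deriveZv; apply: C1_partial hC _.
    by apply: (rP _ _).1; rewrite -(addrA x) [_ - x]addrC addKr; apply: inb.
  rewrite scale0r scale1r addr0 subr0 mulr1 -addrA -[k in trunc k]/(K : nat) -truncS /= => hE.
  rewrite !sumS mulrDr.
  have -> : h (x + trunc k.+1 z) = h (x + trunc k z) +
    z 0 K * gradient h (x + trunc k z + c *: (z 0 K *: delta_mx 0 K)) 0 K.
    by rewrite -hE [RHS]addrC subrK.
  set G := gradient h (_ + _) 0 K.
  have GE : `|G - gradient h x 0 K| <= e / n.+1%:R.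
    apply: (rP _ _).2; rewrite -(addrA x) [_ - x]addrC addKr; apply: inb.
    by case/andP: c01 => /ltW-> /ltW->.
  set S := \sum_(i < n | _) _.
  have -> : h (x + trunc k z) + z 0 K * G - h x - (S + gradient h x 0 K * z 0 K) =
    (h (x + trunc k z) - h x - S) + z 0 K * (G - gradient h x 0 K) by ring.
  apply: le_trans (ler_normD _ _) _; apply: lerD => //.
  by rewrite normrM mulrC ler_wpM2r.
have := step n (leqnn n).
rewrite (_ : trunc n z = z); last by apply/rowP => i; rewrite mxE ltn_ord.
rewrite (eq_bigl xpredT) => [|i]; last by rewrite ltn_ord.
rewrite [X in _ <= _ * X](eq_bigl xpredT) => [|i]; last by rewrite ltn_ord.
move=> /le_trans; apply; rewrite -mulrA ler_pM2l // mulrC ler_pdivrMr //.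
apply: le_trans (sum_le_enorm z) _; rewrite mulrC ler_wpM2l ?enorm_ge0 //.
by rewrite ler_nat.
Qed.

Lemma C1_derive U h x v : open U -> C1on U h -> U x ->
  is_derive x v h (dot (gradient h x) v).
Proof.
move=> oU hC Ux; apply/is_derive_epsP => e e0.
have v1 : 0 < enorm v + 1 by rewrite ltr_pwDr // enorm_ge0.
have [r r0 rP] := C1_frechet oU hC Ux (divr_gt0 e0 v1).
exists (r / (enorm v + 1)) => [|t tr]; first exact: divr_gt0.
have tv : enorm (t *: v) <= `|t| * (enorm v + 1).
  by rewrite enormZ ler_wpM2l // lerDl.
have := rP (t *: v); rewrite dotZr => /(_ _)/le_trans; apply.
  by apply: le_lt_trans tv _; rewrite -ltr_pdivlMr.
rewrite -mulrA ler_pM2l // mulrC ler_pdivrMr //.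
Qed.

Definition qform (A : 'M[R]_n) z : R := \sum_i \sum_j A i j * (z 0 i * z 0 j).

Lemma qformZ A (t : R) z : qform A (t *: z) = t ^+ 2 * qform A z.
Proof.
rewrite mulr_sumr; apply: eq_bigr => i _; rewrite mulr_sumr; apply: eq_bigr => j _.
by rewrite !mxE; ring.
Qed.

(** A single mean value step for the remainder along the segment leads to the gradient at an
    intermediate point [x + c z]; expanding each partial derivative there by [C1_frechet] cancels
    the quadratic term exactly. *)
Lemma taylor2 U h x e : open U -> C2on U h -> U x -> 0 < e ->
  exists2 r, 0 < r & forall z, enorm z < r ->
    `|h (x + z) - h x - dot (gradient h x) z - qform (hessian h x) z / 2| <=
      e * enorm z ^+ 2.
Proof.
move=> oU [hC hCC] Ux e0; have n1 : (0 : R) < n.+1%:R by [].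
have [r r0 rP] : exists2 r, 0 < r & forall z, enorm z < r -> U (x + z) /\
    forall i, `|partial i h (x + z) - partial i h x -
      dot (gradient (partial i h) x) z| <= e / n.+1%:R * enorm z.
  have /nbhs_enormP[r1 r10 r1P] : nbhs x U by apply: open_nbhs_nbhs.
  have /nbhs_enormP[r2 r20 r2P] : \forall y \near x, forall i : 'I_n,
      `|partial i h y - partial i h x -
      dot (gradient (partial i h) x) (y - x)| <= e / n.+1%:R * enorm (y - x).
    apply: filter_forall => i.
    have [r r0 rP] := C1_frechet oU (hCC i) Ux (divr_gt0 e0 n1).
    by apply/nbhs_enormP; exists r => // y /rP; rewrite [x + _]addrC subrK.
  exists (Num.min r1 r2); first by rewrite lt_min r10.
  move=> z; rewrite lt_min => /andP[z1 z2].
  have xz : x + z - x = z by rewrite addrAC subrr add0r.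
  split; first by apply: r1P; rewrite /eball /= xz.
  by move=> i; have := r2P (x + z); rewrite /eball /= xz => /(_ z2 i).
exists r => // z zr.
have tz t : 0 <= t <= 1 -> enorm (t *: z) < r.
  move=> /andP[t0 t1]; apply: le_lt_trans zr; rewrite enormZ ger0_norm //.
  by rewrite ler_piMl ?enorm_ge0.
pose Q := qform (hessian h x) z.
pose rem (t : R) := h (x + t *: z) - (t * dot (gradient h x) z + t ^+ 2 / 2 * Q).
have dquad (t : R) : is_derive t 1 (fun s : R => s * dot (gradient h x) z + s ^+ 2 / 2 * Q)
    (dot (gradient h x) z + t * Q).
  have := is_derive_quad 0 (dot (gradient h x) z) (Q / 2) 0 t.
  rewrite subr0 (_ : 2 * (Q / 2) * t = t * Q); last by field.
  rewrite (_ : (fun s => _) = fun s : R => s * dot (gradient h x) z + s ^+ 2 / 2 * Q) //.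
  by apply/funext => s; field.
have [t t01|c c01] := @MVT1 R rem (fun t => dot (gradient h (x + t *: z)) z -
    (dot (gradient h x) z + t * Q)) 0 1 ltr01.
  have dh : is_derive t 1 (fun s : R => h (x + s *: z)) (dot (gradient h (x + t *: z)) z).
    apply: (@is_derive_line _ _ h x z _ t).1; apply: C1_derive oU hC _.
    exact: (rP _ (tz _ t01)).1.
  exact: is_deriveB dh (dquad t).
rewrite subr0 mulr1 /rem scale1r scale0r addr0 expr1n expr0n /= !mul0r !mul1r addr0 subr0 => hE.
have c01' : 0 <= c <= 1 by case/andP: c01 => /ltW-> /ltW->.
have -> : h (x + z) - h x - dot (gradient h x) z - Q / 2 =
  dot (gradient h (x + c *: z)) z - dot (gradient h x) z - c * Q.
  by move: hE; lra.
have -> : dot (gradient h (x + c *: z)) z - dot (gradient h x) z - c * Q =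
   \sum_i z 0 i * (partial i h (x + c *: z) - partial i h x -
      dot (gradient (partial i h) x) (c *: z)).
  rewrite /dot -sumrB /Q mulr_sumr -sumrB; apply: eq_bigr => i _.
  rewrite !mxE !mulrBr [z 0 i * partial i h _]mulrC [z 0 i * partial i h x]mulrC.
  congr (_ - _); rewrite !mulr_sumr; apply: eq_bigr => j _.
  by rewrite !mxE; ring.
apply: le_trans (ler_norm_sum _ _ _) _.
have bnd i : `|z 0 i * (partial i h (x + c *: z) - partial i h x -
      dot (gradient (partial i h) x) (c *: z))| <= e / n.+1%:R * enorm z ^+ 2.
  rewrite normrM; apply: le_trans (ler_wpM2l _ ((rP _ (tz _ c01')).2 i)) _ => //.
  rewrite mulrCA expr2 ler_pM2l ?divr_gt0 //.
  apply: ler_pM => //; rewrite ?enorm_ge0 ?coord_le_enorm // enormZ.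
  by case/andP: c01' => c0 c1; rewrite ger0_norm // ler_piMl ?enorm_ge0.
apply: le_trans (ler_sum _ (fun i _ => bnd i)) _.
rewrite sumr_const card_ord -[leLHS]mulr_natr mulrAC ler_wpM2r ?sqr_ge0 //.
by rewrite -mulrA ger_pMr // mulrC ler_pdivrMr // mul1r ler_nat.
Qed.

(* Add Taylor's formulas at [x + t e] and [x - t e]. *)
Lemma second_derive_max U h x i r : open U -> C2on U h -> U x -> 0 < r ->
  (forall y, enorm (y - x) < r -> h y <= h x) -> partial i (partial i h) x <= 0.
Proof.
move=> oU hC Ux r0 hmax; apply/ler_addgt0Pr => e e0; rewrite add0r.
have [|s s0 sP] := taylor2 oU hC Ux (_ : 0 < e / 2); first by rewrite divr_gt0.
pose t := Num.min r s / 2.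
have t0 : 0 < t by rewrite divr_gt0 // lt_min r0.
have : t < Num.min r s by rewrite ltr_pdivrMr // ltr_pMr ?ltr1n // lt_min r0.
rewrite lt_min => /andP[tr ts].
have H (b : R) : `|b| = 1 -> b * t * partial i h x +
    t ^+ 2 / 2 * partial i (partial i h) x <= e / 2 * t ^+ 2.
  move=> b1; have b2 : b ^+ 2 = 1 by rewrite -real_normK ?num_real // b1 expr1n.
  have en : enorm ((b * t) *: (delta_mx 0 i : 'rV[R]_n)) = t.
    by rewrite enormZ enorm_delta mulr1 normrM b1 mul1r gtr0_norm.
  have := hmax (x + (b * t) *: delta_mx 0 i).
  rewrite addrAC subrr add0r en => /(_ tr) h1.
  have := sP ((b * t) *: delta_mx 0 i); rewrite en => /(_ ts).
  rewrite dotZr dot_delta qformZ mxE (_ : qform _ _ = partial i (partial i h) x).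
    rewrite ler_norml => /andP[h2 _]; move: h2.
    have -> : (b * t) ^+ 2 = b ^+ 2 * t ^+ 2 by ring.
    rewrite b2; lra.
  rewrite /qform (bigD1 i) //= (bigD1 i) //= !mxE !eqxx !mulr1 !big1 ?addr0 //.
    move=> k ki; rewrite big1 // => j _; rewrite !mxE (negPf ki) andbF mul0r mulr0 //.
  by move=> k ki; rewrite !mxE (negPf ki) andbF !mulr0.
have := H 1 (normr1 _); have := H (-1) (normrN1 _) => h1 h2.
have : t ^+ 2 * partial i (partial i h) x <= t ^+ 2 * e by lra.
by rewrite ler_pM2l // exprn_gt0.
Qed.

End Differential.

Section PartialEq.
Variables (R : realType) (n : nat).

Lemma partial_eq (h : 'rV[R]_n -> R) x (i : 'I_n) d :
  is_derive x (delta_mx 0 i) h d -> partial i h x = d.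
Proof. exact: derive_eq. Qed.

End PartialEq.

(* Unification would otherwise unfold [partial] down to limits of filters. *)
Opaque partial.

(** * Polynomial functions *)

Section Polynomials.
Variables (R : realType) (n : nat).
Implicit Types (p q : 'rV[R]_n -> R) (x y z : 'rV[R]_n).

(** Homogeneous polynomial functions, generated by how they are built so that facts follow by
    induction. [hpoly_0] puts zero in every degree, because derivatives may vanish. The grading
    serves Euler's identity and the Fischer decomposition. *)
Inductive hpoly : nat -> ('rV[R]_n -> R) -> Prop :=
| hpoly_cst c : hpoly 0 (fun=> c)
| hpoly_X k i p : hpoly k p -> hpoly k.+1 (fun x => x 0 i * p x)
| hpoly_D k p q : hpoly k p -> hpoly k q -> hpoly k (fun x => p x + q x)
| hpoly_0 k : hpoly k (fun=> 0).

Inductive polyf : ('rV[R]_n -> R) -> Prop :=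
| polyf_h k p : hpoly k p -> polyf p
| polyf_D p q : polyf p -> polyf q -> polyf (fun x => p x + q x).

Lemma hpoly_M k l p q : hpoly k p -> hpoly l q ->
  hpoly (k + l) (fun x => p x * q x).
Proof.
elim=> {k p} [c|k i p hp IH|k p p' hp IH hp' IH'|k] hq.
- elim: hq => {l q} [c'|k i p hp IH|k p p' hp IH hp' IH'|k].
  + exact: hpoly_cst.
  + rewrite (_ : (fun x => _) = fun x => x 0 i * (c * p x)).
      exact: hpoly_X.
    by apply/funext => x; rewrite mulrCA.
  + rewrite (_ : (fun x => _) = fun x => c * p x + c * p' x).
      exact: hpoly_D.
    by apply/funext => x; rewrite mulrDr.
  + rewrite (_ : (fun x => _) = fun=> 0); first exact: hpoly_0.
    by apply/funext => x; rewrite mulr0.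
- rewrite (_ : (fun x => _) = fun x => x 0 i * (p x * q x)).
    by rewrite addSn; exact/hpoly_X/IH.
  by apply/funext => x; rewrite mulrA.
- rewrite (_ : (fun x => _) = fun x => p x * q x + p' x * q x).
    by apply: hpoly_D; [exact: IH|exact: IH'].
  by apply/funext => x; rewrite mulrDl.
- rewrite (_ : (fun x => _) = fun=> 0); first exact: hpoly_0.
  by apply/funext => x; rewrite mul0r.
Qed.

Lemma hpoly_Z k p c : hpoly k p -> hpoly k (fun x => c * p x).
Proof. by move=> hp; apply: (hpoly_M (hpoly_cst c) hp). Qed.

Lemma hpoly_sum (I : Type) (s : seq I) k (F : I -> 'rV[R]_n -> R) :
  (forall i, hpoly k (F i)) -> hpoly k (fun x => \sum_(i <- s) F i x).
Proof.
move=> hF; elim: s => [|i s IH].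
  rewrite (_ : (fun x => _) = fun=> 0); first exact: hpoly_0.
  by apply/funext => x; rewrite big_nil.
rewrite (_ : (fun x => _) = fun x => F i x + \sum_(j <- s) F j x).
  exact: hpoly_D.
by apply/funext => x; rewrite big_cons.
Qed.

Lemma hpoly_coord i : hpoly 1 (fun x => x 0 i).
Proof.
rewrite (_ : (fun x => _) = fun x => x 0 i * 1); first exact/hpoly_X/hpoly_cst.
by apply/funext => x; rewrite mulr1.
Qed.

Lemma hpoly_dot a : hpoly 1 (dot a).
Proof. by apply: hpoly_sum => i; apply/hpoly_Z/hpoly_coord. Qed.

Lemma hpoly_sqnorm : hpoly 2 (fun x => dot x x).
Proof. by apply: hpoly_sum => i; apply: (hpoly_M (hpoly_coord i) (hpoly_coord i)). Qed.

Lemma hpoly_qform A : hpoly 2 (qform A).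
Proof.
apply: hpoly_sum => i; apply: hpoly_sum => j; apply: hpoly_Z.
exact: (hpoly_M (hpoly_coord i) (hpoly_coord j)).
Qed.

Lemma polyf_cst c : polyf (fun=> c).
Proof. exact: polyf_h (hpoly_cst c). Qed.

Lemma polyf_coord i : polyf (fun x => x 0 i).
Proof. exact: polyf_h (hpoly_coord i). Qed.

Lemma polyf_M p q : polyf p -> polyf q -> polyf (fun x => p x * q x).
Proof.
elim=> {p} [k p hp|p p' hp IH hp' IH'] hq.
  elim: hq => {q} [l q hq|q q' hq IH hq' IH'].
    exact: polyf_h (hpoly_M hp hq).
  rewrite (_ : (fun x => _) = fun x => p x * q x + p x * q' x).
    exact: polyf_D.
  by apply/funext => x; rewrite mulrDr.
rewrite (_ : (fun x => _) = fun x => p x * q x + p' x * q x).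
  by apply: polyf_D; [exact: IH|exact: IH'].
by apply/funext => x; rewrite mulrDl.
Qed.

Lemma polyf_Z p c : polyf p -> polyf (fun x => c * p x).
Proof. by move=> hp; apply: polyf_M => //; exact: polyf_cst. Qed.

Lemma polyf_N p : polyf p -> polyf (fun x => - p x).
Proof.
move=> hp; rewrite (_ : (fun x => _) = fun x => -1 * p x); first exact: polyf_Z.
by apply/funext => x; rewrite mulN1r.
Qed.

Lemma polyf_B p q : polyf p -> polyf q -> polyf (fun x => p x - q x).
Proof. by move=> hp hq; apply: polyf_D => //; exact: polyf_N. Qed.

Lemma polyf_X p k : polyf p -> polyf (fun x => p x ^+ k).
Proof.
move=> hp; elim: k => [|k IH].
  rewrite (_ : (fun x => _) = fun=> 1); first exact: polyf_cst.
  by apply/funext => x; rewrite expr0.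
rewrite (_ : (fun x => _) = fun x => p x * p x ^+ k); first exact: polyf_M.
by apply/funext => x; rewrite exprS.
Qed.

Lemma polyf_sum (I : Type) (s : seq I) (F : I -> 'rV[R]_n -> R) :
  (forall i, polyf (F i)) -> polyf (fun x => \sum_(i <- s) F i x).
Proof.
move=> hF; elim: s => [|i s IH].
  rewrite (_ : (fun x => _) = fun=> 0); first exact: polyf_cst.
  by apply/funext => x; rewrite big_nil.
rewrite (_ : (fun x => _) = fun x => F i x + \sum_(j <- s) F j x).
  exact: polyf_D.
by apply/funext => x; rewrite big_cons.
Qed.

Lemma polyf_comp p (T : 'rV[R]_n -> 'rV[R]_n) :
  (forall i, polyf (fun x => T x 0 i)) -> polyf p -> polyf (fun x => p (T x)).
Proof.
move=> hT; elim=> {p} [k p|p p' _ IH _ IH']; last exact: (polyf_D IH IH').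
elim=> {k p} [c|k i p _ IH|k p p' _ IH _ IH'|k].
- exact: polyf_cst.
- exact: (polyf_M (hT i) IH).
- exact: (polyf_D IH IH').
- exact: polyf_cst.
Qed.

Lemma polyf_affine p a y : polyf p -> polyf (fun x => p (y + a *: x)).
Proof.
apply: polyf_comp => i.
rewrite (_ : (fun x => _) = fun x => y 0 i + a * x 0 i).
  exact: (polyf_D (polyf_cst _) (polyf_Z _ (polyf_coord i))).
by apply/funext => x; rewrite !mxE.
Qed.

Lemma polyf_shift p y : polyf p -> polyf (fun x => p (x + y)).
Proof.
move=> /(polyf_affine 1 y); congr polyf.
by apply/funext => x; rewrite scale1r addrC.
Qed.

Lemma polyf_dot a : polyf (dot a).
Proof. exact: polyf_h (hpoly_dot a). Qed.

Lemma polyf_qform A : polyf (qform A).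
Proof. exact: polyf_h (hpoly_qform A). Qed.

Lemma polyf_sqnorm : polyf (fun x => dot x x).
Proof. exact: polyf_h hpoly_sqnorm. Qed.

Lemma is_derive_coord x v i : is_derive x v (fun y => y 0 i) (v 0 i).
Proof.
apply/is_derive_epsP => e e0; exists 1 => // t _.
rewrite !mxE (_ : _ - _ = 0); last by ring.
by rewrite normr0 mulr_ge0 // ltW.
Qed.

(** In degree zero the derivative is said to vanish rather than to have a degree: for [hpoly_X] over
    a constant, the term [x 0 j * partial i p x] must again have degree zero, and only the vanishing
    gives this. *)
Lemma hpoly_derive k p (i : 'I_n) : hpoly k p ->
  (forall x, is_derive x (delta_mx 0 i) p (partial i p x)) /\
  if k is k'.+1 then hpoly k' (partial i p) else partial i p = fun=> 0.
Proof.
elim=> {k p} [c|k j p hp [IHd IH]|k p p' hp [IHd IH] hp' [IHd' IH']|k].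
- have h x : is_derive x (delta_mx 0 i) (fun=> c : R) 0 by exact: is_derive_cst.
  by split=> [x|]; [|apply/funext => x]; rewrite (partial_eq (h x)).
- have h x : is_derive x (delta_mx 0 i) (fun x => x 0 j * p x)
      (x 0 j * partial i p x + p x * (i == j)%:R).
    have h1 := is_derive_coord x (delta_mx 0 i) j.
    have h2 := IHd x; have := is_deriveM h1 h2.
    by rewrite mxE eqxx [j == i]eq_sym /=.
  have E : partial i (fun x => x 0 j * p x) =
      (fun x => x 0 j * partial i p x + (i == j)%:R * p x).
    by apply/funext => x; rewrite (partial_eq (h x)) mulrC [_ * p x]mulrC.
  split=> [x|]; first by rewrite E mulrC [_ * p x]mulrC mulrC; exact: h.
  rewrite E; apply: hpoly_D; last exact: hpoly_Z.
  case: k hp IH => [|k] hp IH; last exact: hpoly_X.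
  rewrite IH (_ : (fun x => _) = fun=> 0); first exact: hpoly_0.
  by apply/funext => x; rewrite mulr0.
- have h x : is_derive x (delta_mx 0 i) (fun x => p x + p' x)
      (partial i p x + partial i p' x).
    by apply: is_deriveD.
  have E : partial i (fun x => p x + p' x) = (fun x => partial i p x + partial i p' x).
    by apply/funext => x; rewrite (partial_eq (h x)).
  split=> [x|]; first by rewrite E.
  rewrite E; case: k hp hp' IH IH' => [|k] hp hp' IH IH'; last exact: hpoly_D.
  by rewrite IH IH'; apply/funext => x; rewrite addr0.
- have h x : is_derive x (delta_mx 0 i) (fun=> 0 : R) 0 by exact: is_derive_cst.
  have E : partial i (fun=> 0 : R) = (fun=> 0).
    by apply/funext => x; rewrite (partial_eq (h x)).
  by split=> [x|]; rewrite E //; case: k => // k; exact: hpoly_0.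
Qed.

Lemma polyf_derive p i : polyf p ->
  (forall x, is_derive x (delta_mx 0 i) p (partial i p x)) /\
  polyf (partial i p).
Proof.
elim=> {p} [k p hp|p p' _ [IHd IH] _ [IHd' IH']].
  have [h1 h2] := hpoly_derive i hp; split=> //.
  by case: k hp h2 => [|k] _; [move=> ->; exact: polyf_cst|exact: polyf_h].
have h x : is_derive x (delta_mx 0 i) (fun x => p x + p' x)
    (partial i p x + partial i p' x) by apply: is_deriveD.
have -> : partial i (fun x => p x + p' x) = (fun x => partial i p x + partial i p' x).
  by apply/funext => x; rewrite (partial_eq (h x)).
by split=> //; exact: polyf_D.
Qed.

Lemma polyf_cont p x : polyf p -> {for x, continuous p}.
Proof.
have cc i : {for x, continuous (fun x : 'rV[R]_n => x 0 i)}.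
  exact: coord_continuous.
elim=> {p} [k p|p p' _ IH _ IH']; last exact: (continuousD IH IH').
elim=> {k p} [c|k i p _ IH|k p p' _ IH _ IH'|k].
- exact: cst_continuous.
- exact: (continuousM (cc i) IH).
- exact: (continuousD IH IH').
- exact: cst_continuous.
Qed.

Lemma polyf_C1 p U : polyf p -> C1on U p.
Proof.
move=> hp x _; split=> [|i]; first exact: polyf_cont.
have [dp hpp] := polyf_derive i hp.
by split; [case: (dp x)|exact: polyf_cont].
Qed.

Lemma polyf_C2 p U : polyf p -> C2on U p.
Proof.
by move=> hp; split=> [|i]; apply: polyf_C1 => //; apply: (polyf_derive i hp).2.
Qed.

Lemma polyf_C2_near p x : polyf p -> C2_near x p.
Proof.
move=> hp; exists setT; first by split=> //; exact: openT.
by apply/Ck2P; [exact: openT|exact: polyf_C2].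
Qed.

Lemma partial_cst c i : partial i (fun=> c) = (fun=> 0) :> ('rV[R]_n -> R).
Proof.
apply/funext => x; apply: partial_eq; exact: is_derive_cst.
Qed.

Lemma partial_coord j i x : partial i (fun x : 'rV[R]_n => x 0 j) x = (i == j)%:R.
Proof.
rewrite (partial_eq (is_derive_coord x (delta_mx 0 i) j)).
by rewrite mxE eqxx eq_sym.
Qed.

Lemma partialD p q i : polyf p -> polyf q ->
  partial i (fun x => p x + q x) = (fun x => partial i p x + partial i q x).
Proof.
move=> hp hq; apply/funext => x; apply: partial_eq.
by apply: is_deriveD; exact: (polyf_derive i _).1.
Qed.

Lemma partialM p q i : polyf p -> polyf q ->
  partial i (fun x => p x * q x) =
  (fun x => partial i p x * q x + p x * partial i q x).
Proof.
move=> hp hq; apply/funext => x; apply: partial_eq.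
have h := is_deriveM ((polyf_derive i hp).1 x) ((polyf_derive i hq).1 x).
by rewrite addrC [partial i p x * _]mulrC.
Qed.

Lemma partialZ p c i : polyf p ->
  partial i (fun x => c * p x) = (fun x => c * partial i p x).
Proof.
move=> hp; rewrite (partialM _ (polyf_cst c)) // partial_cst.
by apply/funext => x; rewrite mul0r add0r.
Qed.

Lemma partialN p i : polyf p ->
  partial i (fun x => - p x) = (fun x => - partial i p x).
Proof.
move=> hp; rewrite (_ : (fun x => - p x) = fun x => -1 * p x).
  by rewrite partialZ //; apply/funext => x; rewrite mulN1r.
by apply/funext => x; rewrite mulN1r.
Qed.

Lemma partialB p q i : polyf p -> polyf q ->
  partial i (fun x => p x - q x) = (fun x => partial i p x - partial i q x).
Proof. by move=> hp hq; rewrite partialD ?partialN //; exact: polyf_N. Qed.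

Lemma lapD p q x : polyf p -> polyf q ->
  laplacian (fun x => p x + q x) x = laplacian p x + laplacian q x.
Proof.
move=> hp hq; rewrite -big_split; apply: eq_bigr => i _ /=.
by rewrite !partialD //; exact: (polyf_derive i _).2.
Qed.

Lemma lapZ p c x : polyf p ->
  laplacian (fun x => c * p x) x = c * laplacian p x.
Proof.
move=> hp; rewrite mulr_sumr; apply: eq_bigr => i _ /=.
by rewrite !partialZ //; exact: (polyf_derive i _).2.
Qed.

Lemma lapN p x : polyf p -> laplacian (fun x => - p x) x = - laplacian p x.
Proof.
move=> hp; rewrite (_ : (fun x => - p x) = fun y => -1 * p y).
  by rewrite lapZ // mulN1r.
by apply/funext => y; rewrite mulN1r.
Qed.

Lemma lapB p q x : polyf p -> polyf q ->
  laplacian (fun x => p x - q x) x = laplacian p x - laplacian q x.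
Proof. by move=> hp hq; rewrite lapD ?lapN //; exact: polyf_N. Qed.

Lemma lap_cst c x : laplacian (fun=> c : R) x = 0.
Proof. by rewrite /laplacian big1 // => i _; rewrite !partial_cst. Qed.

Lemma lapM p q x : polyf p -> polyf q ->
  laplacian (fun x => p x * q x) x = laplacian p x * q x +
    2 * dot (gradient p x) (gradient q x) + p x * laplacian q x.
Proof.
move=> hp hq; rewrite /laplacian /dot !mulr_suml !mulr_sumr -!big_split.
apply: eq_bigr => i _ /=; have pp := (polyf_derive i hp).2.
have pq := (polyf_derive i hq).2.
rewrite (partialM i hp hq) (partialD i (polyf_M pp hq) (polyf_M hp pq)).
rewrite (partialM i pp hq) (partialM i hp pq) /gradient !mxE.
move: (partial i p x) (partial i q x) (partial i (partial i p) x)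
  (partial i (partial i q) x) => a b c d; ring.
Qed.

Lemma polyf_lap p : polyf p -> polyf (laplacian p).
Proof.
move=> hp; apply: polyf_sum => i; apply: (polyf_derive i _).2.
exact: (polyf_derive i _).2.
Qed.

Lemma is_derive_comp_affine p x v y (a d : R) : is_derive (y + a *: x) v p d ->
  is_derive x v (fun x => p (y + a *: x)) (a * d).
Proof.
move=> h; have /is_derive_epsP {}h := is_deriveZv a h.
apply/is_derive_epsP => e /h[r r0 rP]; exists r => // t /rP.
by rewrite scalerDr addrA scalerA mulrC -scalerA.
Qed.

Lemma partial_affine p y a i : polyf p ->
  partial i (fun x => p (y + a *: x)) = (fun x => a * partial i p (y + a *: x)).
Proof.
move=> hp; apply/funext => x; apply: partial_eq; apply: is_derive_comp_affine.
exact: (polyf_derive i hp).1.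
Qed.

Lemma partial_shift p y i : polyf p ->
  partial i (fun x => p (x + y)) = (fun x => partial i p (x + y)).
Proof.
move=> hp; have := @partial_affine p y 1 i hp.
under eq_fun do rewrite scale1r addrC; move=> ->.
by apply/funext => x; rewrite mul1r scale1r addrC.
Qed.

Lemma lap_shift p y x : polyf p ->
  laplacian (fun x => p (x + y)) x = laplacian p (x + y).
Proof.
move=> hp; apply: eq_bigr => i _; rewrite !partial_shift //.
exact: (polyf_derive i hp).2.
Qed.

Lemma partial_dot (a : 'rV[R]_n) i : partial i (dot a) = fun=> a 0 i.
Proof.
apply/funext => x; apply: partial_eq; rewrite -(dot_delta a i).
apply/is_derive_epsP => e e0; exists 1 => // t _.
rewrite !dotE (_ : _ - _ = 0); last by ring.
by rewrite normr0 mulr_ge0 // ltW.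
Qed.

Lemma partial_sqnorm i : partial i (fun x : 'rV[R]_n => dot x x) = fun x => 2 * x 0 i.
Proof.
apply/funext => x; apply: partial_eq; apply/is_derive_epsP => e e0; exists e => // t te.
rewrite !dotE (dotC _ x) !dot_delta mxE !eqxx /=.
rewrite (_ : _ - _ = t * t); last by ring.
by rewrite normrM ler_wpM2r // ltW.
Qed.

Lemma gradient_sqnorm x : gradient (fun x : 'rV[R]_n => dot x x) x = 2 *: x.
Proof. by apply/rowP => i; rewrite mxE partial_sqnorm mxE. Qed.

Lemma lap_sqnorm x : laplacian (fun x : 'rV[R]_n => dot x x) x = 2 * n%:R.
Proof.
rewrite /laplacian (eq_bigr (fun=> 2)) ?sumr_const ?card_ord ?mulr_natr // => i _.
by rewrite partial_sqnorm partialZ ?partial_coord ?eqxx ?mulr1 //; exact: polyf_coord.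
Qed.

Lemma lap_dot (a : 'rV[R]_n) x : laplacian (dot a) x = 0.
Proof. by rewrite /laplacian big1 // => i _; rewrite partial_dot partial_cst. Qed.

Lemma partial_qform A i x : partial i (qform A) x = \sum_j (A i j + A j i) * x 0 j.
Proof.
apply: partial_eq; apply/is_derive_epsP => e e0.
exists (e / (`|A i i| + 1)) => [|t te]; first by rewrite divr_gt0 // ltr_pwDr.
have -> : qform A (x + t *: delta_mx 0 i) - qform A x -
   t * (\sum_j (A i j + A j i) * x 0 j) = t * t * A i i.
  have D (k : 'I_n) : (x + t *: delta_mx 0 i) 0 k = x 0 k + t * (k == i)%:R.
    by rewrite !mxE eqxx.
  have S1 (F : 'I_n -> R) : \sum_k F k * (k == i)%:R = F i.
    rewrite (bigD1 i) //= eqxx mulr1 big1 ?addr0 // => k /negPf ->.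
    by rewrite mulr0.
  rewrite /qform; have -> : \sum_k \sum_l A k l * ((x + t *: delta_mx 0 i) 0 k *
      (x + t *: delta_mx 0 i) 0 l) = \sum_k \sum_l A k l * (x 0 k * x 0 l) +
     t * \sum_k (\sum_l A k l * x 0 l) * (k == i)%:R +
     t * \sum_k \sum_l (A k l * x 0 k) * (l == i)%:R +
     t * t * \sum_k (\sum_l A k l * (l == i)%:R) * (k == i)%:R.
    rewrite !mulr_sumr -!big_split; apply: eq_bigr => k _ /=.
    rewrite !mulr_suml !mulr_sumr -!big_split; apply: eq_bigr => l _ /=.
    by rewrite !D; ring.
  rewrite !S1 (_ : \sum_k \sum_l A k l * x 0 k * (l == i)%:R = \sum_k A k i * x 0 k).
    rewrite (_ : \sum_j (A i j + A j i) * x 0 j =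
      \sum_j A i j * x 0 j + \sum_j A j i * x 0 j); first by ring.
    by rewrite -big_split; apply: eq_bigr => j _; rewrite mulrDl.
  by apply: eq_bigr => k _; rewrite (S1 (fun l => A k l * x 0 k)).
rewrite normrM normrM mulrAC ler_wpM2r //.
have a1 : 0 < `|A i i| + 1 by rewrite ltr_pwDr.
move: te; rewrite ltr_pdivlMr // => /ltW; apply: le_trans.
by rewrite ler_wpM2l // lerDl.
Qed.

Lemma lap_qform A x : laplacian (qform A) x = 2 * \tr A.
Proof.
rewrite /mxtrace mulr_sumr; apply: eq_bigr => i _.
rewrite (_ : partial i (qform A) = dot (\row_j (A i j + A j i))).
  by rewrite partial_dot mxE; ring.
apply/funext => y; rewrite partial_qform; apply: eq_bigr => j _.
by rewrite mxE.
Qed.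

Lemma euler k p x : hpoly k p -> dot x (gradient p x) = k%:R * p x.
Proof.
elim=> {k p} [c|k j p hp IH|k p p' hp IH hp' IH'|k].
- by rewrite mul0r /dot big1 // => i _; rewrite mxE partial_cst mulr0.
- have fp := polyf_h hp.
  have -> : gradient (fun x => x 0 j * p x) x =
      p x *: delta_mx 0 j + x 0 j *: gradient p x.
    apply/rowP => i; rewrite !mxE partialM //; last exact: polyf_coord.
    by rewrite partial_coord eqxx mulrC.
  by rewrite !dotE dot_delta IH -natr1; ring.
- rewrite mulrDr -IH -IH' -dotDr; congr dot; apply/rowP => i.
  by rewrite !mxE (partialD _ (polyf_h hp) (polyf_h hp')).
- by rewrite mulr0 /dot big1 // => i _; rewrite mxE partial_cst mulr0.
Qed.

End Polynomials.

(** * The Dirichlet problem on balls with polynomial data *)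

Section Dirichlet.
Variables (R : realType) (n : nat).
Implicit Types (p q : 'rV[R]_n -> R) (x y z : 'rV[R]_n).
Let sq : 'rV[R]_n -> R := fun x => dot x x.

Lemma hpoly_lap k p : hpoly k p ->
  if k is k'.+2 then hpoly k' (laplacian p) else laplacian p = fun=> 0.
Proof.
move=> hp; have H i := (hpoly_derive i hp).2.
case: k hp H => [|[|k]] hp H.
- by apply/funext => x; rewrite /laplacian big1 // => i _; rewrite H partial_cst.
- apply/funext => x; rewrite /laplacian big1 // => i _.
  by rewrite (hpoly_derive i (H i)).2.
- by apply: hpoly_sum => i; apply: (hpoly_derive i (H i)).2.
Qed.

(** The cross term of the product rule is 4 x . grad p, which is 4 k p by Euler's identity. *)
Lemma lap_sqnormM k p x : hpoly k p ->
  laplacian (fun x => sq x * p x) x =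
    (2 * n%:R + 4 * k%:R) * p x + sq x * laplacian p x.
Proof.
move=> hp; rewrite lapM ?lap_sqnorm ?gradient_sqnorm; last 2 first.
- exact: polyf_sqnorm.
- exact: polyf_h hp.
by rewrite dotZl (euler x hp); ring.
Qed.

Lemma hpoly_sqXM k p m : hpoly k p -> hpoly (m.*2 + k) (fun x => sq x ^+ m * p x).
Proof.
move=> hp; elim: m => [|m IH].
  by rewrite (_ : (fun x => _) = p) //; apply/funext => x; rewrite mul1r.
rewrite (_ : (fun x => _) = fun x => sq x * (sq x ^+ m * p x)).
  exact: (hpoly_M (hpoly_sqnorm _ _) IH).
by apply/funext => x; rewrite exprS mulrA.
Qed.

Lemma lap_sqnormXM k p m : (0 < n)%N -> hpoly k p -> exists2 c, 0 < c &
  forall x, laplacian (fun x => sq x ^+ m.+1 * p x) x =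
    c * (sq x ^+ m * p x) + sq x ^+ m.+1 * laplacian p x.
Proof.
move=> n0 hp; have n0' : 0 < 2 * n%:R :> R by rewrite mulr_gt0 // ltr0n.
elim: m => [|m [c c0 IH]].
  exists (2 * n%:R + 4 * k%:R) => [|x]; first by rewrite ltr_pwDl // mulr_ge0.
  rewrite expr0 mul1r expr1 -(lap_sqnormM x hp).
  by rewrite (_ : (fun x => _) = fun x => sq x * p x).
exists (2 * n%:R + 4 * (m.+1.*2 + k)%:R + c) => [|x].
  by rewrite addr_gt0 // ltr_pwDl // mulr_ge0.
rewrite (_ : (fun x => _) = fun x => sq x * (sq x ^+ m.+1 * p x)); last first.
  by apply/funext => y; rewrite exprS mulrA.
rewrite (lap_sqnormM _ (hpoly_sqXM m.+1 hp)) IH.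
by rewrite ![sq x ^+ _.+1]exprS; ring.
Qed.

(* Fischer decomposition: [q |-> lap (|x|^2 q)] is onto in each degree. The factor
   [|x|^2j] strengthens the statement enough for an induction on the degree. *)
Lemma fischer k p j : (0 < n)%N -> hpoly k p -> exists2 q, hpoly (j.*2 + k) q &
  forall x, laplacian (fun x => sq x * q x) x = sq x ^+ j * p x.
Proof.
move=> n0; elim/ltn_ind: k p j => k IH p j hp.
have [c c0 cE] := lap_sqnormXM j n0 hp.
(* [q0] inverts the leading term of [cE]. The error it leaves is |x|^(2j+2) times [laplacian p], up
   to a constant; that factor has degree [k - 2], so the induction hypothesis at [j.+1] removes
   it. *)
pose q0 := fun x => c^-1 * (sq x ^+ j * p x).
have hq0 : hpoly (j.*2 + k) q0 by apply: hpoly_Z; exact: hpoly_sqXM.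
have E x : laplacian (fun x => sq x * q0 x) x =
    sq x ^+ j * p x + c^-1 * (sq x ^+ j.+1 * laplacian p x).
  rewrite (_ : (fun x => _) = fun x => c^-1 * (sq x ^+ j.+1 * p x)).
    rewrite lapZ ?cE; last exact: polyf_h (hpoly_sqXM j.+1 hp).
    by rewrite mulrDr mulKf // gt_eqF.
  by apply/funext => y; rewrite /q0 exprS; ring.
have [[hl k2]|[q1 hq1 q1E]] : (laplacian p = (fun=> 0)) /\ True \/
    exists2 q1, hpoly (j.*2 + k) q1 & forall x,
      laplacian (fun x => sq x * q1 x) x = sq x ^+ j.+1 * laplacian p x.
- have := hpoly_lap hp; case: k hp IH {E hq0 cE} => [|[|k]] hp IH; [by left..|].
  move=> hl; right; have [|q1 hq1 q1E] := IH k _ _ j.+1 hl; first by [].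
  by exists q1 => //; move: hq1; rewrite doubleS !addSn !addnS.
- by exists q0 => // x; rewrite E hl !mulr0 addr0.
exists (fun x => q0 x + (- c^-1) * q1 x).
  by apply: hpoly_D => //; exact: hpoly_Z.
move=> x; rewrite (_ : (fun x => _) =
    fun x => sq x * q0 x + (- c^-1) * (sq x * q1 x)); last first.
  by apply/funext => y; ring.
have f0 : polyf (fun x => sq x * q0 x) by apply: polyf_M (polyf_h hq0); exact: polyf_sqnorm.
have f1 : polyf (fun x => sq x * q1 x) by apply: polyf_M (polyf_h hq1); exact: polyf_sqnorm.
by rewrite lapD ?lapZ ?E ?q1E //; [ring|exact: polyf_Z].
Qed.

Lemma lap_bump (c : R) q x : polyf q -> laplacian (fun x => (c - sq x) * q x) x =
  c * laplacian q x - laplacian (fun x => sq x * q x) x.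
Proof.
move=> hq; rewrite (_ : (fun x => _) = fun x => c * q x - sq x * q x).
  rewrite lapB ?lapZ //; first exact: polyf_Z.
  by apply: polyf_M => //; exact: polyf_sqnorm.
by apply/funext => y; ring.
Qed.

(** The factor [c - sq x] vanishes on a sphere, so this is the Dirichlet problem with zero boundary
    values. The part - lap (|x|^2 q) preserves the degree and is inverted by [fischer] with [j = 0];
    the other part, c lap q, has degree lower by two and is treated by induction. *)
Lemma poisson_poly (c : R) p : (0 < n)%N -> polyf p -> exists2 q, polyf q &
  forall x, laplacian (fun x => (c - sq x) * q x) x = p x.
Proof.
move=> n0; elim=> {p} [k p|p p' _ [q hq qE] _ [q' hq' qE']]; last first.
  exists (fun x => q x + q' x) => [|x]; first exact: polyf_D.
  rewrite (_ : (fun x => _) =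
      fun y => (c - sq y) * q y + (c - sq y) * q' y); last first.
    by apply/funext => y; ring.
  have hc : polyf (fun y => c - sq y).
    by apply: polyf_B; [exact: polyf_cst|exact: polyf_sqnorm].
  by rewrite (lapD x (polyf_M hc hq) (polyf_M hc hq')) qE qE'.
elim/ltn_ind: k p => k IH p hp.
have [q0 hq0 q0E] := fischer 0 n0 hp; rewrite add0n in hq0.
have [q1 hq1 q1E] : exists2 q1, polyf q1 & forall x,
    laplacian (fun x => (c - sq x) * q1 x) x = c * laplacian q0 x.
  have := hpoly_lap hq0; case: k hp IH hq0 q0E => [|[|k]] hp IH hq0 q0E hl.
  - exists (fun=> 0) => [|x]; first exact: polyf_cst.
    rewrite hl mulr0 (_ : (fun x => _) = fun=> 0) ?lap_cst //.
    by apply/funext => y; rewrite mulr0.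
  - exists (fun=> 0) => [|x]; first exact: polyf_cst.
    rewrite hl mulr0 (_ : (fun x => _) = fun=> 0) ?lap_cst //.
    by apply/funext => y; rewrite mulr0.
  - have [|q1 hq1 q1E] := IH k _ _ (hpoly_Z c hl); first by [].
    by exists q1.
have f0 := polyf_h hq0; exists (fun x => q1 x - q0 x) => [|x]; first exact: polyf_B.
rewrite lap_bump; last exact: polyf_B.
have := q1E x; rewrite (lap_bump _ _ hq1) => q1E'.
have s1 : polyf (fun x => sq x * q1 x) by apply: polyf_M hq1; exact: polyf_sqnorm.
have s0 : polyf (fun x => sq x * q0 x) by apply: polyf_M f0; exact: polyf_sqnorm.
rewrite lapB // (_ : (fun x => sq x * (q1 x - q0 x)) =
   fun x => sq x * q1 x - sq x * q0 x); last by apply/funext => y; ring.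
rewrite lapB // q0E mul1r; move: q1E'.
move: (laplacian q1 x) (laplacian q0 x) (laplacian _ x) (p x) => a b d e; lra.
Qed.

(** The boundary polynomial [p] serves as its own extension; a multiple of r^2 - |x - x0|^2 corrects
    its Laplacian without changing the values on the sphere. *)
Lemma dirichlet_poly x0 r p h : (0 < n)%N -> polyf p -> polyf h ->
  exists w, [/\ polyf w, forall x, laplacian w x = h x &
    forall x, enorm (x - x0) = r -> w x = p x].
Proof.
move=> n0 hp hh.
have hp' : polyf (fun x => p (x + x0)) by exact: polyf_shift.
have [q hq qE] := @poisson_poly (r ^+ 2) (fun x => h (x + x0) -
  laplacian (fun x => p (x + x0)) x) n0
  (polyf_B (polyf_shift _ hh) (polyf_lap hp')).
have hb : polyf (fun x => (r ^+ 2 - sq x) * q x).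
  by apply: polyf_M hq; apply: polyf_B; [exact: polyf_cst|exact: polyf_sqnorm].
exists (fun x => p x + (r ^+ 2 - sq (x - x0)) * q (x - x0)); split.
- apply: polyf_D => //; exact: (polyf_shift (- x0) hb).
- move=> x; rewrite lapD //; last exact: (polyf_shift (- x0) hb).
  rewrite (lap_shift (- x0) x hb) qE subrK.
  by rewrite (lap_shift x0 _ hp) subrK; ring.
- by move=> x xr; rewrite /sq -enorm_sqr xr subrr mul0r addr0.
Qed.

End Dirichlet.

(** * Uniform approximation by Bernstein polynomials *)

Section BinomialWalk.
Variable R : realType.
Implicit Types (t : R) (phi psi : nat -> R).

(* Expectation of [phi] at the value of a binomial variable: the Bernstein
   polynomial [\sum_k 'C(N, k) t^k (1-t)^(N-k) phi k]. *)
Fixpoint bexp N t phi : R :=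
  if N is N'.+1 then (1 - t) * bexp N' t phi + t * bexp N' t (phi \o S)
  else phi 0%N.

Lemma bexp_le N t phi psi : 0 <= t <= 1 ->
  (forall k, (k <= N)%N -> phi k <= psi k) -> bexp N t phi <= bexp N t psi.
Proof.
move=> /andP[t0 t1]; elim: N phi psi => [|N IH] phi psi h /=; first exact: h.
apply: lerD; apply: ler_wpM2l; rewrite ?subr_ge0 //; apply: IH => k kN.
  by apply: h; apply: leqW.
exact: h.
Qed.

Lemma bexp_affine N t phi (a b : R) :
  bexp N t (fun k => a + b * phi k) = a + b * bexp N t phi.
Proof.
elim: N phi => [//|N IH] phi /=; rewrite IH.
by rewrite (IH (phi \o S)); ring.
Qed.

Lemma bexpN N t phi : bexp N t (fun k => - phi k) = - bexp N t phi.
Proof.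
rewrite -[RHS]add0r -mulN1r -bexp_affine; congr bexp; apply/funext => k.
by rewrite add0r mulN1r.
Qed.

(** The second moment about [s] of a binomial variable: squared bias plus the variance N t (1 -
    t). *)
Lemma bexp_sqr N t (s : R) :
  bexp N t (fun k => (k%:R - s) ^+ 2) = (N%:R * t - s) ^+ 2 + N%:R * t * (1 - t).
Proof.
elim: N s => [|N IH] s /=; first by ring.
rewrite IH (_ : _ \o S = fun k => (k%:R - (s - 1)) ^+ 2).
  by rewrite IH -natr1; ring.
by apply/funext => k; rewrite /= -natr1; ring.
Qed.

End BinomialWalk.

Section Density.
Variables (R : realType) (n : nat).
Implicit Types (x y z : 'rV[R]_n) (f : 'rV[R]_n -> R).

(** Uniform continuity in the form that suits second moments: nearby points are covered by [e],
    distant ones by the quadratic term, as [f] is bounded on [K]. Compactness turns the local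
    choices of [C] into a global one. *)
Lemma quadratic_modulus (K : set 'rV[R]_n) f (e : R) : compact K ->
  (forall x, K x -> {for x, continuous f}) -> 0 < e ->
  exists2 C, 0 <= C & forall x z, K x -> K z ->
    `|f z - f x| <= e + C * dot (z - x) (z - x).
Proof.
move=> cK cf e0; have e20 : 0 < e / 2 by rewrite divr_gt0.
have [K0|/set0P[x0 Kx0]] := eqVneq K set0; first by exists 0 => // x z; rewrite K0.
have [c Kc cmax] := @compact_max _ _ K (fun x => `|f x|) _ Kx0 cK
  (fun x Kx => continuous_comp (cf x Kx) (@norm_continuous _ _ _)).
pose M := `|f c|.
have := (compact_near_coveringP K).1 cK R (pinfty_nbhs R)
  (fun C x => forall z, K z -> `|f z - f x| <= e + C * dot (z - x) (z - x)) _.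
case.
- move=> x Kx; have /cont_enormP/(_ _ e20)[d d0 dP] := cf x Kx.
  (* With this constant the quadratic term alone reaches 2 M + e as soon as the distance is at least
     d / 2. *)
  pose C0 := (2 * M + e) / (d / 2) ^+ 2.
  exists (eball x (d / 2), [set C | C0 < C]).
    split; first by apply: nbhs_eball; rewrite divr_gt0.
    by exists C0; split => //; exact: num_real.
  move=> [y C] [/= yx CC] z Kz.
  have M0 : 0 <= M by exact: normr_ge0.
  have C00 : 0 <= C0 by rewrite divr_ge0 ?sqr_ge0 // addr_ge0 ?mulr_ge0 // ltW.
  have C1 : 0 <= C by rewrite (le_trans C00) // ltW.
  have fy : `|f y - f x| < e / 2.
    by apply: dP; apply: lt_trans yx _; rewrite ltr_pdivrMr // ltr_pMr // ltr1n.
  have [zy|zy] := ltP (enorm (z - y)) (d / 2).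
    have fz : `|f z - f x| < e / 2.
      apply: dP; rewrite (_ : z - x = (z - y) + (y - x)); last by rewrite addrA subrK.
      apply: le_lt_trans (enormD _ _) _; move: yx; rewrite /eball /= => yx; lra.
    have : 0 <= C * dot (z - y) (z - y) by rewrite mulr_ge0 ?dot_ge0.
    move: fy fz; rewrite !ltr_norml => /andP[? ?] /andP[? ?] ?.
    by rewrite ler_norml; apply/andP; split; lra.
  have : 2 * M + e <= C * dot (z - y) (z - y).
    rewrite -enorm_sqr; apply: le_trans (_ : C0 * (d / 2) ^+ 2 <= _).
      by rewrite /C0 divfK // gt_eqF // exprn_gt0 // divr_gt0.
    apply: ler_pM; rewrite ?sqr_ge0 ?(ltW CC) //.
    by rewrite lerXn2r ?nnegrE ?enorm_ge0 // divr_ge0 // ltW.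
  have := cmax z Kz; have := cmax x Kx; move: fy; rewrite -/M.
  rewrite !ltr_norml !ler_norml => /andP[? ?] /andP[? ?] /andP[? ?] ?.
  by apply/andP; split; lra.
- move=> C0 [_ h]; exists (Num.max 0 (C0 + 1)); first by rewrite le_max lexx.
  move=> x z Kx Kz; apply: h => //.
  by rewrite lt_max ltrDl ltr01 orbT.
Qed.

Definition setc y (i : 'I_n) (a : R) : 'rV[R]_n :=
  \row_j (if j == i then a else y 0 j).

(* Iterated Bernstein operator in the coordinates of [s], on the grid
   [a 0 i + b * k]; [t i x] is the corresponding success probability. *)
Fixpoint bern (N : nat) (b : R) (a : 'rV[R]_n) (t : 'I_n -> 'rV[R]_n -> R)
    (s : seq 'I_n) f x y : R :=
  if s is i :: s' then
    bexp N (t i x) (fun k => bern N b a t s' f x (setc y i (a 0 i + b * k%:R)))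
  else f y.

Lemma polyf_bexp N (t : 'rV[R]_n -> R) (F : nat -> 'rV[R]_n -> R) : polyf t ->
  (forall k, polyf (F k)) -> polyf (fun x => bexp N (t x) (fun k => F k x)).
Proof.
move=> ht; elim: N F => [|N IH] F hF /=; first exact: hF.
apply: polyf_D; apply: polyf_M => //.
- by apply: polyf_B => //; exact: polyf_cst.
- exact: IH.
- by apply: (IH (fun k => F k.+1)) => k; exact: hF.
Qed.

Lemma polyf_bern N b a t s f y : (forall i, polyf (t i)) ->
  polyf (fun x => bern N b a t s f x y).
Proof.
move=> ht; elim: s y => [|i s IH] y /=; first exact: polyf_cst.
by apply: polyf_bexp.
Qed.

Lemma bernN N b a t s f x y :
  bern N b a t s (fun z => - f z) x y = - bern N b a t s f x y.
Proof.
elim: s y => [//|i s IH] y /=; rewrite -bexpN; congr bexp.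
by apply/funext => k; rewrite IH.
Qed.

(** Averaging over one coordinate replaces its squared distance to [x] by a variance of at most b^2
    N; the coordinates outside [s] keep theirs. The bound is one-sided, and [bernN] yields the other
    side. *)
Lemma bern_le N b (a : 'rV[R]_n) t (s : seq 'I_n) f x y (B C : R) : uniq s -> 0 <= b -> 0 <= C ->
  (forall i, 0 <= t i x <= 1) ->
  (forall i, x 0 i = a 0 i + b * (N%:R * t i x)) ->
  (forall z, (forall i, a 0 i <= z 0 i <= a 0 i + b * N%:R) ->
     f z <= B + C * dot (z - x) (z - x)) ->
  (forall i, a 0 i <= y 0 i <= a 0 i + b * N%:R) ->
  bern N b a t s f x y <=
    B + C * (\sum_(j | j \notin s) (y 0 j - x 0 j) ^+ 2 + (size s)%:R * (b ^+ 2 * N%:R)).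
Proof.
move=> us b0 C0 t01 xE hf; elim: s us y => [_ y ybox|i s IH /= /andP[si us] y ybox] /=.
  rewrite mul0r addr0 (eq_bigl xpredT) //; apply: le_trans (hf y ybox) _.
  rewrite le_eqVlt; apply/orP; left; apply/eqP; congr (_ + _ * _).
  by apply: eq_bigr => j _; rewrite !mxE -expr2.
pose S := \sum_(j | j \notin i :: s) (y 0 j - x 0 j) ^+ 2.
apply: le_trans (_ : bexp N (t i x) (fun k => (B + C * (S + (size s)%:R * (b ^+ 2 * N%:R))) +
   C * b ^+ 2 * (k%:R - N%:R * t i x) ^+ 2) <= _).
  apply: bexp_le => // k kN; have k0 : 0 <= b * k%:R by rewrite mulr_ge0.
  apply: le_trans (IH us _ _) _.
    move=> j; rewrite mxE; have [->|//] := eqVneq j i.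
    by rewrite lerDl k0 lerD2l ler_wpM2l // ler_nat.
  rewrite (bigD1 i) //= mxE eqxx xE.
  rewrite (_ : \sum_(j | (j \notin s) && (j != i)) _ = S).
    by rewrite le_eqVlt; apply/orP; left; apply/eqP; ring.
  apply: eq_big => [j|j /andP[_ /negPf ji]]; first by rewrite inE negb_or andbC.
  by rewrite mxE ji.
rewrite bexp_affine bexp_sqr subrr expr0n add0r -natr1 /= -/S.
have /andP[ti0 ti1] := t01 i.
have : C * b ^+ 2 * (N%:R * t i x * (1 - t i x)) <= C * (b ^+ 2 * N%:R).
  rewrite -[leRHS]mulr1 -!mulrA !ler_wpM2l ?sqr_ge0 //.
  by rewrite mulr_ile1 // ?subr_ge0 // gerBl.
by lra.
Qed.

(** The grid fills the cube of half side [r] around [x0]. This cube contains the ball of radius [r]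
    and lies in the ball of radius [n * r], on which continuity is therefore assumed. *)
Lemma poly_dense f x0 (r e : R) : 0 < r -> 0 < e ->
  (forall x, ceball x0 (n%:R * r) x -> {for x, continuous f}) ->
  exists2 p, polyf p & forall x, ceball x0 r x -> `|p x - f x| <= e.
Proof.
move=> r0 e0 cf; have e20 : 0 < e / 2 by rewrite divr_gt0.
have [C C0 CP] := quadratic_modulus (@compact_ceball _ _ x0 (n%:R * r)) cf e20.
pose a : 'rV[R]_n := x0 - const_mx r.
(* With [b = 2 r / N] the total variance term is C n (4 r^2) / N, and [N > X] makes it at most e /
   2. *)
pose X := C * (n%:R * (4 * r ^+ 2)) / (e / 2).
have X0 : 0 <= X by rewrite divr_ge0 ?mulr_ge0 ?sqr_ge0 // ltW.
pose N := (Num.truncn X).+1; have XN : X < N%:R by exact: truncnS_gt.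
have N0 : 0 < N%:R :> R by rewrite ltr0n.
pose b := 2 * r / N%:R; have b0 : 0 < b by rewrite divr_gt0 ?mulr_gt0.
have bN : b * N%:R = 2 * r by rewrite /b divfK // gt_eqF.
pose t (i : 'I_n) (x : 'rV[R]_n) := (x 0 i - a 0 i) / (2 * r).
exists (fun x => bern N b a t (enum 'I_n) f x x0).
  apply: polyf_bern => i; rewrite /t.
  rewrite (_ : (fun x => _) = fun x => (2 * r)^-1 * (x 0 i - a 0 i)).
    by apply: polyf_Z; apply: polyf_B; [exact: polyf_coord|exact: polyf_cst].
  by apply/funext => x; rewrite mulrC.
move=> x xr.
have box y : (forall i, a 0 i <= y 0 i <= a 0 i + b * N%:R) <->
    (forall i, `|(y - x0) 0 i| <= r).
  by split=> h i; have := h i; rewrite bN !mxE ler_norml => /andP[? ?];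
    apply/andP; split; lra.
have inK z : (forall i, a 0 i <= z 0 i <= a 0 i + b * N%:R) ->
    ceball x0 (n%:R * r) z.
  move=> /box zb; rewrite /ceball /=; apply: le_trans (enorm_sum_le _) _.
  rewrite mulr_natl -[X in _ *+ X]card_ord -sumr_const.
  by apply: ler_sum => i _; exact: zb.
have xbox : forall i, a 0 i <= x 0 i <= a 0 i + b * N%:R.
  by apply/box => i; apply: le_trans (coord_le_enorm _ _) xr.
have x0box : forall i, a 0 i <= x0 0 i <= a 0 i + b * N%:R.
  by apply/box => i; rewrite subrr mxE normr0 ltW.
have r20 : 0 < 2 * r by rewrite mulr_gt0.
have t01 i : 0 <= t i x <= 1.
  have := xbox i; rewrite bN => /andP[? ?]; apply/andP; split.
    by rewrite divr_ge0 ?(ltW r20) // subr_ge0.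
  by rewrite ler_pdivrMr // mul1r lerBlDl.
have xE i : x 0 i = a 0 i + b * (N%:R * t i x).
  by rewrite mulrA bN /t mulrC divfK ?gt_eqF // addrC subrK.
have bound (g : 'rV[R]_n -> R) :
    (forall z, ceball x0 (n%:R * r) z -> `|g z - g x| <= e / 2 + C * dot (z - x) (z - x)) ->
    bern N b a t (enum 'I_n) g x x0 <= g x + e.
  move=> hg; have := @bern_le N b a t (enum 'I_n) g x x0 (g x + e / 2) C
    (enum_uniq _) (ltW b0) C0 t01 xE _ x0box.
  rewrite big1 => [|j]; last by rewrite mem_enum.
  rewrite add0r size_enum_ord => /(_ _)/le_trans; apply.
    move=> z /inK /hg; rewrite ler_norml => /andP[_ ?]; lra.
  have : C * (n%:R * (b ^+ 2 * N%:R)) <= e / 2; last by lra.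
  rewrite (_ : _ * _ = C * (n%:R * (4 * r ^+ 2)) / N%:R).
    rewrite ler_pdivrMr // -ler_pdivrMl // mulrC; exact: ltW.
  by rewrite /b; field; rewrite gt_eqF.
have h1 : bern N b a t (enum 'I_n) f x x0 <= f x + e.
  by apply: bound => z Kz; apply: CP => //; exact: inK.
have h2 : bern N b a t (enum 'I_n) (fun z => - f z) x x0 <= - f x + e.
  apply: bound => z Kz; rewrite -opprD normrN; apply: CP => //; exact: inK.
rewrite bernN in h2; rewrite ler_norml; apply/andP; split; lra.
Qed.

End Density.

(** The limit inherits each Cauchy bound with the same [e] and [N]. Bounds that are uniform over
    points thereby stay uniform in the limit, although the limit is taken at each point
    separately. *)
Lemma real_cauchy (R : realType) (a : nat -> R) :
  (forall e, 0 < e -> exists N, forall k l, (N <= k)%N -> (N <= l)%N -> `|a k - a l| <= e) ->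
  exists d, forall e N, 0 < e ->
    (forall k l, (N <= k)%N -> (N <= l)%N -> `|a k - a l| <= e) ->
    forall k, (N <= k)%N -> `|a k - d| <= e.
Proof.
move=> h; have : cauchy (a @ \oo).
  apply: cauchy_exP => e e0.
  have [|N NP] := h (e / 2); first by rewrite divr_gt0.
  exists (a N), N => // k /= Nk; rewrite /ball /=.
  by apply: le_lt_trans (NP _ _ _ Nk) _; rewrite // ltr_pdivrMr // ltr_pMr // ltr1n.
move=> /cauchy_cvgP /cvg_ex[d /cvgrPdist_le ad]; exists d => e N e0 NP k Nk.
apply/ler_addgt0Pr => s s0; have [M _ MP] := ad s s0.
have := NP k (maxn M N) Nk (leq_maxr _ _); have := MP (maxn M N) (leq_maxl _ _).
rewrite /= !ler_norml => /andP[? ?] /andP[? ?]; apply/andP; split; lra.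
Qed.

(** * Interior gradient estimate *)

Section GradientEstimate.
Variables (R : realType) (n : nat).
Implicit Types (W p q : 'rV[R]_n -> R) (x y z : 'rV[R]_n).

Definition reflect_coord (i : 'I_n) x : 'rV[R]_n := x - (2 * x 0 i) *: delta_mx 0 i.

Lemma reflect_coordE i x j :
  reflect_coord i x 0 j = (if j == i then - x 0 i else x 0 j).
Proof.
rewrite !mxE eqxx /=; have [->|_] := eqVneq j i; last by rewrite mulr0 subr0.
by rewrite mulr1; ring.
Qed.

Lemma enorm_reflect i x : enorm (reflect_coord i x) = enorm x.
Proof.
rewrite !enormE; congr Num.sqrt; apply: eq_bigr => j _.
by rewrite reflect_coordE; case: eqP => [->|]; rewrite ?mulrNN.
Qed.

Lemma polyf_reflect W i : polyf W -> polyf (fun x => W (reflect_coord i x)).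
Proof.
apply: polyf_comp => j; rewrite (_ : (fun x => _) = fun x =>
    x 0 j - (2 * (j == i)%:R) * x 0 i); last first.
  by apply/funext => x; rewrite !mxE eqxx /=; ring.
by apply: polyf_B; [|apply: polyf_Z]; exact: polyf_coord.
Qed.

Lemma partial_reflect W i j : polyf W ->
  partial j (fun x => W (reflect_coord i x)) =
  fun x => (-1) ^+ (j == i) * partial j W (reflect_coord i x).
Proof.
move=> hW; apply/funext => x; apply: partial_eq.
have := is_deriveZv ((-1) ^+ (j == i)) ((polyf_derive j hW).1 (reflect_coord i x)).
move=> /is_derive_epsP h; apply/is_derive_epsP => e /h[r r0 rP]; exists r => // t /rP.
rewrite (_ : reflect_coord i x + _ = reflect_coord i (x + t *: delta_mx 0 j)) //.
apply/rowP => k; rewrite 3!mxE !reflect_coordE !mxE eqxx /=.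
have [->|ki] := eqVneq k i.
  by rewrite [i == j]eq_sym; case: (j == i); rewrite /= ?expr1 ?expr0 ?mulr1 ?mulr0; ring.
have [kj|kj] := eqVneq k j; last by rewrite !mulr0 subr0.
by rewrite -kj (negPf ki) /= expr0 mulr0 subr0 mul1r.
Qed.

Lemma lap_reflect W i x : polyf W ->
  laplacian (fun x => W (reflect_coord i x)) x = laplacian W (reflect_coord i x).
Proof.
move=> hW; apply: eq_bigr => j _; rewrite partial_reflect //.
rewrite partialZ; last by apply: polyf_reflect; exact: (polyf_derive j hW).2.
rewrite partial_reflect; last exact: (polyf_derive j hW).2.
by rewrite mulrA -signr_addb addbb mul1r.
Qed.

Lemma lap_max_le0 W x r : polyf W -> 0 < r ->
  (forall y, enorm (y - x) < r -> W y <= W x) -> laplacian W x <= 0.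
Proof.
move=> hW r0 hmax; apply: sumr_le0 => i _.
exact: (second_derive_max i openT (polyf_C2 _ hW) I r0 hmax).
Qed.

Lemma lap_coord i x : laplacian (fun x => x 0 i) x = 0.
Proof.
rewrite (_ : (fun x => _) = dot (delta_mx 0 i)) ?lap_dot //.
by apply/funext => y; rewrite dotC dot_delta.
Qed.

Lemma lap_coord_sq i x : laplacian (fun x => x 0 i ^+ 2) x = 2.
Proof.
have hi : polyf (fun x : 'rV[R]_n => x 0 i) by exact: polyf_coord.
rewrite (_ : (fun x => _) = fun x => x 0 i * x 0 i); last first.
  by apply/funext => y; rewrite expr2.
rewrite (lapM x hi hi) lap_coord (_ : gradient _ x = delta_mx 0 i).
  by rewrite dot_delta mxE !eqxx /=; ring.
by apply/rowP => j; rewrite !mxE partial_coord eqxx.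
Qed.

Let halfball (r : R) (i : 'I_n) : set 'rV[R]_n := ceball 0 r `&` [set x | 0 <= x 0 i].

Let compact_halfball r i : compact (halfball r i).
Proof.
apply: subclosed_compact (@compact_ceball _ _ 0 r) _; last by move=> x [].
apply: closedI; first exact: closed_ceball.
apply: (@closed_comp _ _ (fun x : 'rV[R]_n => x 0 i) [set a | 0 <= a]).
  by move=> x _; exact: coord_continuous.
exact: closed_ge.
Qed.

(* The barrier [a x_i - b x_i^2 + c |x|^2] dominates the odd part of [W] on the
   boundary of the half ball and is a strict supersolution there. *)
Lemma odd_part_le W r M K i y c b : polyf W -> 0 < r -> 0 < K ->
  (forall x, ceball 0 r x -> `|W x| <= M) ->
  (forall x, ceball 0 r x -> `|laplacian W x| <= K) ->
  halfball r i y ->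
  c = 2 * M / r ^+ 2 -> b = n%:R * c + 2 * K ->
  W y - W (reflect_coord i y) <= b * r * y 0 i - b * y 0 i ^+ 2 + c * dot y y.
Proof.
move=> hW r0 K0 hM hK hy cE bE.
have M0 : 0 <= M by apply: le_trans (hM 0 _); rewrite // /ceball /= subr0 enorm0 ltW.
have c0 : 0 <= c by rewrite cE; apply: divr_ge0; [exact: mulr_ge0|exact: sqr_ge0].
have b0 : 0 <= b by rewrite bE addr_ge0 ?mulr_ge0 // ltW.
pose e : 'rV[R]_n := delta_mx 0 i.
pose B x := b * r * x 0 i - b * x 0 i ^+ 2 + c * dot x x.
have hx : polyf (fun x => x 0 i) by exact: polyf_coord.
have hx2 : polyf (fun x => x 0 i ^+ 2) by exact: polyf_X.
have hB : polyf B.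
  apply: polyf_D; last by apply: polyf_Z; exact: polyf_sqnorm.
  by apply: polyf_B; exact: polyf_Z.
have lapB' x : laplacian B x = - (2 * b) + c * (2 * n%:R).
  rewrite /B (lapD x (polyf_B (polyf_Z _ hx) (polyf_Z _ hx2)) (polyf_Z _ (polyf_sqnorm _ _))).
  rewrite (lapB x (polyf_Z _ hx) (polyf_Z _ hx2)) !lapZ //; last exact: polyf_sqnorm.
  by rewrite lap_sqnorm lap_coord lap_coord_sq; ring.
pose F x := W x - W (reflect_coord i x) - B x.
have hWr : polyf (fun x => W (reflect_coord i x)) by exact: polyf_reflect.
have hF : polyf F by apply: polyf_B hB; exact: polyf_B.
have [z [zr zi] zmax] := compact_max hy (@compact_halfball r i)
  (fun x _ => @polyf_cont _ _ F x hF).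
suff Fz : F z <= 0 by have := le_trans (zmax y hy) Fz; rewrite /F /B; lra.
rewrite leNgt; apply/negP => Fz.
have zr' : ceball 0 r (reflect_coord i z).
  by rewrite /ceball /= subr0 enorm_reflect; move: zr; rewrite /ceball /= subr0.
have zi0 : 0 < z 0 i.
  rewrite lt_def zi andbT; apply/eqP => z0; move: Fz; rewrite ltNge => /negP; apply.
  rewrite /F /B z0 (_ : reflect_coord i z = z).
    have : 0 <= c * dot z z by rewrite mulr_ge0 ?dot_ge0.
    by lra.
  by rewrite /reflect_coord z0 mulr0 scale0r subr0.
have zi_le : z 0 i <= r.
  move: zr; rewrite /ceball /= subr0; apply: le_trans.
  by apply: le_trans (coord_le_enorm z i); exact: ler_norm.
have zn : enorm z < r.
  rewrite lt_def; move: (zr); rewrite /ceball /= subr0 => ->; rewrite andbT.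
  apply/eqP => zE; move: Fz; rewrite ltNge => /negP; apply.
  have : c * dot z z = 2 * M.
    by rewrite -enorm_sqr -zE cE divfK // expf_neq0 // gt_eqF.
  have := hM z zr; have := hM _ zr'.
  rewrite !ler_norml => /andP[? ?] /andP[? ?] ?.
  have : 0 <= b * z 0 i * (r - z 0 i) by rewrite !mulr_ge0 ?subr_ge0.
  by rewrite /F /B; lra.
have s0 : 0 < Num.min (z 0 i) (r - enorm z) by rewrite lt_min zi0 subr_gt0.
have Fle : laplacian F z <= 0.
  apply: lap_max_le0 hF s0 _ => x; rewrite lt_min => /andP[x1 x2]; apply: zmax; split.
    rewrite /ceball /= subr0; have := enormD (x - z) z; rewrite subrK.
    by move: x2 => /[swap]; lra.
  have := le_lt_trans (coord_le_enorm (x - z) i) x1.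
  by rewrite !mxE ltr_norml => /andP[? ?] /=; lra.
(* By the choice of [b], lap B = - 4 K, whereas the Laplacian of the odd part is at least - 2 K; so
   lap F > 0 at an interior maximum, a contradiction. *)
move: Fle; rewrite (lapB z (polyf_B hW hWr) hB) (lapB z hW hWr) lapB' lap_reflect //.
have := hK z zr; have := hK _ zr'.
rewrite bE; move: (laplacian W z) (laplacian W (reflect_coord i z)) => p q.
by clear -K0; rewrite !ler_norml => /andP[? ?] /andP[? ?]; lra.
Qed.

(** At the point t e_i the bound [odd_part_le] reads W (t e_i) - W (- t e_i) <= b r t + O(t^2).
    Division by 2 t leaves b r / 2, which is the right-hand side. *)
Lemma gradient_estimate0 W r M K i : polyf W -> 0 < r -> 0 < K ->
  (forall x, ceball 0 r x -> `|W x| <= M) ->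
  (forall x, ceball 0 r x -> `|laplacian W x| <= K) ->
  partial i W 0 <= n%:R * M / r + K * r.
Proof.
move=> hW r0 K0 hM hK.
have M0 : 0 <= M by apply: le_trans (hM 0 _); rewrite // /ceball /= subr0 enorm0 ltW.
pose c := 2 * M / r ^+ 2; pose b := n%:R * c + 2 * K.
have c0 : 0 <= c by apply: divr_ge0; [exact: mulr_ge0|exact: sqr_ge0].
have b0 : 0 <= b by apply: addr_ge0; apply: mulr_ge0 => //; exact: ltW.
have -> : n%:R * M / r + K * r = b * r / 2.
  by rewrite /b /c; field; rewrite gt_eqF.
apply/ler_addgt0Pr => e e0.
have /is_derive_epsP/(_ (e / 2))[|s s0 sP] := (polyf_derive i hW).1 0.
  by rewrite divr_gt0.
pose t := Num.min (Num.min (s / 2) r) (e / (c + 1)).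
have c1 : 0 < c + 1 by rewrite ltr_pwDr.
have t0 : 0 < t by rewrite !lt_min !divr_gt0 ?r0.
have ts : t < s.
  apply: le_lt_trans (_ : s / 2 < s); first by rewrite !ge_min lexx.
  by rewrite ltr_pdivrMr // ltr_pMr // ltr1n.
have tr : t <= r by rewrite !ge_min lexx !orbT.
have tc : t * c <= e.
  apply: le_trans (_ : t * (c + 1) <= _); first by rewrite ler_pM2l // lerDl.
  by rewrite -ler_pdivlMr // !ge_min lexx !orbT.
pose y : 'rV[R]_n := t *: delta_mx 0 i.
have yi : y 0 i = t by rewrite !mxE !eqxx mulr1.
have hy : halfball r i y.
  by split; rewrite /ceball /= ?subr0 ?enormZ ?enorm_delta ?mulr1 ?gtr0_norm ?yi // ltW.
have := odd_part_le hW r0 K0 hM hK hy erefl erefl; rewrite -/c -/b yi.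
have -> : reflect_coord i y = (- t) *: delta_mx 0 i.
  by rewrite /reflect_coord yi /y -scalerBl; congr (_ *: _); ring.
rewrite (_ : dot y y = t ^+ 2); last by rewrite -enorm_sqr enormZ enorm_delta mulr1 gtr0_norm.
have := sP t; have := sP (- t); rewrite normrN gtr0_norm // !add0r -/y.
move=> /(_ ts) + /(_ ts); rewrite !ler_norml => /andP[_ h1] /andP[h2 _] h3.
rewrite -(ler_pM2l t0).
have : 0 <= b * t ^+ 2 by rewrite mulr_ge0 ?sqr_ge0.
have : t * (t * c) <= t * e by rewrite ler_pM2l.
move: h1 h2 h3; move: (partial i W 0) (W y) (W 0) (W (- t *: _)) => d p q u.
by clearbody b c t; clear; lra.
Qed.

Lemma gradient_estimate W x0 r M K i : polyf W -> 0 < r -> 0 < K ->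
  (forall x, ceball x0 r x -> `|W x| <= M) ->
  (forall x, ceball x0 r x -> `|laplacian W x| <= K) ->
  `|partial i W x0| <= n%:R * M / r + K * r.
Proof.
move=> hW r0 K0 hM hK.
have hs : polyf (fun x => W (x + x0)) by exact: polyf_shift.
have inb x : ceball 0 r x -> ceball x0 r (x + x0).
  by rewrite /ceball /= subr0 addrK.
rewrite ler_norml; apply/andP; split.
  rewrite lerNl.
  have := @gradient_estimate0 (fun x => - W (x + x0)) r M K i (polyf_N hs) r0 K0.
  rewrite (partialN i hs) (partial_shift x0 i hW) add0r; apply.
    by move=> x /inb /hM; rewrite normrN.
  by move=> x /inb /hK; rewrite (lapN x hs) lap_shift // normrN.
have := @gradient_estimate0 (fun x => W (x + x0)) r M K i hs r0 K0.
rewrite (partial_shift x0 i hW) add0r; apply.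
  by move=> x /inb /hM.
by move=> x /inb /hK; rewrite lap_shift.
Qed.

End GradientEstimate.

(** * Regularity of viscosity solutions of the Poisson equation *)

Section Regularity.
Variables (R : realType) (n : nat).
Implicit Types (u v H W w : 'rV[R]_n -> R) (x y z : 'rV[R]_n) (U : set 'rV[R]_n).

(* Sub- and viscosity solutions of [lap u = H], tested against polynomials only. *)
Definition psub U u H := forall x phi r, U x -> polyf phi -> 0 < r ->
  phi x = u x -> (forall y, enorm (y - x) < r -> u y <= phi y) ->
  H x <= laplacian phi x.

Definition pvisc U u H := psub U u H /\ psub U (fun x => - u x) (fun x => - H x).

(** The bump e (r^2 - |x - x0|^2) has Laplacian - 2 n e <= - 2 e. Added to [w] it gives a strict
    supersolution, and this forbids that [u - w - b] has an interior maximum with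
    [u c > w c + b c + e]. *)
Lemma psub_comparison u H w x0 r e : (0 < n)%N -> 0 < r -> 0 < e ->
  psub (eball x0 r) u H -> (forall x, ceball x0 r x -> {for x, continuous u}) ->
  polyf w -> (forall x, ceball x0 r x -> laplacian w x <= H x + e) ->
  (forall x, enorm (x - x0) = r -> u x <= w x + e) ->
  forall x, ceball x0 r x -> u x <= w x + e + e * r ^+ 2.
Proof.
move=> n0 r0 e0 hu cu hw lw bw x xr.
pose b y := e * (r ^+ 2 - dot (y - x0) (y - x0)).
have hs : polyf (fun y => dot (y - x0) (y - x0)).
  exact: (polyf_shift (- x0) (polyf_sqnorm R n)).
have hb : polyf b by apply: polyf_Z; apply: polyf_B => //; exact: polyf_cst.
have lb y : laplacian b y = - (e * (2 * n%:R)).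
  rewrite /b (lapZ e y (polyf_B (polyf_cst _ (r ^+ 2)) hs)).
  rewrite (lapB y (polyf_cst _ (r ^+ 2)) hs) lap_cst.
  by rewrite (lap_shift (- x0) y (polyf_sqnorm R n)) lap_sqnorm; ring.
have hwb : polyf (fun y => w y + b y) by exact: polyf_D.
have [c cr cmax] := compact_max xr (@compact_ceball _ _ x0 r)
   (fun y yr => @continuousB _ _ _ u (fun y => w y + b y) y (cu y yr)
      (@polyf_cont _ _ _ y hwb)).
have bE y : b y = e * r ^+ 2 - e * enorm (y - x0) ^+ 2 by rewrite /b -enorm_sqr; ring.
have [hc|hc] := leP (u c) (w c + b c + e).
  have := cmax x xr; rewrite !fctE bE => h.
  have : 0 <= e * enorm (x - x0) ^+ 2 by rewrite mulr_ge0 ?sqr_ge0 // ltW.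
  by move: h hc; move: (e * _ ^+ 2) (e * r ^+ 2) (b c) => ? ? ?; lra.
have cn : enorm (c - x0) < r.
  rewrite lt_def; move: (cr); rewrite /ceball /= => ->; rewrite andbT.
  apply/eqP => cE; have := bw c (esym cE); move: hc; rewrite bE -cE; lra.
pose k := u c - (w c + b c).
have := hu c (fun y => w y + b y + k) (r - enorm (c - x0)) cn.
move=> /(_ (polyf_D hwb (polyf_cst _ _))) h.
have : H c <= laplacian (fun y => w y + b y + k) c.
  apply: h; first by rewrite subr_gt0.
    by rewrite /k addrC subrK.
  move=> y yc; have := cmax y; rewrite !fctE => /(_ _) h.
  have : ceball x0 r y.
    apply: (@ceball_sub _ _ x0 c (r - enorm (c - x0))); first by rewrite addrC subrK.
    exact: ltW.
  by move=> /h; rewrite /k; lra.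
rewrite (lapD c hwb (polyf_cst _ k)) lap_cst (lapD c hw hb) lb.
have := lw c cr; have : e <= e * n%:R by rewrite ler_peMr ?(ltW e0) // ler1n.
by move: (laplacian w c) (H c) => p q; clear -e0; lra.
Qed.

Lemma pvisc_comparison u H w x0 r e : (0 < n)%N -> 0 < r -> 0 < e ->
  pvisc (eball x0 r) u H -> (forall x, ceball x0 r x -> {for x, continuous u}) ->
  polyf w -> (forall x, ceball x0 r x -> `|laplacian w x - H x| <= e) ->
  (forall x, enorm (x - x0) = r -> `|w x - u x| <= e) ->
  forall x, ceball x0 r x -> `|w x - u x| <= e + e * r ^+ 2.
Proof.
move=> n0 r0 e0 [h1 h2] cu hw lw bw x xr.
have := @psub_comparison u H w x0 r e n0 r0 e0 h1 cu hw.
have := @psub_comparison (fun x => - u x) (fun x => - H x) (fun x => - w x) x0 r e n0 r0 e0 h2.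
move=> k1 k2; rewrite ler_norml; apply/andP; split.
  rewrite lerBrDr; have := k2 _ _ x xr; rewrite -addrA => k.
  suff : u x <= w x + (e + e * r ^+ 2) by lra.
  apply: k => y hy; [have := lw y hy|have := bw y hy]; rewrite ler_norml => /andP[? ?]; lra.
suff : - u x <= - w x + e + e * r ^+ 2 by lra.
apply: k1 => //.
- by move=> y /cu; exact: continuousN.
- exact: polyf_N.
- by move=> y /lw; rewrite (lapN y hw) ler_norml => /andP[? ?]; lra.
- by move=> y /bw; rewrite ler_norml => /andP[? ?]; lra.
Qed.

(** The bound [K] on the Laplacian stays fixed while [e] tends to 0; this is enough to make the
    gradients converge. *)
Definition approx x0 r (K : R) v (e : R) W := polyf W /\
  forall x, ceball x0 r x -> `|W x - v x| <= e /\ `|laplacian W x| <= K.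

Lemma pvisc_approx u H x0 r e : (0 < n)%N -> 0 < r -> 0 < e ->
  pvisc (eball x0 r) u H ->
  (forall x, ceball x0 (n%:R * r) x -> {for x, continuous u}) ->
  (forall x, ceball x0 (n%:R * r) x -> {for x, continuous H}) ->
  exists2 w, polyf w & forall x, ceball x0 r x ->
    `|w x - u x| <= e /\ `|laplacian w x - H x| <= e.
Proof.
move=> n0 r0 e0 hu cu cH.
have q0 : 0 < 1 + r ^+ 2 by rewrite ltr_pwDl // sqr_ge0.
(* Comparison on a ball of radius [r] enlarges an error by the factor 1 + r^2. *)
pose d := e / (1 + r ^+ 2); have d0 : 0 < d by rewrite divr_gt0.
have dE : d + d * r ^+ 2 = e by rewrite /d -[X in X + _]mulr1 -mulrDr divfK // gt_eqF.
have [p hp pE] := poly_dense r0 d0 cu; have [h hh hE] := poly_dense r0 d0 cH.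
have [w [hw wl wb]] := dirichlet_poly x0 r n0 hp hh.
have sub : ceball x0 r `<=` ceball x0 (n%:R * r).
  by move=> y; rewrite /ceball /= => /le_trans; apply; rewrite ler_peMl ?ler1n // ltW.
exists w => // x xr; split.
  rewrite -dE; apply: (pvisc_comparison n0 r0 d0 hu) => //.
  - by move=> y /sub; exact: cu.
  - by move=> y yr; rewrite wl; exact: hE.
  - by move=> y yr; rewrite wb //; apply: pE; rewrite /ceball /= yr.
rewrite wl; apply: le_trans (hE x xr) _; rewrite -dE lerDl mulr_ge0 ?sqr_ge0 //.
exact: ltW.
Qed.

Section UniformLimit.
Variables (x0 : 'rV[R]_n) (r K : R) (v : 'rV[R]_n -> R).
Hypotheses (r0 : 0 < r) (K0 : 0 < K).
Hypothesis happ : forall e, 0 < e -> exists W, approx x0 r K v e W.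

Let r20 : 0 < r / 2. Proof. by rewrite divr_gt0. Qed.

Let approx_le e e' W : e <= e' -> approx x0 r K v e W -> approx x0 r K v e' W.
Proof.
move=> ee [hW h]; split=> // x /h[h1 h2]; split=> //; exact: le_trans h1 ee.
Qed.

(** On balls of radius [s] the gradient estimate for [W - W'] reads 2 n e / s + 2 K s. The second
    term is made small by [s], then the first by [e]. *)
Lemma approx_cauchy d : 0 < d -> exists2 e, 0 < e & forall W W' i x,
  approx x0 r K v e W -> approx x0 r K v e W' -> eball x0 (r / 2) x ->
  `|partial i W x - partial i W' x| <= d.
Proof.
move=> d0; pose s := Num.min (r / 2) (d / (4 * K)).
have s0 : 0 < s by rewrite lt_min r20 divr_gt0 // mulr_gt0.
have n1 : 0 < n%:R + 1 :> R by rewrite ltr_wpDl.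
exists (d * s / (4 * (n%:R + 1))); first by rewrite divr_gt0 ?mulr_gt0.
set e := _ / _; move=> W W' i x [hW h] [hW' h'] xr.
have inb y : ceball x s y -> ceball x0 r y.
  apply: ceball_sub; have : s <= r / 2 by rewrite ge_min lexx.
  by move: xr; rewrite /eball /=; lra.
have := @gradient_estimate R n (fun y => W y - W' y) x s (2 * e) (2 * K) i.
rewrite (partialB i hW hW') => /(_ (polyf_B hW hW') s0) H'.
apply: le_trans (H' _ _ _) _.
- by rewrite mulr_gt0.
- move=> y /inb yr; have [+ _] := h y yr; have [+ _] := h' y yr.
  by rewrite !ler_norml => /andP[? ?] /andP[? ?]; apply/andP; split; lra.
- move=> y /inb yr; rewrite (lapB y hW hW').
  apply: le_trans (ler_normB _ _) _; rewrite mulr_natl mulr2n.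
  by apply: lerD; [exact: (h y yr).2|exact: (h' y yr).2].
have h1 : n%:R * (2 * e) / s <= d / 2.
  rewrite (_ : _ / s = d / 2 * (n%:R / (n%:R + 1))).
    by rewrite ler_piMr ?divr_ge0 ?(ltW d0) // ler_pdivrMr // mul1r lerDl ler01.
  by rewrite /e; field; rewrite (gt_eqF n1) (gt_eqF s0).
have h2 : 2 * K * s <= d / 2.
  have : s <= d / (4 * K) by rewrite ge_min lexx orbT.
  by rewrite ler_pdivlMr ?mulr_gt0 //; lra.
lra.
Qed.

(** The theorem on limits of functions whose derivatives converge uniformly. The second conclusion
    holds for every approximant of accuracy [e], not just for a chosen sequence, so that difference
    quotients of such approximants can be controlled later. *)
Lemma approx_C1 : (forall x, eball x0 (r / 2) x -> {for x, continuous v}) ->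
  C1on (eball x0 (r / 2)) v /\
  forall d, 0 < d -> exists2 e, 0 < e & forall W i x,
    approx x0 r K v e W -> eball x0 (r / 2) x ->
    `|partial i W x - partial i v x| <= d.
Proof.
move=> cv; have /choice[w wP] : forall k : nat, exists W, approx x0 r K v k.+1%:R^-1 W.
  by move=> k; apply: happ; rewrite invr_gt0.
have small e : 0 < e -> exists N, forall k, (N <= k)%N -> approx x0 r K v e (w k).
  move=> e0; exists (Num.truncn e^-1) => k Nk; apply: approx_le (wP k).
  rewrite invf_ple ?posrE //; apply: le_trans (ltW (truncnS_gt _)) _.
  by rewrite ler_nat.
pose U := eball x0 (r / 2).
have conv i x : exists d, U x -> forall a e, 0 < a -> (forall W W' i x,
    approx x0 r K v e W -> approx x0 r K v e W' -> U x ->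
    `|partial i W x - partial i W' x| <= a) -> forall k, approx x0 r K v e (w k) -> 
    (0 < e) -> `|partial i (w k) x - d| <= a.
  have [Ux|] := pselect (U x); last by exists 0.
  have [a0 a00|d dP] := @real_cauchy R (fun k => partial i (w k) x).
    have [e e0 eP] := approx_cauchy a00; have [N NP] := small e e0.
    exists N => k l Nk Nl.
    exact: (eP (w k) (w l) i x (NP k Nk) (NP l Nl) Ux).
  exists d => _ a e a0 he k kP e0; have [N NP] := small e e0.
  apply/ler_addgt0Pr => s s0; have [e' e'0 eP'] := approx_cauchy s0.
  have [N' NP'] := small e' e'0; pose M := maxn N N'.
  have h1 : `|partial i (w k) x - partial i (w M) x| <= a.
    exact: (he (w k) (w M) i x kP (NP M (leq_maxl _ _)) Ux).
  have hc k' l : (N' <= k')%N -> (N' <= l)%N ->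
     `|partial i (w k') x - partial i (w l) x| <= s.
    by move=> hk hl; exact: (eP' (w k') (w l) i x (NP' k' hk) (NP' l hl) Ux).
  have h2 := dP s N' s0 hc M (leq_maxr _ _); move: h1 h2.
  move: (partial i (w k) x) (partial i (w M) x) => p q; rewrite !ler_norml.
  by move=> /andP[? ?] /andP[? ?]; apply/andP; split; lra.
have /choice[D DP] : forall ix : 'I_n * 'rV[R]_n, exists d, U ix.2 ->
   forall a e, 0 < a -> (forall W W' i x,
    approx x0 r K v e W -> approx x0 r K v e W' -> U x ->
    `|partial i W x - partial i W' x| <= a) -> forall k, approx x0 r K v e (w k) ->
    (0 < e) -> `|partial ix.1 (w k) ix.2 - d| <= a.
  by move=> [i x]; exact: conv.
have Dclose a : 0 < a -> exists2 e, 0 < e & forall W i x, approx x0 r K v e W ->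
    U x -> `|partial i W x - D (i, x)| <= a.
  move=> a0; have a20 : 0 < a / 2 by rewrite divr_gt0.
  have [e e0 eP] := approx_cauchy a20; exists e => // W i x hW Ux.
  have [N NP] := small e e0; have h1 := DP (i, x) Ux (a / 2) e a20 eP N (NP N (leqnn _)) e0.
  have := eP W (w N) i x hW (NP N (leqnn _)) Ux; move: h1 => /=.
  move: (partial i W x) (partial i (w N) x) => p q; rewrite !ler_norml.
  by move=> /andP[? ?] /andP[? ?]; apply/andP; split; lra.
have Dder i x : U x -> is_derive x (delta_mx 0 i) v (D (i, x)).
  move=> Ux; apply/is_derive_epsP => e e0; have e40 : 0 < e / 4 by rewrite divr_gt0.
  have [s s0 sP] := approx_cauchy e40; have [s' s'0 sP'] := Dclose _ e40.
  pose m := Num.min s s'; have m0 : 0 < m by rewrite lt_min s0.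
  have ms : m <= s by rewrite ge_min lexx.
  have ms' : m <= s' by rewrite ge_min lexx orbT.
  have [N NP] := small m m0; have hN := NP N (leqnn _).
  have [hNp _] := hN.
  have /is_derive_epsP/(_ _ e40)[q q0 qP] := (polyf_derive i hNp).1 x.
  pose t0 := Num.min q (r / 2 - enorm (x - x0)).
  have t00 : 0 < t0 by rewrite lt_min q0 subr_gt0.
  exists t0 => // t; rewrite lt_min => /andP[tq tr].
  have inU a : `|a| <= `|t| -> U (x + a *: delta_mx 0 i).
    move=> at_; rewrite /U /eball /= addrAC.
    apply: le_lt_trans (enormD _ _) _; rewrite enormZ enorm_delta mulr1.
    by move: at_ tr; lra.
  (* [v] is not yet known to be differentiable, so the mean value theorem is applied to [w N - W]
     for ever better approximants [W], and the bound passes to the limit. *)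
  have mv : `|(w N (x + t *: delta_mx 0 i) - v (x + t *: delta_mx 0 i)) -
      (w N x - v x)| <= e / 4 * `|t|.
    apply/ler_addgt0Pr => a a0; have a20 : 0 < a / 2 by rewrite divr_gt0.
    have [N' NP'] := small _ a20; have [N'' NP''] := small _ m0.
    have hM := NP' (maxn N' N'') (leq_maxl _ _); have hM' := NP'' (maxn N' N'') (leq_maxr _ _).
    move: (w (maxn N' N'')) hM hM' => W hM hM'; have hWp := hM.1.
    have fine_t : `|(w N (x + t *: delta_mx 0 i) - W (x + t *: delta_mx 0 i)) -
      (w N x - W x)| <= e / 4 * `|t|.
      have [->|tn0] := eqVneq t 0.
        by rewrite scale0r addr0 subrr normr0 mulr0.
      have hd := polyf_B hNp hWp.
      have [a1 a1P|c c01] := @MVT_line R _ (fun y => w N y - W y) x (t *: delta_mx 0 i)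
        (fun a1 => t * partial i (fun y => w N y - W y) (x + a1 *: (t *: delta_mx 0 i)))
        0 1 ltr01.
        by apply: is_deriveZv; exact: (polyf_derive i hd).1.
      rewrite scale1r scale0r addr0 subr0 mulr1 => ->.
      rewrite normrM mulrC ler_wpM2r // (partialB i hNp hWp).
      apply: (sP (w N) W i _ (approx_le ms hN) (approx_le ms hM')).
      rewrite scalerA; apply: inU; rewrite normrM ler_piMl //.
      by case/andP: c01 => c0 c1; rewrite gtr0_norm // ltW.
    have subr : U `<=` ceball x0 r.
      by move=> y; rewrite /U /eball /ceball /= => yU; move: r0; lra.
    have [h1 _] := hM.2 x (subr _ Ux).
    have [h2 _] := hM.2 _ (subr _ (inU t (lexx _))).
    move: fine_t h1 h2; rewrite !ler_norml.
    move: (w N _) (W (x + _)) (v (x + _)) (w N x) (W x) (v x) (e / 4 * _) => b1 b2 b3 b4 b5 b6 b7.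
    by move=> /andP[? ?] /andP[? ?] /andP[? ?]; apply/andP; split; lra.
  have hD' := sP' (w N) i x (approx_le ms' hN) Ux.
  have := qP t tq; move: mv.
  have : `|t * (partial i (w N) x - D (i, x))| <= e / 4 * `|t|.
    by rewrite normrM mulrC ler_wpM2r.
  have : 0 <= e / 4 * `|t| by rewrite mulr_ge0 // ltW.
  rewrite (_ : e * `|t| = 4 * (e / 4 * `|t|)); last by field.
  move: (w N _) (v (x + _)) (w N x) (v x) (e / 4 * _) (partial i _ x) (D _) => b1 b2 b3 b4 b5 b6 b7.
  rewrite !ler_norml => ? /andP[? ?] /andP[? ?] /andP[? ?]; apply/andP; split; lra.
have Dpart i x : U x -> partial i v x = D (i, x).
  by move=> Ux; apply: partial_eq; exact: Dder.
split; last first.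
  move=> d d0; have [e e0 eP] := Dclose d d0; exists e => // W i x hW Ux.
  by rewrite Dpart //; exact: eP.
move=> x Ux; split=> [|i]; first exact: cv.
split; first by case: (Dder i x Ux).
apply/cont_enormP => e e0; have e40 : 0 < e / 4 by rewrite divr_gt0.
have [s s0 sP] := Dclose _ e40; have [W hW] := happ s0.
have /cont_enormP/(_ _ e40)[q q0 qP] := @polyf_cont _ _ _ x (polyf_derive i hW.1).2.
exists (Num.min q (r / 2 - enorm (x - x0))); first by rewrite lt_min q0 subr_gt0.
move=> y; rewrite lt_min => /andP[yq yr].
have Uy : U y by apply: (eball_sub _ yr); rewrite addrC subrK.
rewrite !Dpart //; have := sP W i x hW Ux; have := sP W i y hW Uy; have := qP y yq.
move: (partial i W x) (partial i W y) (D (i, x)) (D (i, y)) => p1 p2 p3 p4.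
rewrite !ler_norml !ltr_norml => /andP[? ?] /andP[? ?] /andP[? ?]; apply/andP; split; lra.
Qed.

End UniformLimit.

Lemma compact_bound (A : set 'rV[R]_n) v : compact A ->
  (forall x, A x -> {for x, continuous v}) ->
  exists2 M, 0 < M & forall x, A x -> `|v x| <= M.
Proof.
move=> cA cv; have [A0|/set0P[x0 Ax0]] := eqVneq A set0.
  by exists 1 => // x; rewrite A0.
have [c Ac cmax] := compact_max Ax0 cA
  (fun x Ax => continuous_comp (cv x Ax) (@norm_continuous _ _ _)).
by exists (`|v c| + 1) => [|x /cmax]; [rewrite ltr_pwDr|move=> /= h; lra].
Qed.

Lemma pvisc_C1 u H x0 r : (0 < n)%N -> 0 < r -> pvisc (eball x0 r) u H ->
  (forall x, ceball x0 (n%:R * r) x -> {for x, continuous u}) ->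
  (forall x, ceball x0 (n%:R * r) x -> {for x, continuous H}) ->
  C1on (eball x0 (r / 2)) u.
Proof.
move=> n0 r0 hu cu cH.
have sub : ceball x0 r `<=` ceball x0 (n%:R * r).
  by move=> y; rewrite /ceball /= => /le_trans; apply; rewrite ler_peMl ?ler1n // ltW.
have [M M0 hM] := @compact_bound (ceball x0 r) H (@compact_ceball _ _ _ _)
  (fun x xr => cH x (sub x xr)).
have [||x xr|//] := @approx_C1 x0 r (M + 1) u r0.
- by rewrite addr_gt0.
- move=> e e0; have e'0 : 0 < Num.min e 1 by rewrite lt_min e0 ltr01.
  have [w hw wP] := pvisc_approx n0 r0 e'0 hu cu cH.
  exists w; split=> // x xr; have [h1 h2] := wP x xr; split.
    by apply: le_trans h1 _; rewrite ge_min lexx.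
  have {}h2 : `|laplacian w x - H x| <= 1.
    by apply: le_trans h2 _; rewrite ge_min lexx orbT.
  have := hM x xr; move: h2; move: (laplacian w x) (H x) => p q.
  by rewrite !ler_norml => /andP[? ?] /andP[? ?]; apply/andP; split; lra.
- apply/cu/sub; move: xr; rewrite /eball /ceball /=; move: r0; lra.
Qed.

(** [approx_C1] is applied once more, to [partial j u]. The approximants are difference quotients of
    [w] with step [t]; as [H] is Lipschitz and [lap w] is within [t] of [H], their Laplacians are
    bounded by [L + 2], uniformly in [t]. *)
Lemma lipschitz_C2 u H x0 r L : 0 < r -> 0 <= L ->
  (forall e, 0 < e -> exists2 w, polyf w & forall x, ceball x0 r x ->
    `|w x - u x| <= e /\ `|laplacian w x - H x| <= e) ->
  (forall x, ceball x0 r x -> {for x, continuous u}) ->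
  (forall x y, ceball x0 r x -> ceball x0 r y -> `|H x - H y| <= L * enorm (x - y)) ->
  C2on (eball x0 (r / 8)) u.
Proof.
move=> r0 L0 happ cu hL; pose K := `|H x0| + L * r + 1.
have K0 : 0 < K by rewrite ltr_pwDr // addr_ge0 // mulr_ge0 // ltW.
have hK w e x : e <= 1 -> ceball x0 r x -> `|laplacian w x - H x| <= e ->
    `|laplacian w x| <= K.
  move=> e1 xr; have x0r : ceball x0 r x0 by rewrite /ceball /= subrr enorm0 ltW.
  have := hL x x0 xr x0r; have : L * enorm (x - x0) <= L * r by rewrite ler_wpM2l.
  rewrite /K; have : - `|H x0| <= H x0 <= `|H x0| by rewrite -ler_norml.
  move: `|H x0| => N.
  move: (laplacian w x) (H x) (H x0) (L * r) (L * enorm _) => p q s a b.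
  clear -e1; rewrite !ler_norml => /andP[? ?] ? /andP[? ?] /andP[? ?].
  by apply/andP; split; lra.
have happK e : 0 < e -> exists W, approx x0 r K u e W.
  move=> e0; have e'0 : 0 < Num.min e 1 by rewrite lt_min e0 ltr01.
  have [w hw wP] := happ _ e'0; exists w; split=> // x xr; have [h1 h2] := wP x xr.
  split; first by apply: le_trans h1 _; rewrite ge_min lexx.
  by apply: hK h2 => //; rewrite ge_min lexx orbT.
have sub : eball x0 (r / 2) `<=` ceball x0 r.
  by move=> x; rewrite /eball /ceball /=; move: r0; lra.
have [uC close] := approx_C1 r0 K0 happK (fun x xr => cu x (sub x xr)).
have sub8 : eball x0 (r / 8) `<=` eball x0 (r / 2).
  by move=> x; rewrite /eball /=; move: r0; lra.
split=> [x /sub8|j]; first exact: uC.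
have r40 : 0 < r / 4 by rewrite divr_gt0.
have L2 : 0 < L + 2 by rewrite ltr_wpDl.
rewrite (_ : r / 8 = r / 4 / 2); last by field.
have subc : ceball x0 (3 * r / 8) `<=` eball x0 (r / 2).
  by move=> x; rewrite /eball /ceball /=; move: r0; lra.
have cv x : eball x0 (r / 2) x -> {for x, continuous (partial j u)}.
  by move=> /uC[_ /(_ j)[]].
apply: (approx_C1 r40 L2 _ _).1; last first.
  by move=> x xr; apply: cv; move: xr; rewrite /eball /=; move: r0; lra.
move=> e e0; have e30 : 0 < e / 3 by rewrite divr_gt0.
have [C C0 CP] := quadratic_modulus (@compact_ceball _ _ x0 (3 * r / 8))
  (fun x xr => cv x (subc x xr)) e30.
have [e1 e10 e1P] := close _ e30.
have C1 : 0 < C + 1 by rewrite ltr_wpDl.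
pose t := Num.min (Num.min (r / 8) 1) (e / 3 / (C + 1)).
have t0 : 0 < t by rewrite !lt_min ltr01 !divr_gt0.
have tr : t <= r / 8 by rewrite !ge_min lexx.
have t1 : t <= 1 by rewrite !ge_min lexx orbT.
have tC : C * t ^+ 2 <= e / 3.
  apply: le_trans (_ : t * (C + 1) <= _); last first.
    by rewrite -ler_pdivlMr // ge_min lexx orbT.
  rewrite expr2 mulrCA ler_pM2l //; apply: le_trans (_ : C <= _); last by rewrite lerDl.
  by rewrite ler_piMr.
clearbody t.
(* The accuracy [e1] controls the gradient of [w], [t] the Laplacian of the difference quotient, and
   1 gives the fixed bound [K]. *)
pose e2 := Num.min (Num.min e1 t) 1.
have e20 : 0 < e2 by rewrite !lt_min e10 t0 ltr01.
have [w hw wP] := happ _ e20.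
pose h : 'rV[R]_n := t *: delta_mx 0 j.
have hwh : polyf (fun x => w (x + h)) by exact: polyf_shift.
have eh (c : R) : 0 <= c -> enorm (c *: (delta_mx 0 j : 'rV[R]_n)) = c.
  by move=> c0; rewrite enormZ enorm_delta mulr1 ger0_norm.
have wapp : approx x0 r K u e1 w.
  split=> // x xr; have [h1 h2] := wP x xr; split.
    by apply: le_trans h1 _; rewrite !ge_min lexx.
  by apply: hK h2 => //; rewrite !ge_min lexx !orbT.
exists (fun x => t^-1 * (w (x + h) - w x)); split.
  by apply: polyf_Z; exact: polyf_B.
move=> x xr; split.
  have [a a1P|c /andP[c0 ct] cE] := @MVT_line R _ w x (delta_mx 0 j)
    (fun a => partial j w (x + a *: delta_mx 0 j)) 0 t t0.
    exact: (polyf_derive j hw).1.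
  pose y := x + c *: delta_mx 0 j.
  have yx : enorm (y - x) <= t.
    by rewrite /y addrAC subrr add0r eh ltW.
  have yin : ceball x0 (3 * r / 8) y.
    apply: (@ceball_sub _ _ x0 x t); last by [].
    by move: xr tr; rewrite /ceball /=; lra.
  have xin : ceball x0 (3 * r / 8) x.
    by move: xr; rewrite /ceball /=; move: r0; lra.
  have -> : t^-1 * (w (x + h) - w x) = partial j w y.
    move: cE; rewrite scale0r addr0 subr0 => ->.
    by rewrite mulrC mulfK // gt_eqF.
  have h1 := e1P w j y wapp (subc _ yin); have h2 := CP x y xin yin.
  have h3 : C * dot (y - x) (y - x) <= e / 3.
    apply: le_trans tC; rewrite -enorm_sqr ler_wpM2l //.
    by rewrite lerXn2r ?nnegrE ?enorm_ge0 // ltW.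
  move: h1 h2 h3; move: (partial j w y) (partial j u y) (partial j u x) (C * _) => p q s b.
  by rewrite !ler_norml => /andP[? ?] /andP[? ?] ?; apply/andP; split; lra.
rewrite (lapZ _ x (polyf_B hwh hw)) (lapB x hwh hw) (lap_shift h x hw).
have xin : ceball x0 r x by move: xr; rewrite /ceball /=; move: r0; lra.
have xhin : ceball x0 r (x + h).
  apply: (@ceball_sub _ _ x0 x (r / 8)); first by move: xr; rewrite /ceball /=; move: r0; lra.
  by rewrite /ceball /= addrAC subrr add0r eh // ltW.
have [_ h1] := wP _ xin; have [_ h2] := wP _ xhin.
have := hL _ _ xhin xin; rewrite addrAC subrr add0r eh ?(ltW t0) // => h3.
have h4 : e2 <= t by rewrite !ge_min lexx orbT.
rewrite normrM gtr0_norm ?invr_gt0 // ler_pdivrMl //.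
move: h1 h2 h3; move: (laplacian w x) (laplacian w _) (H x) (H _) => p q s b.
by rewrite !ler_norml => /andP[? ?] /andP[? ?] /andP[? ?]; apply/andP; split; lra.
Qed.

End Regularity.

(** * The eikonal equation for continuously differentiable solutions *)

Section Eikonal.
Variables (R : realType) (n : nat).
Implicit Types (u v : 'rV[R]_n -> R) (x y z : 'rV[R]_n) (U : set 'rV[R]_n).

Lemma within_eps (I : set R) (f : R -> R) t (e : R) : {within I, continuous f} ->
  I t -> 0 < e -> exists2 d, 0 < d & forall s, I s -> `|s - t| < d -> `|f s - f t| < e.
Proof.
move=> /subspace_continuousP cf It e0; have := cf t It.
move=> /cvgrPdist_lt /(_ e e0) /nbhs_ballP[d /= d0 dP]; exists d => // s Is sd.
by rewrite distrC; apply: (dP s) => //; rewrite /ball /= distrC.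
Qed.

Lemma within_comp (I : set R) (f : R -> R) U u x : {within I, continuous f} ->
  open U -> u @` U `<=` I -> U x -> {for x, continuous u} ->
  {for x, continuous (fun y => f (u y))}.
Proof.
move=> cf oU uI Ux cu; apply/cont_enormP => e e0.
have [d d0 dP] := within_eps cf (uI _ (imageP u Ux)) e0.
have /cont_enormP/(_ _ d0)[s s0 sP] := cu.
have /nbhs_enormP[s' s'0 sP'] : nbhs x U by exact: open_nbhs_nbhs.
exists (Num.min s s'); first by rewrite lt_min s0.
by move=> y; rewrite lt_min => /andP[/sP h /sP' Uy]; apply: dP => //; exact/uI/imageP.
Qed.

Lemma gradient_cont U u x e : C1on U u -> U x -> 0 < e ->
  exists2 d, 0 < d & forall y, enorm (y - x) < d ->
    enorm (gradient u y - gradient u x) < e.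
Proof.
move=> uC Ux e0; have [_ /all_and2[_ cu]] := uC x Ux.
have n1 : 0 < n%:R + 1 :> R by rewrite ltr_wpDl.
have /nbhs_enormP[d d0 dP] : \forall y \near x, forall i : 'I_n,
    `|(gradient u y - gradient u x) 0 i| <= e / (n%:R + 1).
  apply: filter_forall => i.
  have /cont_enormP/(_ _ (divr_gt0 e0 n1))[r r0 rP] := cu i.
  by apply/nbhs_enormP; exists r => // y /rP /ltW; rewrite !mxE.
exists d => // y /dP h; apply: le_lt_trans (enorm_sum_le _) _.
apply: le_lt_trans (ler_sum _ (fun i _ => h i)) _.
rewrite sumr_const card_ord -[ltLHS]mulr_natr -mulrA -[ltRHS]mulr1 ltr_pM2l //.
by rewrite mulrC ltr_pdivrMr // mul1r ltrDl.
Qed.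

Lemma enorm_gradient_cont U u x : C1on U u -> U x ->
  {for x, continuous (fun y => enorm (gradient u y))}.
Proof.
move=> uC Ux; apply/cont_enormP => e e0.
have [d d0 dP] := gradient_cont uC Ux e0; exists d => // y /dP.
apply: le_lt_trans; rewrite ler_norml; apply/andP; split.
  rewrite lerBrDr; have := enormD (gradient u x - gradient u y) (gradient u y).
  by rewrite subrK (enormB (gradient u x)); lra.
by have := enormD (gradient u y - gradient u x) (gradient u x); rewrite subrK; lra.
Qed.

Lemma touch_gradient U u phi x r : C1on U u -> C1on U phi -> U x -> 0 < r ->
  phi x = u x -> (forall y, enorm (y - x) < r -> u y <= phi y) ->
  gradient phi x = gradient u x.
Proof.
move=> uC hC Ux r0 pu pmin; apply/rowP => i.
have h1 := C1_partial i uC Ux; have h2 := C1_partial i hC Ux.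
have := derive_min0 (is_deriveB h2 h1) r0; move=> h; apply/eqP.
rewrite -subr_eq0; apply/eqP; apply: h => y /pmin; rewrite !fctE pu subrr.
by rewrite subr_ge0.
Qed.

(** The paraboloid is so steep that [u - q] is smaller on the sphere than at its centre: K r^2 = 2 M
    + 1 exceeds the oscillation of [u]. The maximum is therefore interior, and a shifted paraboloid
    touches there. *)
Lemma touch_above_exists u c r : 0 < r ->
  (forall x, ceball c r x -> {for x, continuous u}) ->
  exists x phi s, [/\ eball c r x, polyf phi, 0 < s, phi x = u x &
    forall y, enorm (y - x) < s -> u y <= phi y].
Proof.
move=> r0 cu; have [M M0 hM] := compact_bound (@compact_ceball _ _ c r) cu.
pose K := (2 * M + 1) / r ^+ 2.
have r2 : 0 < r ^+ 2 by rewrite exprn_gt0.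
pose q x := K * dot (x - c) (x - c).
have hq : polyf q by apply: polyf_Z; exact: (polyf_shift (- c) (polyf_sqnorm R n)).
have cc : ceball c r c by rewrite /ceball /= subrr enorm0 ltW.
have [x xr xmax] := compact_max cc (@compact_ceball _ _ c r)
   (fun y yr => @continuousB _ _ _ u q y (cu y yr) (@polyf_cont _ _ _ y hq)).
have xn : enorm (x - c) < r.
  rewrite lt_def; move: (xr); rewrite /ceball /= => ->; rewrite andbT.
  apply/eqP => xE; have := xmax c cc; rewrite !fctE /q subrr dot0l mulr0 subr0.
  rewrite -enorm_sqr -xE divfK ?gt_eqF //.
  have := hM c cc; have := hM x xr; rewrite !ler_norml => /andP[? ?] /andP[? ?]; lra.
exists x, (fun y => q y + (u x - q x)), (r - enorm (x - c)); split => //.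
- by apply: polyf_D => //; exact: polyf_cst.
- by rewrite subr_gt0.
- by rewrite addrC subrK.
move=> y yx; have /xmax : ceball c r y.
  apply: (@ceball_sub _ _ c x (r - enorm (x - c))); first by rewrite addrC subrK.
  exact: ltW.
by rewrite !fctE; lra.
Qed.

Lemma sgn_ge0 (t : R) : 0 <= t -> sgn t = 1.
Proof. by rewrite /sgn => ->. Qed.

Lemma sgn_lt0 (t : R) : t < 0 -> sgn t = -1.
Proof. by rewrite /sgn leNgt => ->. Qed.

Lemma sign_conflict (s p q : R) : `|s| = 1 -> 0 < s * p -> 0 < s * q -> 0 <= p -> q <= 0 -> False.
Proof.
move=> /eqP; rewrite eqr_norml ler01 andbT => /orP[] /eqP ->; lra.
Qed.

(* Points where [u] is touched from above, and points where it is touched from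
   below, are dense, and at both kinds of points [u] is differentiable; so the sign
   of [f u - |grad u|] on a small ball is incompatible with one of the two tests,
   whichever sign [g u] has there. *)
Lemma eikonal_pointwise (f g : R -> R) (Omega : set 'rV[R]_n) u :
  open Omega -> C1on Omega u ->
  (forall x, Omega x -> {for x, continuous (fun y => f (u y))}) ->
  (forall x, Omega x -> {for x, continuous (fun y => g (u y))}) ->
  viscosity_solution (@eikonal_op R n f g) Omega u ->
  forall x, Omega x -> enorm (gradient u x) = f (u x).
Proof.
move=> oO uC cf cg [_ visc].
pose E y := f (u y) - enorm (gradient u y).
have cE y : Omega y -> {for y, continuous E}.
  by move=> Oy; apply: continuousB; [exact: cf|exact: enorm_gradient_cont uC Oy].
have tabove x phi s : Omega x -> polyf phi -> 0 < s -> phi x = u x ->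
    (forall y, enorm (y - x) < s -> u y <= phi y) -> 0 <= sgn (g (u x)) * E x.
  move=> Ox hphi s0 pu pmin; have [_] := visc x phi Ox (polyf_C2_near x hphi).
  rewrite /eikonal_op (touch_gradient uC (@polyf_C1 _ _ phi Omega hphi) Ox s0 pu pmin) pu.
  by apply; split=> //; apply/nbhs_enormP; exists s => // y; exact: pmin.
have tbelow x phi s : Omega x -> polyf phi -> 0 < s -> phi x = u x ->
    (forall y, enorm (y - x) < s -> phi y <= u y) -> sgn (g (u x)) * E x <= 0.
  move=> Ox hphi s0 pu pmin; have [+ _] := visc x phi Ox (polyf_C2_near x hphi).
  have := touch_gradient (@polyf_C1 _ _ phi Omega hphi) uC Ox s0 (esym pu) pmin.
  rewrite /eikonal_op => <-; rewrite pu.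
  by apply; split=> //; apply/nbhs_enormP; exists s => // y; exact: pmin.
have above c r : 0 < r -> ceball c r `<=` Omega ->
    exists2 x, eball c r x & 0 <= sgn (g (u x)) * E x.
  move=> r0 rO; have [x [phi [s [xr hphi s0 pu pmin]]]] :=
    touch_above_exists r0 (fun x xr => (uC x (rO x xr)).1).
  by exists x => //; apply: tabove hphi s0 pu pmin; exact/rO/eball_ceball.
have below c r : 0 < r -> ceball c r `<=` Omega ->
    exists2 x, eball c r x & sgn (g (u x)) * E x <= 0.
  move=> r0 rO; have [x [phi [s [xr hphi s0 pu pmin]]]] :=
    touch_above_exists r0 (fun x xr => continuousN (uC x (rO x xr)).1).
  exists x => //; apply: (tbelow x (fun y => - phi y) s) => //.
  - exact/rO/eball_ceball.
  - exact: polyf_N.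
  - by rewrite pu opprK.
  - by move=> y /pmin; rewrite lerNl.
have nb x (P : set 'rV[R]_n) : Omega x -> nbhs x P ->
    exists r, [/\ 0 < r, ceball x r `<=` Omega & ceball x r `<=` P].
  move=> Ox nP; have : nbhs x (Omega `&` P) by apply: filterI => //; exact: open_nbhs_nbhs.
  move=> /nbhs_enormP[r r0 rP]; exists (r / 2); split; first by rewrite divr_gt0.
    move=> y yr; apply: (rP y _).1; apply: le_lt_trans yr _.
    by rewrite ltr_pdivrMr // ltr_pMr // ltr1n.
  move=> y yr; apply: (rP y _).2; apply: le_lt_trans yr _.
  by rewrite ltr_pdivrMr // ltr_pMr // ltr1n.
have pos_nbhs (h : 'rV[R]_n -> R) x : {for x, continuous h} -> 0 < h x ->
    nbhs x [set y | 0 < h y].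
  move=> /cont_enormP ch hx; have [d d0 dP] := ch _ hx.
  apply/nbhs_enormP; exists d => // y /dP; rewrite ltr_norml => /andP[? ?] /=; lra.
move=> x Ox; apply/eqP; rewrite eq_sym -subr_eq0; apply/eqP; change (E x = 0).
have key (s : R) : `|s| = 1 -> 0 < s * E x -> False.
  move=> s1 sE; have csE : {for x, continuous (fun y => s * E y)}.
    by apply: continuousM; [exact: cst_continuous|exact: cE].
  have [r [r0 rO rP]] := nb _ _ Ox (pos_nbhs (fun y => s * E y) x csE sE).
  (* The sign function jumps at 0, so it is made constant first: if g (u) < 0 at some point, it
     stays negative on a smaller ball and the sign is - 1 there; otherwise the sign is 1 on the
     whole ball. *)
  have [[y yr gy]|gpos] := pselect (exists2 y, ceball x r y & g (u y) < 0).
    have cNg : {for y, continuous (fun z => - g (u z))}.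
      by apply: continuousN; apply: cg; exact: rO.
    have gy' : 0 < - g (u y) by rewrite oppr_gt0.
    have csEy : {for y, continuous (fun y => s * E y)}.
      by apply: continuousM; [exact: cst_continuous|exact/cE/rO].
    have hn : nbhs y ([set z | 0 < - g (u z)] `&` [set z | 0 < s * E z]).
      exact: (filterI (pos_nbhs (fun z => - g (u z)) y cNg gy')
        (pos_nbhs (fun z => s * E z) y csEy (rP y yr))).
    have [q [q0 qO qP]] := nb _ _ (rO _ yr) hn.
    have [a aq aE] := above _ _ q0 qO; have [b bq bE] := below _ _ q0 qO.
    have [/= ga sa] := qP a (eball_ceball aq); have [/= gb sb] := qP b (eball_ceball bq).
    move: aE bE; rewrite !sgn_lt0 -?oppr_gt0 // !mulN1r oppr_ge0 oppr_le0 => aE bE.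
    exact: (sign_conflict s1 sb sa bE aE).
  have sg y : ceball x r y -> sgn (g (u y)) = 1.
    by move=> yr; apply: sgn_ge0; rewrite leNgt; apply/negP => gy; apply: gpos; exists y.
  have [a aq aE] := above _ _ r0 rO; have [b bq bE] := below _ _ r0 rO.
  have /= sa := rP a (eball_ceball aq); have /= sb := rP b (eball_ceball bq).
  move: aE bE; rewrite !sg; try exact: eball_ceball.
  by rewrite !mul1r => aE bE; exact: (sign_conflict s1 sa sb aE bE).
have [E0|E0|//] := ltgtP (E x) 0; exfalso.
  by apply: (key (-1)); rewrite ?normrN1 // mulN1r oppr_gt0.
by apply: (key 1); rewrite ?normr1 // mul1r.
Qed.

Lemma poisson_pvisc (g : R -> R) (Omega : set 'rV[R]_n) u :
  viscosity_solution (@poisson_op R n g) Omega u ->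
  pvisc Omega u (fun x => g (u x)).
Proof.
move=> [_ visc]; split=> x phi r Ox hphi r0 pu pmin.
  have [_] := visc x phi Ox (polyf_C2_near x hphi); rewrite /poisson_op pu.
  rewrite (_ : \tr (hessian phi x) = laplacian phi x); last first.
    by apply: eq_bigr => i _; rewrite mxE.
  rewrite subr_ge0; apply; split=> //.
  by apply/nbhs_enormP; exists r => // y; exact: pmin.
have hN := polyf_N hphi.
have [+ _] := visc x (fun y => - phi y) Ox (polyf_C2_near x hN).
rewrite /poisson_op pu opprK.
rewrite (_ : \tr (hessian _ x) = laplacian (fun y => - phi y) x); last first.
  by apply: eq_bigr => i _; rewrite mxE.
rewrite (lapN x hphi) subr_le0 lerNl; apply; split; first by rewrite pu opprK.
by apply/nbhs_enormP; exists r => // y /pmin; rewrite lerNl.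
Qed.

Lemma viscosity_C1 (g : R -> R) (Omega : set 'rV[R]_n) u : (0 < n)%N ->
  open Omega -> (forall x, Omega x -> {for x, continuous u}) ->
  (forall x, Omega x -> {for x, continuous (fun y => g (u y))}) ->
  pvisc Omega u (fun x => g (u x)) -> C1on Omega u.
Proof.
move=> n0 oO cu cg hu x Ox.
have /nbhs_enormP[r r0 rO] : nbhs x Omega by exact: open_nbhs_nbhs.
have n1 : 0 < n%:R + 1 :> R by rewrite ltr_wpDl.
(* [pvisc_C1] asks for continuity on the ball of radius [n * s], which has to lie in [Omega]. *)
pose s := r / (n%:R + 1); have s0 : 0 < s by rewrite divr_gt0.
have sr : s <= r by rewrite ler_pdivrMr // ler_peMr ?(ltW r0) // lerDr.
have sub : eball x s `<=` Omega.
  by move=> y ys; apply: rO; exact: lt_le_trans ys sr.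
have subc : ceball x (n%:R * s) `<=` Omega.
  move=> y ys; apply: rO; apply: le_lt_trans ys _.
  by rewrite /s mulrCA gtr_pMr // ltr_pdivrMr // mul1r ltrDl.
have [h1 h2] := hu; apply: (@pvisc_C1 _ _ u (fun y => g (u y)) x s) => //.
- by split=> y phi q /sub; [exact: h1|exact: h2].
- by move=> y /subc; exact: cu.
- by move=> y /subc; exact: cg.
- by apply: eball_center; rewrite divr_gt0.
Qed.

Lemma is_derive_comp1 (f : R -> R) u x e (p d : R) : is_derive (u x) 1 f p ->
  is_derive x e u d -> is_derive x e (fun y => f (u y)) (p * d).
Proof.
move=> hf hu; have hu' : is_derive (x + 0 *: e) e u d by rewrite scale0r addr0.
have {hu'} hl := (@is_derive_line _ _ u x e d 0).1 hu'.
rewrite -[x](addr0) -(scale0r e); apply: (@is_derive_line _ _ _ x e _ 0).2.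
by apply: is_derive1_comp; rewrite /= scale0r addr0.
Qed.

Lemma C1_comp1 (f df : R -> R) U u : C1on U u ->
  (forall x, U x -> is_derive (u x) 1 f (df (u x))) -> open U ->
  (forall x, U x -> {for x, continuous (fun y => df (u y))}) ->
  C1on U (fun y => f (u y)) /\
  forall x i, U x -> partial i (fun y => f (u y)) x = df (u x) * partial i u x.
Proof.
move=> uC fd oU cdf.
have der x i : U x -> is_derive x (delta_mx 0 i) (fun y => f (u y)) (df (u x) * partial i u x).
  move=> Ux; apply: is_derive_comp1; first exact: fd.
  by have [_ /(_ i)[? _]] := uC x Ux; exact: derivableP.
have pE x i : U x -> partial i (fun y => f (u y)) x = df (u x) * partial i u x.
  by move=> Ux; apply: partial_eq; exact: der.
split=> // x Ux; split=> [|i].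
  apply: continuous_comp; first exact: (uC x Ux).1.
  exact: is_derive_cont1 (fd x Ux).
split; first by case: (der x i Ux).
have /nbhs_enormP[r r0 rU] : nbhs x U by exact: open_nbhs_nbhs.
have cp : {for x, continuous (fun y => df (u y) * partial i u y)}.
  by apply: continuousM; [exact: cdf|have [_ /(_ i)[]] := uC x Ux].
move/cont_enormP : cp => cp; apply/cont_enormP => e /cp[d d0 dP].
exists (Num.min d r); first by rewrite lt_min d0.
by move=> y; rewrite lt_min => /andP[/dP h /rU Uy]; rewrite !pE.
Qed.

Lemma antiderivative (k : R -> R) (a b : R) : a < b ->
  (forall t, a <= t <= b -> {for t, continuous k}) ->
  exists K : R -> R, forall t, a < t < b -> is_derive t 1 K (k t).
Proof.
move=> ab ck.
exists (fun s : R => \int[@lebesgue_measure R]_(t in [set` `[a, s]]) (k t))%R.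
move=> t /andP[at_ tb].
have [||h1 h2] := @continuous_FTC1_closed R k a t b tb _ at_ _.
- apply: continuous_compact_integrable; first exact: segment_compact.
  by apply: continuous_in_subspaceT => s; rewrite inE /= in_itv /=; exact: ck.
- by apply: ck; rewrite !ltW.
by rewrite -h2 derive1E; exact: derivableP.
Qed.

End Eikonal.

(** * Functions with gradient of norm one *)

Section QuadraticForms.
Variables (R : realType) (n : nat).
Implicit Types (A P : 'M[R]_n) (x y z : 'rV[R]_n).

(** The polar form q (x + y) - q x - q y of [qform A], written so as to cover non-symmetric
    matrices. *)
Definition qpol A x y : R := \sum_i \sum_j A i j * (x 0 i * y 0 j + y 0 i * x 0 j).

Lemma qformDZ A (a b : R) x y : qform A (a *: x + b *: y) =
  a ^+ 2 * qform A x + a * b * qpol A x y + b ^+ 2 * qform A y.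
Proof.
rewrite /qform /qpol !mulr_sumr -!big_split; apply: eq_bigr => i _ /=.
rewrite !mulr_sumr -!big_split; apply: eq_bigr => j _ /=.
by rewrite !mxE; ring.
Qed.

Lemma qform_scalar (a : R) z : qform a%:M z = a * dot z z.
Proof.
rewrite mulr_sumr; apply: eq_bigr => i _; rewrite (bigD1 i) //= mxE eqxx mulr1n.
rewrite big1 ?addr0 // => j ji; rewrite mxE eq_sym (negPf ji) mulr0n mul0r //.
Qed.

Lemma qformD A P z : qform (A + P) z = qform A z + qform P z.
Proof.
rewrite -big_split; apply: eq_bigr => i _; rewrite -big_split; apply: eq_bigr => j _.
by rewrite mxE mulrDl.
Qed.

Lemma qform_delta2 A i j (b : R) :
  qform A (delta_mx 0 i + b *: delta_mx 0 j) =
  A i i + b * (A i j + A j i) + b ^+ 2 * A j j.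
Proof.
have D (k l : 'I_n) : (delta_mx 0 l : 'rV[R]_n) 0 k = (k == l)%:R by rewrite mxE eqxx.
have S1 (F : 'I_n -> R) l : \sum_k F k * (k == l)%:R = F l.
  rewrite (bigD1 l) //= eqxx mulr1 big1 ?addr0 // => k /negPf ->.
  by rewrite mulr0.
have S2 (k l : 'I_n) : \sum_i \sum_j A i j * ((i == k)%:R * (j == l)%:R) = A k l.
  rewrite -(S1 (fun i => A i l) k); apply: eq_bigr => a _.
  rewrite -(S1 (fun j => A a j) l) mulr_suml; apply: eq_bigr => c _.
  by rewrite -mulrA [(c == l)%:R * _]mulrC.
rewrite -[delta_mx 0 i]scale1r qformDZ expr1n !mul1r.
have -> : qform A (delta_mx 0 i) = A i i.
  rewrite -(S2 i i); apply: eq_bigr => a _; apply: eq_bigr => c _; by rewrite !D.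
have -> : qform A (delta_mx 0 j) = A j j.
  rewrite -(S2 j j); apply: eq_bigr => a _; apply: eq_bigr => c _; by rewrite !D.
congr (_ + _ * _ + _); rewrite -(S2 i j) -(S2 j i) -big_split.
apply: eq_bigr => a _ /=; rewrite -big_split; apply: eq_bigr => c _ /=.
by rewrite !D; ring.
Qed.

(** Testing positivity at e_i + e_j and e_i - e_j bounds the symmetrised entries by the diagonal.
    The factor [n] is the price for avoiding eigenvalues. *)
Lemma psd_le_trace P z : (forall y, 0 <= qform P y) ->
  qform P z <= n%:R * \tr P * dot z z.
Proof.
move=> P0; have D0 i : 0 <= P i i.
  have := P0 (delta_mx 0 i + 0 *: delta_mx 0 i).
  by rewrite qform_delta2 mul0r expr0n mul0r !addr0.
have off i j : `|P i j + P j i| <= P i i + P j j.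
  have := P0 (delta_mx 0 i + 1 *: delta_mx 0 j).
  have := P0 (delta_mx 0 i + (-1) *: delta_mx 0 j).
  by rewrite !qform_delta2 ler_norml => ? ?; apply/andP; split; lra.
have -> : qform P z = \sum_i \sum_j (P i j + P j i) / 2 * (z 0 i * z 0 j).
  have -> : qform P z = (qform P z + qform P z) / 2 by field.
  rewrite {2}/qform exchange_big /= -big_split mulr_suml; apply: eq_bigr => i _ /=.
  by rewrite -big_split mulr_suml; apply: eq_bigr => j _ /=; field.
have le1 i j : (P i j + P j i) / 2 * (z 0 i * z 0 j) <= (P i i + P j j) / 2 * dot z z.
  apply: le_trans (ler_norm _) _; rewrite normrM; apply: ler_pM => //.
    by rewrite normrM [`|2^-1|]ger0_norm ?invr_ge0 // ler_wpM2r ?invr_ge0 ?off.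
  by rewrite normrM -enorm_sqr expr2; apply: ler_pM; rewrite ?coord_le_enorm.
apply: le_trans (ler_sum _ (fun i _ => ler_sum _ (fun j _ => le1 i j))) _.
under eq_bigr do rewrite -mulr_suml -mulr_suml big_split /= sumr_const card_ord.
rewrite -mulr_suml -mulr_suml big_split /= sumr_const card_ord sumrMnl.
by rewrite -/(\tr P) -mulr_natl le_eqVlt; apply/orP; left; apply/eqP; field.
Qed.

End QuadraticForms.

(** * Gradient lines, cones and the transport of quadratic tests *)

Section UnitGradient.
Variables (R : realType) (n : nat).
Implicit Types (v : 'rV[R]_n -> R) (x y z : 'rV[R]_n) (A : 'M[R]_n).

(** The factor 4 leaves room for moving a point of the ball of radius [2 * r] by up to [2 * r]. *)
Definition unit_gradient v x0 r := C1on (eball x0 (4 * r)) v /\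
  forall x, eball x0 (4 * r) x -> enorm (gradient v x) = 1.

Lemma gradientN v x : (forall i : 'I_n, derivable v x (delta_mx 0 i)) ->
  gradient (fun y => - v y) x = - gradient v x.
Proof.
move=> dv; apply/rowP => i; rewrite !mxE; apply: partial_eq.
by apply: is_deriveN; exact: derivableP.
Qed.

Lemma C1onN (U : set 'rV[R]_n) v : open U -> C1on U v -> C1on U (fun y => - v y).
Proof.
move=> oU vC; apply: (C1_comp1 (f := fun t => - t) (df := fun=> -1) vC _ oU _).1.
by move=> x Ux; exact: cst_continuous.
Qed.

Lemma unit_gradientN v x0 r : unit_gradient v x0 r ->
  unit_gradient (fun y => - v y) x0 r.
Proof.
move=> [vC v1]; split; first exact: C1onN (@open_eball _ _ _ _) vC.
move=> x xr; rewrite gradientN ?enormN ?v1 // => i.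
by have [_ /(_ i)[]] := vC x xr.
Qed.

Lemma convex_eball (x0 x y : 'rV[R]_n) (r t : R) : 0 <= t <= 1 -> eball x0 r x -> eball x0 r y ->
  eball x0 r (x + t *: (y - x)).
Proof.
rewrite /eball /= => /andP[t0 t1] xr yr.
have -> : x + t *: (y - x) - x0 = (1 - t) *: (x - x0) + t *: (y - x0).
  by apply/rowP => i; rewrite !mxE; ring.
apply: le_lt_trans (enormD _ _) _; rewrite !enormZ !ger0_norm ?subr_ge0 //.
have [->|tn1] := eqVneq t 1; first by rewrite subrr mul0r add0r mul1r.
have t1' : 0 < 1 - t by rewrite subr_gt0 lt_def eq_sym tn1.
have h1 : (1 - t) * enorm (x - x0) < (1 - t) * r by rewrite ltr_pM2l.
have h2 : t * enorm (y - x0) <= t * r by rewrite ler_wpM2l // ltW.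
by move: h1 h2; move: (enorm _) (enorm _) => a b; lra.
Qed.

Lemma eball_add (x0 x w : 'rV[R]_n) (a b c : R) : eball x0 a x -> enorm w <= b ->
  a + b <= c -> eball x0 c (x + w).
Proof.
rewrite /eball /= => xa wb abc; have := enormD w (x - x0).
by rewrite addrCA addrA; lra.
Qed.

Section Geometry.
Variables (v : 'rV[R]_n -> R) (x0 : 'rV[R]_n) (r : R).
Hypotheses (r0 : 0 < r) (hv : unit_gradient v x0 r).

Let B a := eball x0 (a * r).

Let in_B a b x y : B a x -> enorm (y - x) <= b * r -> B (a + b) y.
Proof.
rewrite /B /eball /= => xr yx; have := enormD (y - x) (x - x0).
by rewrite addrA subrK; lra.
Qed.

Lemma unit_lip x y : B 4 x -> B 4 y -> v y - v x <= enorm (y - x).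
Proof.
move=> xr yr; have [vC v1] := hv.
have [t t01|c c01] := @MVT_line R _ v x (y - x)
  (fun t => dot (gradient v (x + t *: (y - x))) (y - x)) 0 1 ltr01.
  by apply: C1_derive (@open_eball _ _ _ _) vC _; exact: convex_eball.
rewrite scale1r scale0r addr0 subr0 mulr1 [x + (y - x)]addrC subrK => ->.
apply: le_trans (dot_le_enorm _ _) _; rewrite v1 ?mul1r //.
by apply: convex_eball => //; case/andP: c01 => /ltW -> /ltW ->.
Qed.

(* Otherwise [v - th |. - x|] would have, for some [th < 1], an interior maximum
   point on the ball, contradicting [|grad v| = 1] there. *)
Lemma unit_sup x s : B 2 x -> 0 < s -> s <= 2 * r ->
  exists2 y, enorm (y - x) <= s & v x + s <= v y.
Proof.
move=> xr s0 sr; have [vC v1] := hv.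
have sub y : ceball x s y -> B 4 y.
  move=> ys; rewrite (_ : 4 = 2 + 2 :> R); last by ring.
  by apply: in_B xr _; apply: le_trans ys sr.
have xx : ceball x s x by rewrite /ceball /= subrr enorm0 ltW.
have [y ys ymax] := compact_max xx (@compact_ceball _ _ x s)
  (fun z zs => (vC z (sub z zs)).1).
exists y => //; rewrite leNgt; apply/negP => hlt.
(* [th] lies midway between the slope (v y - v x) / s and 1. Being above the slope, it keeps the
   maximum point off the sphere; being below 1, it lets [v] win when that point is moved along its
   gradient. *)
pose th := ((v y - v x) / s + 1) / 2.
have q1 : (v y - v x) / s < 1 by rewrite ltr_pdivrMr // mul1r; lra.
have q0 : 0 <= (v y - v x) / s by rewrite divr_ge0 ?(ltW s0) // subr_ge0 ymax.
have th1 : th < 1 by rewrite /th; lra.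
have th0 : 0 <= th by rewrite /th; lra.
have thE : v y - v x < th * s.
  by rewrite -ltr_pdivrMr // /th; lra.
have cF z : ceball x s z -> {for z, continuous (fun z => v z - th * enorm (z - x))}.
  move=> zs; apply: continuousB; first exact: (vC z (sub z zs)).1.
  apply: continuousM; first exact: cst_continuous.
  apply/cont_enormP => e e0; exists e => // w; apply: le_lt_trans.
  rewrite ler_norml; apply/andP; split.
    rewrite lerBrDr; have := enormD (z - w) (w - x).
    by rewrite addrA subrK (enormB z w); lra.
  by have := enormD (w - z) (z - x); rewrite addrA subrK; lra.
have [z zs zmax] := compact_max xx (@compact_ceball _ _ x s) cF.
have zn : enorm (z - x) < s.
  rewrite lt_def; move: (zs); rewrite /ceball /= => ->; rewrite andbT.
  apply/eqP => zE; have := zmax x xx; have := ymax z zs.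
  by rewrite subrr enorm0 mulr0 -zE; lra.
pose N := gradient v z; have N1 : enorm N = 1 by exact: v1 (sub z zs).
have := C1_derive N (@open_eball _ _ _ _) vC (sub z zs).
rewrite -enorm_sqr N1 expr1n => /is_derive_epsP/(_ ((1 - th) / 2)).
case=> [|q qq qP]; first by rewrite divr_gt0 // subr_gt0.
pose t := Num.min (q / 2) (s - enorm (z - x)).
have t0 : 0 < t by rewrite lt_min divr_gt0 // subr_gt0.
have tq : t < q.
  apply: le_lt_trans (_ : q / 2 < q); first by rewrite ge_min lexx.
  by rewrite ltr_pdivrMr // ltr_pMr // ltr1n.
have ts : t <= s - enorm (z - x) by rewrite ge_min lexx orbT.
have zt : enorm (z + t *: N - x) <= enorm (z - x) + t.
  rewrite addrAC; apply: le_trans (enormD _ _) _.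
  by rewrite enormZ N1 mulr1 gtr0_norm.
have := qP t; rewrite gtr0_norm // => /(_ tq); rewrite mulr1 ler_norml => /andP[h1 _].
have /zmax h2 : ceball x s (z + t *: N) by apply: le_trans zt _; lra.
have h3 : th * enorm (z + t *: N - x) <= th * (enorm (z - x) + t) by rewrite ler_wpM2l.
have : 0 < (1 - th) / 2 * t by rewrite mulr_gt0 // divr_gt0 // subr_gt0.
clear -h1 h2 h3; move: h1 h2 h3; move: (v _) (v z) (enorm _) (enorm _) => a b c d.
by lra.
Qed.

(** The point [y] of [unit_sup] is at distance exactly [s], and the Lipschitz bound forces [v] to
    grow at unit speed all along the segment to it. The derivative at [x] in that unit direction is
    then 1, so by equality in the Cauchy-Schwarz inequality the direction is the gradient. *)
Lemma unit_line_pos x s : B 2 x -> 0 < s -> s <= 2 * r ->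
  v (x + s *: gradient v x) = v x + s.
Proof.
move=> xr s0 sr; have [vC v1] := hv.
have xr4 : B 4 x by move: xr r0; rewrite /B /eball /=; lra.
have [y ys vy] := unit_sup xr s0 sr.
have yr4 : B 4 y.
  rewrite (_ : 4 = 2 + 2 :> R); last by ring.
  by apply: in_B xr _; apply: le_trans ys sr.
have yE : enorm (y - x) = s.
  by apply/eqP; rewrite eq_le ys /=; have := unit_lip xr4 yr4; lra.
pose w := s^-1 *: (y - x).
have w1 : enorm w = 1 by rewrite enormZ yE gtr0_norm ?invr_gt0 // mulVf // gt_eqF.
have sw : s *: w = y - x by rewrite scalerA mulfV ?gt_eqF // scale1r.
have wE t : t *: w = (t / s) *: (y - x) by rewrite scalerA.
clearbody w.
have vw t : 0 <= t <= s -> v (x + t *: w) = v x + t.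
  move=> /andP[t0 ts].
  have tB : B 4 (x + t *: w).
    rewrite wE; apply: convex_eball => //; rewrite divr_ge0 ?(ltW s0) //=.
    by rewrite ler_pdivrMr // mul1r.
  have := unit_lip xr4 tB; have := unit_lip tB yr4.
  rewrite (_ : y - (x + t *: w) = (s - t) *: w); last first.
    by rewrite scalerBl sw opprD addrA.
  rewrite (_ : x + t *: w - x = t *: w); last by rewrite addrAC subrr add0r.
  rewrite !enormZ w1 !mulr1 !ger0_norm ?subr_ge0 //.
  by move=> ? ?; apply/eqP; rewrite eq_le; apply/andP; split; lra.
suff -> : gradient v x = w by rewrite vw // lexx ltW.
apply: unit_dot_eq => //; first exact: v1.
apply/eqP; rewrite -subr_eq0 -normr_eq0 eq_le normr_ge0 andbT.
apply/ler_addgt0Pr => e e0; rewrite add0r.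
have /is_derive_epsP/(_ e e0)[q q0 qP] := C1_derive w (@open_eball _ _ _ _) vC xr4.
pose t := Num.min (q / 2) s; have t0 : 0 < t by rewrite lt_min divr_gt0.
have tq : t < q.
  apply: le_lt_trans (_ : q / 2 < q); first by rewrite ge_min lexx.
  by rewrite ltr_pdivrMr // ltr_pMr // ltr1n.
have := qP t; rewrite gtr0_norm // => /(_ tq); rewrite vw; last first.
  by rewrite (ltW t0) ge_min lexx orbT.
rewrite (_ : _ - _ = - (t * (dot (gradient v x) w - 1))); last by ring.
by rewrite normrN normrM gtr0_norm // mulrC ler_pM2r.
Qed.

End Geometry.

Section Lines.
Variables (v : 'rV[R]_n -> R) (x0 : 'rV[R]_n) (r : R).
Hypotheses (r0 : 0 < r) (hv : unit_gradient v x0 r).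

Lemma unit_line x s : eball x0 (2 * r) x -> `|s| <= 2 * r ->
  v (x + s *: gradient v x) = v x + s.
Proof.
move=> xr; have [s0|s0|->] := ltgtP s 0; last by rewrite scale0r !addr0.
  rewrite ltr0_norm // => sr.
  have := unit_line_pos r0 (unit_gradientN hv) xr _ sr.
  rewrite oppr_gt0 => /(_ s0); rewrite gradientN; last first.
    have xr4 : eball x0 (4 * r) x by move: xr r0; rewrite /eball /=; lra.
    by move=> i; have [_ /(_ i)[]] := hv.1 x xr4.
  by rewrite scalerN scaleNr opprK -opprD => /oppr_inj.
rewrite gtr0_norm // => sr.
exact: (@unit_line_pos v x0 r r0 hv x s xr s0 sr).
Qed.

(** Beyond [z], [v] still grows at unit speed in the direction [gradient v x]; two unit vectors with
    inner product 1 coincide. *)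
Lemma unit_line_gradient x s : eball x0 r x -> `|s| < r ->
  gradient v (x + s *: gradient v x) = gradient v x.
Proof.
move=> xr sr; have [vC v1] := hv.
have xr2 : eball x0 (2 * r) x by move: xr r0; rewrite /eball /=; lra.
have xr4 : eball x0 (4 * r) x by move: xr r0; rewrite /eball /=; lra.
set z := x + _.
have zr : eball x0 (4 * r) z.
  move: xr; rewrite /eball /=; have := enormD (s *: gradient v x) (x - x0).
  rewrite enormZ v1 // mulr1 addrCA addrA -/z.
  by move: r0 sr; lra.
symmetry; apply: unit_dot_eq; rewrite ?v1 // dotC.
apply/eqP; rewrite -subr_eq0 -normr_eq0 eq_le normr_ge0 andbT.
apply/ler_addgt0Pr => e e0; rewrite add0r.
have /is_derive_epsP/(_ e e0)[q q0 qP] :=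
  C1_derive (gradient v x) (@open_eball _ _ _ _) vC zr.
pose t := Num.min (q / 2) r; have t0 : 0 < t by rewrite lt_min divr_gt0.
have tq : t < q.
  apply: le_lt_trans (_ : q / 2 < q); first by rewrite ge_min lexx.
  by rewrite ltr_pdivrMr // ltr_pMr // ltr1n.
have tr : t <= r by rewrite ge_min lexx orbT.
have := qP t; rewrite gtr0_norm // => /(_ tq).
have -> : z + t *: gradient v x = x + (s + t) *: gradient v x.
  by rewrite scalerDl addrA.
rewrite !unit_line //; last 2 first.
- by rewrite ltW // (lt_le_trans sr) // ler_peMl ?ler1n // ltW.
- apply: le_trans (ler_normD _ _) _; rewrite [`|t|]gtr0_norm //.
  by move: sr tr; lra.
rewrite (_ : _ - _ = - (t * (dot (gradient v z) (gradient v x) - 1))); last by ring.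
by rewrite normrN normrM gtr0_norm // mulrC ler_pM2r.
Qed.

(** The pair ([gradient v x], [A]) is an element of the second-order superjet, here without
    remainder term. *)
Definition utest (v : 'rV[R]_n -> R) x A := exists2 d, 0 < d & forall z, enorm z < d ->
  v (x + z) <= v x + dot (gradient v x) z + qform A z / 2.

(** [v] lies below the cone with vertex [y = x - r N], by the Lipschitz bound, and meets it at [x],
    since [v] grows at unit speed from [y] to [x]. The right-hand side is an upper bound for the
    expansion of the cone at distance [r] from its vertex. *)
Lemma cone_above x z : eball x0 r x -> enorm z <= r ->
  v (x + z) <= v x + dot (gradient v x) z + dot z z / (2 * r).
Proof.
move=> xr zr; have [vC v1] := hv.
have xr2 : eball x0 (2 * r) x by move: xr r0; rewrite /eball /=; lra.
have xr4 : eball x0 (4 * r) x by move: xr r0; rewrite /eball /=; lra.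
set N := gradient v x; pose y := x + (- r) *: N.
have rN : `|- r| <= 2 * r by rewrite normrN gtr0_norm //; move: r0; lra.
have vy : v y = v x - r by exact: unit_line xr2 rN.
have yr : eball x0 (4 * r) y.
  move: xr; rewrite /eball /=; have := enormD (- r *: N) (x - x0).
  rewrite enormZ v1 // mulr1 addrCA addrA -/y normrN gtr0_norm //.
  by move: r0; lra.
have zr4 : eball x0 (4 * r) (x + z).
  move: xr; rewrite /eball /=; have := enormD z (x - x0).
  rewrite addrCA addrA; move: r0 zr; lra.
have := unit_lip hv yr zr4; rewrite vy.
have -> : x + z - y = z + r *: N.
  by rewrite /y; move: (N) => M; apply/rowP => i; rewrite !mxE; ring.
suff : enorm (z + r *: N) <= r + dot N z + dot z z / (2 * r) by lra.
have NN : dot N N = 1 by rewrite -enorm_sqr v1 // expr1n.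
have r20 : 0 < 2 * r by rewrite mulr_gt0.
have Nz : `|dot N z| <= r.
  by apply: le_trans (dot_norm_le _ _) _; rewrite v1 // mul1r.
have zz : 0 <= dot z z / (2 * r) by rewrite divr_ge0 ?dot_ge0 // ltW.
move: Nz; rewrite ler_norml => /andP[Nz1 Nz2].
rewrite enorm_leE; last by lra.
rewrite !dotE (dotC z N) NN; pose a := dot z z / (2 * r).
have aE : dot z z = 2 * r * a by rewrite /a mulrC divfK // gt_eqF.
rewrite -/a aE; have a0 : 0 <= a by exact: zz.
have : 0 <= (dot N z + a) ^+ 2 by exact: sqr_ge0.
by move: (dot N z) => b; rewrite !expr2; lra.
Qed.

(** So each point of the ball has at least one test from above, of trace [n / r]; this trace becomes
    the threshold for the tests that are transported. *)
Lemma cone_utest x : eball x0 r x -> utest v x (r^-1)%:M.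
Proof.
move=> xr; exists r => // z /ltW zr; apply: le_trans (cone_above xr zr) _.
by rewrite qform_scalar lerD2l invfM mulrA mulrAC [dot z z * _]mulrC.
Qed.

End Lines.

Lemma cone_below v x0 r x z : 0 < r -> unit_gradient v x0 r -> eball x0 r x ->
  enorm z <= r -> v x + dot (gradient v x) z - dot z z / (2 * r) <= v (x + z).
Proof.
move=> r0 hv xr zr; have := cone_above r0 (unit_gradientN hv) xr zr.
rewrite gradientN ?dotNl; first by lra.
have xr4 : eball x0 (4 * r) x by move: xr r0; rewrite /eball /=; lra.
by move=> i; have [_ /(_ i)[]] := hv.1 x xr4.
Qed.

(** The test is pinched between [v] and the cone below it. Together with a bound on the trace of
    [A], this bounds the whole quadratic form. *)
Lemma utest_ge v x0 r x A z : 0 < r -> unit_gradient v x0 r -> eball x0 r x ->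
  utest v x A -> 0 <= qform (A + r^-1%:M) z.
Proof.
move=> r0 hv xr [d d0 dP].
pose t := Num.min r (d / 2) / (enorm z + 1).
have z1 : 0 < enorm z + 1 by rewrite ltr_wpDl // enorm_ge0.
have m0 : 0 < Num.min r (d / 2) by rewrite lt_min r0 divr_gt0.
have t0 : 0 < t by rewrite divr_gt0.
have tz : enorm (t *: z) <= Num.min r (d / 2).
  rewrite enormZ gtr0_norm // /t mulrAC ler_pdivrMr // ler_wpM2l ?(ltW m0) //.
  by rewrite lerDl.
move: (tz); rewrite le_min => /andP[tzr tzd].
have := cone_below r0 hv xr tzr.
have := dP (t *: z); have -> : enorm (t *: z) < d.
  by apply: le_lt_trans tzd _; rewrite ltr_pdivrMr // ltr_pMr // ltr1n.
move=> /(_ isT) h1 h2; have := le_trans h2 h1.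
rewrite qformZ !dotZl !dotZr qformD qform_scalar => h3.
rewrite -(pmulr_rge0 _ (_ : 0 < t ^+ 2)) ?exprn_gt0 //.
have -> : r^-1 * dot z z = 2 * (dot z z / (2 * r)).
  by field; rewrite gt_eqF.
clearbody t; move: h3; rewrite expr2 (_ : t * (t * dot z z) / (2 * r) = t * t * (dot z z / (2 * r))).
  by move: (dot z z / _) => a; lra.
by rewrite !mulrA.
Qed.

(** Since [v] is 1-Lipschitz, its value at [x + s N + z] is at most [v (x + z) + s]; the gradient
    and the linear growth along the line match, so the same [A] serves. *)
Lemma utest_forward v x0 r x A s : 0 < r -> unit_gradient v x0 r -> eball x0 r x ->
  0 <= s -> s < r -> utest v x A -> utest v (x + s *: gradient v x) A.
Proof.
move=> r0 hv xr s0 sr [d d0 dP]; have [vC v1] := hv.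
have xr2 : eball x0 (2 * r) x by move: xr r0; rewrite /eball /=; lra.
have xr4 : eball x0 (4 * r) x by move: xr r0; rewrite /eball /=; lra.
exists (Num.min d r); first by rewrite lt_min d0.
move=> z; rewrite lt_min => /andP[zd zr].
rewrite (unit_line_gradient r0 hv xr); last by rewrite ger0_norm.
rewrite (unit_line r0 hv xr2); last by rewrite ger0_norm //; move: r0 sr; lra.
set N := gradient v x.
have b1 : eball x0 (4 * r) (x + z).
  by apply: eball_add xr (ltW zr) _; move: r0; lra.
have sN : enorm (s *: N + z) <= 2 * r.
  have := enormD (s *: N) z; rewrite enormZ v1 // mulr1 ger0_norm //.
  by move: zr sr; lra.
have b2 : eball x0 (4 * r) (x + s *: N + z).
  by rewrite -addrA; apply: eball_add xr sN _; move: r0; lra.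
have := unit_lip hv b1 b2; rewrite (_ : _ - _ = s *: N); last first.
  by move: (N) => M; apply/rowP => i; rewrite !mxE; ring.
rewrite enormZ v1 // mulr1 ger0_norm //; have := dP z zd.
by move: (v _) (v _) (v x) (dot _ _) (qform _ _) => a b c e f; lra.
Qed.

(* Backwards along the line, [v (p) = v (p + s grad v p) - s] is estimated by the
   quadratic test at [x]; the error is absorbed by the strict convexity of the sphere,
   [N . (N' - N) = - |N' - N|^2 / 2]. *)
Lemma utest_backward v x0 r (T : R) : 0 < r -> unit_gradient v x0 r ->
  exists L s0, [/\ 0 <= L, 0 < s0 & forall x A s, eball x0 r x -> \tr A <= T ->
    0 <= s -> s < s0 -> utest v x A ->
    utest v (x + (- s) *: gradient v x) (A + (L * s)%:M)].
Proof.
move=> r0 hv; have [vC v1] := hv; pose c := r^-1.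
have c0 : 0 < c by rewrite invr_gt0.
(* [k] bounds the nonnegative form of P = A + c through its trace, uniformly over the tests with
   [\tr A <= T]. *)
pose k := n%:R * `|T + n%:R * c| + 1.
have k0 : 0 < k by rewrite ltr_wpDl // mulr_ge0.
(* Put e = N' - N. Strict convexity of the sphere gains |e|^2, and the cross term of [P], the term s
   P(e) and the cross term - 2 c z . e cost at most |e|^2 / 4 each. What they cost in |z|^2 is [L];
   the bound (4 k)^-1 on [s] serves the second of them. *)
exists (4 * k ^+ 2 + 4 * c ^+ 2), (Num.min r (4 * k)^-1); split.
- by rewrite addr_ge0 // mulr_ge0 // sqr_ge0.
- by rewrite lt_min r0 invr_gt0 mulr_gt0.
move=> x A s xr trA s0; rewrite lt_min => /andP[sr sk] hA.
have sk4 : s * k <= 4^-1.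
  by rewrite -ler_pdivlMr // -invfM ltW.
pose P := A + c%:M.
have P0 z : 0 <= qform P z by exact: utest_ge r0 hv xr hA.
have Pk z : qform P z <= k * dot z z.
  apply: le_trans (psd_le_trace z P0) _; rewrite ler_wpM2r ?dot_ge0 //.
  apply: le_trans (_ : n%:R * `|T + n%:R * c| <= _); last by rewrite lerDl.
  rewrite ler_wpM2l // /P mxtraceD mxtrace_scalar; apply: le_trans (ler_norm _).
  by rewrite mulr_natl lerD2r.
have xr2 : eball x0 (2 * r) x by move: xr r0; rewrite /eball /=; lra.
have xr4 : eball x0 (4 * r) x by move: xr r0; rewrite /eball /=; lra.
have [d d0 dP] := hA; set N := gradient v x; have N1 : enorm N = 1 by exact: v1.
have NN : dot N N = 1 by rewrite -enorm_sqr N1 expr1n.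
have sr' : `|- s| < r by rewrite normrN ger0_norm.
have sr2 : `|- s| <= 2 * r by rewrite normrN ger0_norm //; move: r0 sr; lra.
have gz := unit_line_gradient r0 hv xr sr'; have vz := unit_line r0 hv xr2 sr2.
rewrite -/N in gz vz *; set z1 := x + - s *: N in gz vz *.
have snN : enorm (- s *: N) <= s by rewrite enormZ N1 mulr1 normrN ger0_norm.
have z1r : eball x0 (2 * r) z1 by apply: eball_add xr snN _; move: r0 sr; lra.
have z1r4 : eball x0 (4 * r) z1 by move: z1r r0; rewrite /eball /=; lra.
have dr0 : 0 < d / (2 * r) by rewrite divr_gt0 // mulr_gt0.
(* Continuity of the gradient keeps [e] so small that [p + s N'] falls into the neighbourhood of [x]
   on which the test is valid. *)
have [d1 d10 d1P] := gradient_cont vC z1r4 dr0.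
pose d2 := Num.min (Num.min (d / 2) d1) (2 * r - enorm (z1 - x0)).
exists d2; first by rewrite !lt_min divr_gt0 // d10 subr_gt0.
move=> z; rewrite !lt_min => /andP[/andP[zd zd1] zr].
rewrite gz vz; pose p := z1 + z; rewrite -/p.
have pr : eball x0 (2 * r) p.
  have := enormD z (z1 - x0); rewrite addrCA addrA -/p /eball /=.
  by move: zr; lra.
have pr4 : eball x0 (4 * r) p by move: pr r0; rewrite /eball /=; lra.
pose N' := gradient v p; have N'1 : enorm N' = 1 by exact: v1.
have N'N' : dot N' N' = 1 by rewrite -enorm_sqr N'1 expr1n.
have vp : v (p + s *: N') = v p + s.
  have sr3 : `|s| <= 2 * r by rewrite -normrN.
  exact: (unit_line r0 hv pr sr3).
pose e := N' - N.
have pz : p - z1 = z by rewrite /p addrAC subrr add0r.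
have en : enorm e <= d / (2 * r).
  by rewrite ltW // /e -gz; apply: d1P; rewrite pz.
have yE : p + s *: N' = x + (1 *: z + s *: e).
  rewrite /p /z1 /e; move: (N) (N') => M M'.
  by apply/rowP => i; rewrite !mxE; ring.
have yd : enorm (1 *: z + s *: e) < d.
  have h : s * enorm e <= d / 2.
    apply: le_trans (_ : r * (d / (2 * r)) <= _).
      by apply: ler_pM; rewrite ?enorm_ge0 // ltW.
    by rewrite le_eqVlt; apply/orP; left; apply/eqP; field; rewrite gt_eqF.
  apply: le_lt_trans (enormD _ _) _; rewrite !enormZ normr1 mul1r ger0_norm //.
  by move: zd h; lra.
have Ne : dot N e = - dot e e / 2.
  by rewrite /e !dotE (dotC N' N) NN N'N'; field.
clearbody e.
have := dP _ yd; rewrite -yE vp => hp.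
pose Z := dot z z; pose E := dot e e; pose D := dot z e; pose b := qpol P z e.
have Z0 : 0 <= Z by exact: dot_ge0.
have E0 : 0 <= E by exact: dot_ge0.
have qA w : qform A w = qform P w - c * dot w w.
  by rewrite /P qformD qform_scalar addrK.
have wE : dot (1 *: z + s *: e) (1 *: z + s *: e) = Z + 2 * s * D + s ^+ 2 * E.
  by rewrite !dotE (dotC e z) /Z /D /E; ring.
have bk : b <= 4 * k ^+ 2 * Z + E / 4.
  (* Young's inequality for the polar form, from positivity of [P] at 4 k z - e. *)
  have := P0 ((4 * k) *: z + (- 1) *: e); rewrite qformDZ -/b => h.
  have h1 := Pk z; have h2 := Pk e; rewrite -/Z -/E in h1 h2.
  have k4 : 0 < 4 * k by rewrite mulr_gt0.
  rewrite -(ler_pM2l k4).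
  have h3 : (4 * k) ^+ 2 * qform P z <= (4 * k) ^+ 2 * (k * Z).
    by rewrite ler_wpM2l // sqr_ge0.
  by move: h h2 h3; move: (qform P z) (qform P e) => q1 q2; rewrite !expr2; lra.
have p2 : s * qform P e <= E / 4.
  apply: le_trans (_ : s * (k * E) <= _); first by rewrite ler_wpM2l // Pk.
  by rewrite mulrA mulrC ler_wpM2l.
have Dk : - (2 * c * D) <= 4 * c ^+ 2 * Z + E / 4.
  have := dot_ge0 ((2 * c) *: z + (1 / 2) *: e).
  by rewrite !dotE (dotC e z) -/Z -/D -/E !expr2; lra.
have cE : 0 <= c * s * E by rewrite !mulr_ge0 // ltW.
move: hp; rewrite (qformD A) qform_scalar -/N !dotE Ne -/E !qA wE qformDZ -/b -/Z.
have : s * (b + s * qform P e - 2 * c * D - c * s * E) <=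
    s * ((4 * k ^+ 2 + 4 * c ^+ 2) * Z + E).
  by rewrite ler_wpM2l //; move: bk p2 Dk cE E0; rewrite !expr2; lra.
move: (qform P z) (qform P e) (v p) (v x) (dot N z) => q1 q2 a1 a2 a3.
by clear; rewrite !expr2; lra.
Qed.

End UnitGradient.

(** * Touching parabolas in dimension one *)

Section OneDimension.
Variable R : realType.
Implicit Types (Psi F p q : R -> R) (a b c t tau : R).

Definition touch_quad Psi t b c := exists2 d, 0 < d & forall tau, `|tau - t| < d ->
  Psi tau <= Psi t + b * (tau - t) + c * (tau - t) ^+ 2.

(* [Psi] lies below every parabola of second derivative [k' < k] that agrees with it at
   [a] and [b]; compare the slopes at the end points. *)
Lemma touch_quad_slope Psi F (k a b : R) : a < b ->
  (forall t, a <= t <= b -> is_derive t 1 Psi (F t)) ->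
  (forall t c, a < t < b -> touch_quad Psi t (F t) c -> k <= 2 * c) ->
  k * (b - a) <= F b - F a.
Proof.
move=> ab dPsi hk; have ba : 0 < b - a by rewrite subr_gt0.
apply/ler_addgt0Pr => e e0; pose k' := k - e / (b - a).
have k'k : k' < k by rewrite gtrDl oppr_lt0 divr_gt0.
have kE : k * (b - a) = k' * (b - a) + e by rewrite /k'; field; rewrite gt_eqF.
pose c := k' / 2; pose m := (Psi b - Psi a) / (b - a) - c * (b - a).
pose Q s := Psi a + m * (s - a) + c * (s - a) ^+ 2.
have dQ t : is_derive t 1 Q (m + 2 * c * (t - a)) by exact: is_derive_quad.
pose D s := Psi s - Q s.
have dD t : a <= t <= b -> is_derive t 1 D (F t - (m + 2 * c * (t - a))).
  by move=> tab; exact: is_deriveB (dPsi t tab) (dQ t).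
have Da : D a = 0 by rewrite /D /Q subrr mulr0 expr0n mulr0 !addr0 subrr.
have Db : D b = 0 by rewrite /D /Q /m; field; rewrite gt_eqF.
have [|t tab tmax] := @EVT_max R D a b (ltW ab).
  apply: continuous_in_subspaceT => s; rewrite inE /= in_itv /= => sab.
  exact: is_derive_cont1 (dD s sab).
have Dle s : a <= s <= b -> D s <= 0.
  move=> sab; apply: le_trans (tmax s _) _; first by rewrite in_itv.
  rewrite leNgt; apply/negP => Dt.
  move: (tab); rewrite in_itv /= => /andP[ta tb].
  have ta' : a < t by rewrite lt_def ta andbT; apply/eqP => E; move: Dt; rewrite E Da ltxx.
  have tb' : t < b.
    by rewrite lt_def tb andbT; apply/eqP => E; move: Dt; rewrite -E Db ltxx.
  have dt : is_derive t 1 D 0.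
    apply: (@derive1_at_max R D a b t (ltW ab)).
    - by move=> s'; rewrite in_itv /= => /andP[? ?]; case: (dD s'); rewrite // !ltW.
    - by rewrite in_itv /= ta' tb'.
    - by move=> s'; rewrite in_itv /= => /andP[? ?]; apply: tmax; rewrite in_itv /= !ltW.
  have tab' : a <= t <= b by rewrite ta tb.
  have Ft : F t = m + 2 * c * (t - a).
    apply/eqP; rewrite -subr_eq0; apply/eqP.
    by rewrite -(derive_eq (dD t tab')) (derive_eq dt).
  have : k <= 2 * c.
    apply: (hk t c); first by rewrite ta' tb'.
    exists (Num.min (t - a) (b - t)); first by rewrite lt_min !subr_gt0 ta'.
    move=> s'; rewrite lt_min !ltr_norml => /andP[/andP[? ?] /andP[? ?]].
    have : D s' <= D t by apply: tmax; rewrite in_itv /=; apply/andP; split; lra.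
    by rewrite /D /Q Ft !expr2; lra.
  by rewrite /c; move: k'k; lra.
have slope_a : F a <= m.
  apply/ler_addgt0Pr => s s0; have aab : a <= a <= b by rewrite lexx ltW.
  have /is_derive_epsP/(_ s s0)[q q0 qP] := dD a aab.
  pose t' := Num.min (q / 2) (b - a); have t0 : 0 < t' by rewrite lt_min divr_gt0.
  have tq : t' < q.
    apply: le_lt_trans (_ : q / 2 < q); first by rewrite ge_min lexx.
    by rewrite ltr_pdivrMr // ltr_pMr // ltr1n.
  have tb' : t' <= b - a by rewrite ge_min lexx orbT.
  have := qP t'; rewrite gtr0_norm // [t' *: 1]mulr1 Da subrr mulr0 addr0 => /(_ tq).
  rewrite ler_norml => /andP[h _]; have : D (a + t') <= 0.
    by apply: Dle; apply/andP; split; lra.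
  move=> h'; have : t' * (F a - m) <= t' * s by lra.
  by rewrite ler_pM2l //; lra.
have slope_b : m + 2 * c * (b - a) <= F b.
  apply/ler_addgt0Pr => s s0; have bab : a <= b <= b by rewrite lexx ltW.
  have /is_derive_epsP/(_ s s0)[q q0 qP] := dD b bab.
  pose t' := Num.min (q / 2) (b - a); have t0 : 0 < t' by rewrite lt_min divr_gt0.
  have tq : t' < q.
    apply: le_lt_trans (_ : q / 2 < q); first by rewrite ge_min lexx.
    by rewrite ltr_pdivrMr // ltr_pMr // ltr1n.
  have tb' : t' <= b - a by rewrite ge_min lexx orbT.
  have := qP (- t'); rewrite normrN gtr0_norm // [- t' *: 1]mulr1 Db => /(_ tq).
  rewrite ler_norml => /andP[h _]; have : D (b - t') <= 0.
    by apply: Dle; apply/andP; split; lra.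
  move=> h'; have : t' * (m + 2 * c * (b - a) - F b) <= t' * s by lra.
  by rewrite ler_pM2l //; lra.
by rewrite kE; move: slope_a slope_b; rewrite /c; lra.
Qed.

Section Parabolas.
Variables (Psi F p q : R -> R) (t0 d : R).
Hypothesis dPsi : forall t, `|t - t0| < d -> is_derive t 1 Psi (F t).
Hypothesis up : forall t c, `|t - t0| < d -> touch_quad Psi t (F t) c -> p t <= 2 * c.
Hypothesis low : forall t c, `|t - t0| < d ->
  touch_quad (fun s => - Psi s) t (- F t) c -> - q t <= 2 * c.

(** The hypotheses [up] and [low] say p <= Psi'' <= q in the viscosity sense; here and in
    [touch_low] they are integrated into bounds on increments of [F]. *)
Lemma touch_up (k a b : R) : a < b -> `|a - t0| < d -> `|b - t0| < d ->
  (forall t, a < t < b -> k <= p t) -> k * (b - a) <= F b - F a.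
Proof.
move=> ab ad bd kp.
have inJ t : a <= t <= b -> `|t - t0| < d.
  by move: ad bd; rewrite !ltr_norml => /andP[? ?] /andP[? ?] /andP[? ?];
    apply/andP; split; lra.
apply: touch_quad_slope => // [t /inJ|t c /andP[at_ tb] h]; first exact: dPsi.
apply: le_trans (kp t _) (up _ h); first by rewrite at_ tb.
by apply: inJ; rewrite !ltW.
Qed.

Lemma touch_low (k a b : R) : a < b -> `|a - t0| < d -> `|b - t0| < d ->
  (forall t, a < t < b -> q t <= k) -> F b - F a <= k * (b - a).
Proof.
move=> ab ad bd kq.
have inJ t : a <= t <= b -> `|t - t0| < d.
  by move: ad bd; rewrite !ltr_norml => /andP[? ?] /andP[? ?] /andP[? ?];
    apply/andP; split; lra.
have := @touch_quad_slope (fun s => - Psi s) (fun s => - F s) (- k) a b ab.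
move=> h; suff : - k * (b - a) <= - F b - - F a by lra.
apply: h => [t /inJ /dPsi|t c /andP[at_ tb] h]; first by move=> ?; exact: is_deriveN.
apply: le_trans (low _ h); first by rewrite lerN2 kq // at_ tb.
by apply: inJ; rewrite !ltW.
Qed.

Lemma cont1_eps (h : R -> R) t (e : R) : {for t, continuous h} -> 0 < e ->
  exists2 s, 0 < s & forall tau, `|tau - t| < s -> `|h tau - h t| < e.
Proof.
move=> ch e0; have /cvgrPdist_lt/(_ e e0)/nbhs_ballP[s /= s0 sP] := ch.
by exists s => // tau ts; rewrite distrC; apply: sP; rewrite /ball /= distrC.
Qed.

(** A given point may have no touching parabola on one of the sides, so the two bounds cannot be
    compared at [t] itself. They are compared through the increment of [F] over a short interval
    starting at [t]. *)
Lemma touch_compare t : `|t - t0| < d -> {for t, continuous p} ->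
  {for t, continuous q} -> p t <= q t.
Proof.
move=> td cp cq; rewrite leNgt; apply/negP => qp.
pose e := (p t - q t) / 4; have e0 : 0 < e by rewrite divr_gt0 // subr_gt0.
have [s s0 sP] := cont1_eps cp e0; have [s' s'0 sP'] := cont1_eps cq e0.
pose m := Num.min (Num.min s s') (d - `|t - t0|).
have m0 : 0 < m by rewrite !lt_min s0 s'0 subr_gt0.
have ms : m <= s by rewrite !ge_min lexx.
have ms' : m <= s' by rewrite !ge_min lexx orbT.
have md : m <= d - `|t - t0| by rewrite ge_min lexx orbT.
pose b := t + m / 2.
have tb : t < b by rewrite /b ltrDl divr_gt0.
have bd : `|b - t0| < d.
  rewrite /b addrAC; apply: le_lt_trans (ler_normD _ _) _.
  by rewrite [`|m / 2|]gtr0_norm ?divr_gt0 //; move: md m0; lra.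
have near_t a : t < a < b -> `|a - t| < m.
  by rewrite /b => /andP[? ?]; rewrite ltr_norml; apply/andP; split; lra.
have h1 : (p t - e) * (b - t) <= F b - F t.
  apply: touch_up => // a /near_t am.
  have := sP a (lt_le_trans am ms); rewrite ltr_norml => /andP[? ?]; lra.
have h2 : F b - F t <= (q t + e) * (b - t).
  apply: touch_low => // a /near_t am.
  have := sP' a (lt_le_trans am ms'); rewrite ltr_norml => /andP[? ?]; lra.
have := le_trans h1 h2; rewrite ler_pM2r ?subr_gt0 //.
by rewrite /e; move: qp; lra.
Qed.

End Parabolas.

(** When the two bounds coincide, they squeeze the increment of [F] between p t - e and p t + e
    times the length of the interval. *)
Lemma touch_second_derivative Psi F p t0 d t :
  (forall t, `|t - t0| < d -> is_derive t 1 Psi (F t)) ->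
  (forall t c, `|t - t0| < d -> touch_quad Psi t (F t) c -> p t <= 2 * c) ->
  (forall t c, `|t - t0| < d ->
    touch_quad (fun s => - Psi s) t (- F t) c -> - p t <= 2 * c) ->
  `|t - t0| < d -> {for t, continuous p} -> is_derive t 1 F (p t).
Proof.
move=> dPsi up low td cp; apply/is_derive_epsP => e e0.
have [s s0 sP] := cont1_eps cp e0; pose m := Num.min s (d - `|t - t0|).
exists m => [|a]; first by rewrite lt_min s0 subr_gt0.
rewrite lt_min [a *: 1]mulr1 => /andP[as_ ad].
have tad : `|t + a - t0| < d.
  by rewrite addrAC; apply: le_lt_trans (ler_normD _ _) _; move: ad; lra.
have bnd tau : `|tau - t| <= `|a| -> p t - e <= p tau <= p t + e.
  move=> h; have := sP tau (le_lt_trans h as_).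
  by rewrite ltr_norml => /andP[? ?]; apply/andP; split; lra.
have [a0|a0|->] := ltgtP a 0; last by rewrite !addr0 mul0r !subrr normr0 mulr0.
- have ta : t + a < t by rewrite gtrDl.
  have bnd' tau : t + a < tau < t -> p t - e <= p tau <= p t + e.
    by move=> /andP[? ?]; apply: bnd; rewrite !ltr0_norm; lra.
  have h1 := touch_up dPsi up ta tad td (fun tau h => proj1 (andP (bnd' tau h))).
  have h2 := touch_low dPsi low ta tad td (fun tau h => proj2 (andP (bnd' tau h))).
  by rewrite [`|a|]ltr0_norm // ler_norml; apply/andP; split; lra.
have ta : t < t + a by rewrite ltrDl.
have bnd' tau : t < tau < t + a -> p t - e <= p tau <= p t + e.
  by move=> /andP[? ?]; apply: bnd; rewrite !gtr0_norm; lra.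
have h1 := touch_up dPsi up ta td tad (fun tau h => proj1 (andP (bnd' tau h))).
have h2 := touch_low dPsi low ta td tad (fun tau h => proj2 (andP (bnd' tau h))).
by rewrite [`|a|]gtr0_norm // ler_norml; apply/andP; split; lra.
Qed.

End OneDimension.

(** * The level profile and its second derivative *)

Section TestsFromC2.
Variables (R : realType) (n : nat).
Implicit Types (v w h k : 'rV[R]_n -> R) (x y z : 'rV[R]_n) (U : set 'rV[R]_n).

Lemma trace_hessian h x (a : R) :
  \tr (hessian h x + a%:M) = laplacian h x + n%:R * a.
Proof.
rewrite mxtraceD mxtrace_scalar mulr_natl; congr (_ + _).
by apply: eq_bigr => i _; rewrite mxE.
Qed.

Lemma C2_utest U h x e : open U -> C2on U h -> U x -> 0 < e ->
  utest h x (hessian h x + (2 * e)%:M).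
Proof.
move=> oU hC Ux e0; have [r r0 rP] := taylor2 oU hC Ux e0.
exists r => // z /rP; rewrite qformD qform_scalar -enorm_sqr ler_norml => /andP[_].
by move: (enorm z ^+ 2) (qform _ _) => a b; lra.
Qed.

(** The arbitrary margin [2 * e] absorbs the remainder in Taylor's formula, so that a polynomial
    test becomes an exact quadratic one. *)
Lemma touch_utest U w x phi q e : open U -> C1on U w -> U x -> polyf phi -> 0 < q ->
  phi x = w x -> (forall y, enorm (y - x) < q -> w y <= phi y) -> 0 < e ->
  utest w x (hessian phi x + (2 * e)%:M).
Proof.
move=> oU wC Ux hphi q0 phx htouch e0.
have [r r0 rP] := C2_utest openT (@polyf_C2 _ _ phi setT hphi) (I : setT x) e0.
exists (Num.min r q) => [|z]; first by rewrite lt_min r0.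
rewrite lt_min => /andP[/rP h zq].
rewrite -phx -(touch_gradient wC (@polyf_C1 _ _ phi U hphi) Ux q0 phx htouch).
by apply: le_trans h; apply: htouch; rewrite addrAC subrr add0r.
Qed.

Lemma C1on_eq U h k : open U -> (forall y, U y -> h y = k y) -> C1on U k ->
  C1on U h /\ forall x i, U x -> partial i h x = partial i k x.
Proof.
move=> oU hk kC.
have der x i : U x -> is_derive x (delta_mx 0 i) h (partial i k x).
  move=> Ux; have [_ /(_ i)[dk _]] := kC x Ux.
  apply: (near_eq_is_derive (f := k)); last exact: derivableP.
  have : nbhs x U by exact: open_nbhs_nbhs.
  by apply: filterS => y /hk.
have pE x i : U x -> partial i h x = partial i k x.
  by move=> Ux; apply: partial_eq; exact: der.
have cE (a b : 'rV[R]_n -> R) x : U x -> (forall y, U y -> a y = b y) ->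
    {for x, continuous b} -> {for x, continuous a}.
  move=> Ux ab /cont_enormP cb; apply/cont_enormP => e /cb[d d0 dP].
  have /nbhs_enormP[r r0 rU] : nbhs x U by exact: open_nbhs_nbhs.
  exists (Num.min d r); first by rewrite lt_min d0.
  by move=> y; rewrite lt_min => /andP[/dP hy /rU Uy]; rewrite !ab.
split=> // x Ux; have [ck kCx] := kC x Ux; split=> [|i]; first exact: cE ck.
split; first by case: (der x i Ux).
by apply: (cE _ (partial i k)) (kCx i).2 => // y Uy; exact: pE.
Qed.

Lemma C1onM U h k : open U -> C1on U h -> C1on U k -> C1on U (fun y => h y * k y).
Proof.
move=> oU hC kC.
have der x i : U x -> is_derive x (delta_mx 0 i) (fun y => h y * k y)
    (h x * partial i k x + k x * partial i h x).
  move=> Ux; apply: is_deriveM; apply: derivableP.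
    by have [_ /(_ i)[]] := hC x Ux.
  by have [_ /(_ i)[]] := kC x Ux.
have pE x i : U x -> partial i (fun y => h y * k y) x =
    h x * partial i k x + k x * partial i h x.
  by move=> Ux; apply: partial_eq; exact: der.
move=> x Ux; have [ch hCx] := hC x Ux; have [ck kCx] := kC x Ux.
split=> [|i]; first exact: continuousM.
split; first by case: (der x i Ux).
have cp : {for x, continuous (fun y => h y * partial i k y + k y * partial i h y)}.
  by apply: continuousD; apply: continuousM => //; [exact: (kCx i).2|exact: (hCx i).2].
have /nbhs_enormP[r r0 rU] : nbhs x U by exact: open_nbhs_nbhs.
move/cont_enormP : cp => cp; apply/cont_enormP => e /cp[d d0 dP].
exists (Num.min d r); first by rewrite lt_min d0.
by move=> y; rewrite lt_min => /andP[/dP hy /rU Uy]; rewrite !pE.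
Qed.

Lemma C2onN U h : open U -> C2on U h -> C2on U (fun y => - h y) /\
  forall x, U x -> laplacian (fun y => - h y) x = - laplacian h x.
Proof.
move=> oU [hC hCC]; have d x i : U x -> partial i (fun y => - h y) x = - partial i h x.
  move=> Ux; apply: partial_eq; apply: is_deriveN; apply: derivableP.
  by have [_ /(_ i)[]] := hC x Ux.
have dd i := C1on_eq oU (fun y Uy => d y i Uy) (C1onN oU (hCC i)).
split; first by split=> [|i]; [exact: C1onN|exact: (dd i).1].
move=> x Ux; rewrite -sumrN; apply: eq_bigr => i _; rewrite (dd i).2 //.
apply: partial_eq; apply: is_deriveN; apply: derivableP.
by have [_ /(_ i)[]] := hCC i x Ux.
Qed.

Lemma laplacian_cont U h x : C2on U h -> U x -> {for x, continuous (laplacian h)}.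
Proof.
move=> [_ hCC] Ux; rewrite /laplacian; elim: (index_enum _) => [|i s IH].
  rewrite (_ : (fun y => _) = fun=> 0); first exact: cst_continuous.
  by apply/funext => y; rewrite big_nil.
rewrite (_ : (fun y => _) = fun y => partial i (partial i h) y +
    \sum_(j <- s) partial j (partial j h) y).
  by apply: continuousD => //; have [_ /(_ i)[]] := hCC i x Ux.
by apply/funext => y; rewrite big_cons.
Qed.

Lemma line_cont h x (w : 'rV[R]_n) (a t : R) : {for x + (t - a) *: w, continuous h} ->
  {for t, continuous (fun s => h (x + (s - a) *: w))}.
Proof.
move=> /cont_enormP ch.
apply/(@cvgrPdist_lt _ _ _ (nbhs t) _) => e /ch[d d0 dP].
have v1 : 0 < enorm w + 1 by rewrite ltr_wpDl // enorm_ge0.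
apply/nbhs_ballP; exists (d / (enorm w + 1)) => /=; first exact: divr_gt0.
move=> s; rewrite /ball /= distrC ltr_pdivlMr // => sd; rewrite distrC; apply: dP.
rewrite (_ : _ - _ = (s - t) *: w); last by apply/rowP => i; rewrite !mxE; ring.
rewrite enormZ; by apply: le_lt_trans sd; rewrite ler_wpM2l // lerDl ler01.
Qed.

End TestsFromC2.

(** * Tests of a composition Psi o v, compared across level sets *)

Section Comparison.
Variables (R : realType) (n : nat).
Implicit Types (u v H : 'rV[R]_n -> R) (x y z : 'rV[R]_n) (A : 'M[R]_n).

(* If [psi] touches [Psi] and the quadratic [q] touches [v], both from above, then the
   polynomial [psi \o q] touches [u = Psi \o v] from above. *)
Lemma quad_test u v H (Psi : R -> R) (U : set 'rV[R]_n) x A (b c : R) :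
  open U -> U x -> psub U u H -> (forall y, U y -> u y = Psi (v y)) ->
  {for x, continuous v} -> enorm (gradient v x) = 1 -> utest v x A -> 0 < b ->
  touch_quad Psi (v x) b c -> H x <= 2 * c + b * \tr A.
Proof.
move=> oU Ux hu uE cv N1 [d d0 dP] b0 [d1 d10 d1P].
set N := gradient v x in N1 dP.
pose q y := dot N (y - x) + 1 / 2 * qform A (y - x).
have hq1 : polyf (fun y => dot N (y - x)) by exact: (polyf_shift (- x) (polyf_dot N)).
have hq2' : polyf (fun y => qform A (y - x)) by exact: (polyf_shift (- x) (polyf_qform A)).
have hq2 : polyf (fun y => 1 / 2 * qform A (y - x)) by exact: polyf_Z.
have hq : polyf q by exact: polyf_D.
have q0 : q x = 0.
  rewrite /q subrr dot0r -(scale0r (0 : 'rV[R]_n)) qformZ expr0n /=.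
  by rewrite mul0r mulr0 addr0.
pose phi y := Psi (v x) + (b * q y + c * (q y * q y)).
have hb : polyf (fun y => b * q y) by exact: polyf_Z.
have hqq : polyf (fun y => q y * q y) by exact: polyf_M.
have hc : polyf (fun y => c * (q y * q y)) by exact: polyf_Z.
have hphi : polyf phi by apply: polyf_D; [exact: polyf_cst|exact: polyf_D].
(* The second bound ensures |c (v y - v x + q y)| <= b, so that psi s = b s + c s^2 is nondecreasing
   on the values that occur. *)
pose m := Num.min d1 (b / (2 * (`|c| + 1))).
have c1 : 0 < `|c| + 1 by rewrite ltr_wpDl.
have m0 : 0 < m by rewrite lt_min d10 divr_gt0 // mulr_gt0.
have /nbhs_enormP[r1 r10 r1P] : nbhs x U by exact: open_nbhs_nbhs.
have /cont_enormP/(_ m m0)[r2 r20 r2P] := cv.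
have /cont_enormP/(_ m m0)[r3 r30 r3P] := @polyf_cont _ _ _ x hq.
pose r := Num.min (Num.min d r1) (Num.min r2 r3).
have rr : 0 < r by rewrite !lt_min d0 r10 r20 r30.
have phix : phi x = u x by rewrite /phi q0 !mulr0 !addr0 uE.
have -> : 2 * c + b * \tr A = laplacian phi x.
  rewrite (lapD x (polyf_cst _ _) (polyf_D hb hc)) lap_cst (lapD x hb hc).
  rewrite (lapZ b x hq) (lapZ c x hqq) (lapM x hq hq) q0 mulr0 mul0r.
  have -> : gradient q x = N.
    apply/rowP => i; rewrite mxE (partialD i hq1 hq2) (partialZ _ i hq2').
    rewrite (partial_shift (- x) i (polyf_dot N)) partial_dot.
    rewrite (partial_shift (- x) i (polyf_qform A)) partial_qform big1 ?mulr0 ?addr0 //.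
    by move=> j _; rewrite subrr mxE mulr0.
  rewrite (lapD x hq1 hq2) (lapZ _ x hq2') (lap_shift (- x) x (polyf_dot N)) lap_dot.
  rewrite (lap_shift (- x) x (polyf_qform A)) lap_qform -enorm_sqr N1.
  by field.
apply: (hu x phi r) => // y; rewrite /r !lt_min => /andP[/andP[yd y1] /andP[y2 y3]].
have Uy : U y by exact: r1P.
have vq : v y - v x <= q y.
  have := dP (y - x) yd; rewrite [x + _]addrC subrK /q.
  by move: (dot _ _) (qform _ _) => a a'; lra.
have := r2P y y2; have := r3P y y3; rewrite q0 subr0.
rewrite !lt_min => /andP[q1 q2] /andP[v1 v2].
rewrite uE //; apply: le_trans (d1P (v y) v1) _; rewrite /phi.
have key : `|c * (v y - v x + q y)| <= b.
  rewrite normrM; have h : `|v y - v x + q y| <= b / (`|c| + 1).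
    apply: le_trans (ler_normD _ _) _; move: q2 v2.
    have -> : b / (2 * (`|c| + 1)) = b / (`|c| + 1) / 2 by field; rewrite gt_eqF.
    by move: (b / _) => a; lra.
  apply: le_trans (_ : (`|c| + 1) * (b / (`|c| + 1)) <= _).
    by apply: ler_pM => //; rewrite lerDl.
  by rewrite mulrC divfK // gt_eqF.
(* The product is the difference of psi at [q y] and at [v y - v x]. *)
have : 0 <= (q y - (v y - v x)) * (b + c * (v y - v x + q y)).
  rewrite mulr_ge0 ?subr_ge0 //; move: key; rewrite ler_norml => /andP[? _]; lra.
by move: (q y) (v y) (v x) (Psi _) => a1 a2 a3 a4; rewrite !expr2; lra.
Qed.

Section Profile.
Variables (u v : 'rV[R]_n -> R) (x0 : 'rV[R]_n) (r : R) (Psi F G : R -> R).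
Hypotheses (r0 : 0 < r) (hv : unit_gradient v x0 r).
Hypothesis hu : pvisc (eball x0 r) u (fun y => G (v y)).
Hypothesis uE : forall y, eball x0 r y -> u y = Psi (v y).
Hypothesis dPsi : forall t, `|t - v x0| < r -> is_derive t 1 Psi (F t).
Hypothesis F0 : forall t, `|t - v x0| < r -> 0 < F t.
Hypothesis cF : forall t, `|t - v x0| < r -> {for t, continuous F}.
Hypothesis cG : forall t, `|t - v x0| < r -> {for t, continuous G}.

Let r4 : eball x0 r `<=` eball x0 (4 * r).
Proof. by move=> y; rewrite /eball /=; move: r0; lra. Qed.

Lemma v_lip x y : eball x0 r x -> eball x0 r y -> `|v y - v x| <= enorm (y - x).
Proof.
move=> /r4 xr /r4 yr; rewrite ler_norml; apply/andP; split.
  by have := unit_lip hv yr xr; rewrite (enormB x); lra.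
exact: (unit_lip hv xr yr).
Qed.

Lemma v_near y (d : R) : d <= r -> eball x0 d y -> `|v y - v x0| < d.
Proof.
move=> dr yd; have yr : eball x0 r y by exact: (lt_le_trans yd dr).
by apply: le_lt_trans yd; apply: v_lip => //; exact: eball_center.
Qed.

(** A lower bound G t - F t * \tr A for Psi'' at [t], in the sense of touching parabolas; the point
    [z] matters only through its level. In the application [F] and [G] are [f] and [g] composed with
    [Psi]. *)
Lemma quad_up z A t c : eball x0 r z -> v z = t -> utest v z A ->
  touch_quad Psi t (F t) c -> G t <= 2 * c + F t * \tr A.
Proof.
move=> zr zt hA ht; have [h1 _] := hu.
have tr : `|t - v x0| < r by rewrite -zt; exact: v_near.
have := quad_test (@open_eball _ _ _ _) zr h1 uE (hv.1 z (r4 zr)).1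
  (hv.2 z (r4 zr)) hA (F0 tr).
by rewrite zt; apply.
Qed.

(** The mirror image of [quad_up]: - u is the composition of s |-> - Psi (- s), again with positive
    derivative, and - v. *)
Lemma quad_low z A t c : eball x0 r z -> v z = t -> utest (fun y => - v y) z A ->
  touch_quad (fun s => - Psi s) t (- F t) c -> - G t <= 2 * c + F t * \tr A.
Proof.
move=> zr zt hA [d d0 dP]; have [_ h2] := hu.
have tr : `|t - v x0| < r by rewrite -zt; exact: v_near.
have hN := unit_gradientN hv.
pose Psi' s := - Psi (- s).
have uE' y : eball x0 r y -> - u y = Psi' (- v y).
  by move=> /uE ->; rewrite /Psi' opprK.
have := quad_test (@open_eball _ _ _ _) zr h2 uE' (hN.1 z (r4 zr)).1
  (hN.2 z (r4 zr)) hA (F0 tr).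
rewrite zt; apply; exists d => // s sd.
have sd' : `|- s - t| < d by rewrite -opprD normrN; move: sd; rewrite opprK.
have := dP (- s) sd'; rewrite /Psi' opprK.
by move: (Psi _) (Psi t) => a a'; rewrite !expr2; lra.
Qed.

(* Laplacians of quadratic tests of [v] from above at [x2] and from below at [x1] are
   both transported along the lines to any level [t], where they bound the second
   derivative of [Psi]. *)
Lemma tests_compare : exists C d, [/\ 0 <= C, 0 < d, d <= r &
  forall x1 A1 x2 A2 t, eball x0 d x1 -> utest (fun y => - v y) x1 A1 ->
    \tr A1 <= n%:R / r -> eball x0 d x2 -> utest v x2 A2 -> \tr A2 <= n%:R / r ->
    `|t - v x0| < d ->
    - \tr A1 - C * `|t - v x1| <= \tr A2 + C * `|t - v x2|].
Proof.
have transport w : unit_gradient w x0 r -> (forall x y, eball x0 r x -> eball x0 r y ->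
    `|w y - w x| <= enorm (y - x)) -> exists C d, [/\ 0 <= C, 0 < d, d <= r &
    forall x A t, eball x0 d x -> utest w x A -> \tr A <= n%:R / r ->
      `|t - w x0| < d -> exists z A', [/\ eball x0 r z, w z = t, utest w z A' &
        \tr A' <= \tr A + C * `|t - w x|]].
  move=> hw wlip; have [L [s0 [L0 s00 LP]]] := utest_backward (n%:R / r) r0 hw.
  pose d := Num.min s0 r / 4; have m0 : 0 < Num.min s0 r by rewrite lt_min s00.
  have d0 : 0 < d by rewrite divr_gt0.
  have ds : 4 * d <= s0 by rewrite mulrC divfK // ge_min lexx.
  have dr : 4 * d <= r by rewrite mulrC divfK // ge_min lexx orbT.
  exists (n%:R * L), d; split => //; first by rewrite mulr_ge0.
    by move: dr d0; lra.
  move=> x A t xd hA trA td.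
  have xr : eball x0 r x by move: xd dr d0; rewrite /eball /=; lra.
  have xr2 : eball x0 (2 * r) x by move: xr r0; rewrite /eball /=; lra.
  have xr4 : eball x0 (4 * r) x by exact: r4.
  have wx : `|w x - w x0| < d.
    by apply: le_lt_trans xd; apply: wlip => //; exact: eball_center.
  have tx : `|t - w x| < 2 * d.
    move: td wx; rewrite !ltr_norml => /andP[? ?] /andP[? ?]; apply/andP; split; lra.
  (* [w] changes at unit speed along this line, so [z] lies on level [t]. The sign of [t - w x]
     decides between free forward transport and backward transport, which adds L |t - w x| to each
     diagonal entry. *)
  pose z := x + (t - w x) *: gradient w x.
  have wz : w z = t.
    have h : `|t - w x| <= 2 * r by move: tx dr d0; lra.
    by rewrite /z (unit_line r0 hw xr2 h) addrC subrK.
  have zr : eball x0 r z.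
    have h : enorm ((t - w x) *: gradient w x) <= `|t - w x|.
      by rewrite enormZ hw.2 // mulr1.
    by apply: eball_add xd h _; move: tx dr d0; lra.
  have [h|h] := leP 0 (t - w x).
    exists z, A; split=> //; last by rewrite lerDl !mulr_ge0.
    have ts : t - w x < r by move: tx dr d0; rewrite ger0_norm //; lra.
    exact: (utest_forward r0 hw xr h ts hA).
  exists z, (A + (L * - (t - w x))%:M); split=> //.
    have -> : z = x + (- - (t - w x)) *: gradient w x by rewrite opprK.
    have ts : - (t - w x) < s0 by move: tx ds d0; rewrite ltr0_norm //; lra.
    have ts0 : 0 <= - (t - w x) by rewrite oppr_ge0 ltW.
    exact: (LP x A _ xr trA ts0 ts hA).
  by rewrite mxtraceD mxtrace_scalar ltr0_norm // -[X in _ + X <= _]mulr_natl mulrA.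
have [C [d [C0 d0 dr dP]]] := transport v hv v_lip.
have lipN x y : eball x0 r x -> eball x0 r y -> `|- v y - - v x| <= enorm (y - x).
  by move=> xr yr; rewrite -opprD normrN; exact: v_lip.
have [C' [d' [C'0 d'0 d'r dP']]] := transport _ (unit_gradientN hv) lipN.
pose D := Num.max C C'; pose m := Num.min d d'.
have mr : m <= r by rewrite ge_min dr.
have m0 : 0 < m by rewrite lt_min d0.
have md : m <= d by rewrite ge_min lexx.
have md' : m <= d' by rewrite ge_min lexx orbT.
have CD : C <= D by rewrite le_max lexx.
have C'D : C' <= D by rewrite le_max lexx orbT.
clearbody D m; exists D, m; split=> //; first exact: (le_trans C0 CD).
move=> x1 A1 x2 A2 t x1m h1 tr1 x2m h2 tr2 tm.
(* After transport to level [s], the test at [x2] gives p <= Psi'' and the test at [x1] gives Psi''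
   <= q in the viscosity sense; [touch_compare] then removes Psi''. *)
pose p s := G s - F s * (\tr A2 + D * `|s - v x2|).
pose q s := G s + F s * (\tr A1 + D * `|s - v x1|).
have sub s : `|s - v x0| < m -> `|s - v x0| < r by move=> h; exact: (lt_le_trans h mr).
have absc (a : R) s : {for s, continuous (fun s : R => `|s - a|)}.
  apply: (@continuous_comp _ _ _ (fun s : R => s - a) (fun s => `|s|)).
    by apply: continuousB; [exact: cvg_id|exact: cst_continuous].
  exact: norm_continuous.
have cl (a b c : R) s : {for s, continuous (fun s : R => a + b * `|s - c|)}.
  apply: continuousD; first exact: cst_continuous.
  by apply: continuousM; [exact: cst_continuous|exact: absc].
have cp : {for t, continuous p}.
  apply: continuousB; first exact/cG/sub.
  by apply: continuousM; [exact/cF/sub|exact: cl].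
have cq : {for t, continuous q}.
  apply: continuousD; first exact/cG/sub.
  by apply: continuousM; [exact/cF/sub|exact: cl].
have : p t <= q t.
  apply: (@touch_compare _ Psi F p q (v x0) m) => //.
  - by move=> s /sub; exact: dPsi.
  - move=> s c sm hs; have sd := lt_le_trans sm md.
    have x2d : eball x0 d x2 by exact: (lt_le_trans x2m md).
    have [z [A' [zr zs hA' trA']]] := dP x2 A2 s x2d h2 tr2 sd.
    have := quad_up zr zs hA' hs.
    have : F s * \tr A' <= F s * (\tr A2 + D * `|s - v x2|).
      rewrite ler_pM2l ?F0 //; last exact: sub.
      by apply: le_trans trA' _; rewrite lerD2l ler_wpM2r.
    by rewrite /p; move: (F s * \tr A') (F s * _) => a a'; lra.
  - move=> s c sm hs; have sd : `|- s - - v x0| < d'.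
      by rewrite -opprD normrN; exact: (lt_le_trans sm md').
    have x1d : eball x0 d' x1 by exact: (lt_le_trans x1m md').
    have [z [A' [zr zs hA' trA']]] := dP' x1 A1 (- s) x1d h1 tr1 sd.
    have := quad_low zr (oppr_inj zs) hA' hs.
    have : F s * \tr A' <= F s * (\tr A1 + D * `|s - v x1|).
      rewrite ler_pM2l ?F0 //; last exact: sub.
      apply: le_trans trA' _; rewrite lerD2l -opprD normrN.
      by rewrite ler_wpM2r.
    by rewrite /q; move: (F s * \tr A') (F s * _) => a a'; lra.
have Ft : 0 < F t by exact/F0/sub.
rewrite /p /q => h; rewrite -(ler_pM2l Ft); move: h.
by move: (D * _) (D * _) => a a'; lra.
Qed.

Let T := n%:R / r.

Let tr_cone : \tr (r^-1%:M : 'M[R]_n) = T.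
Proof. by rewrite mxtrace_scalar -[LHS]mulr_natl. Qed.

(* The infimum over all quadratic tests from above, transported to level [t]. *)
Lemma laplacian_profile : exists C d h, [/\ 0 <= C, 0 < d, d <= r,
  forall s t : R, `|h s - h t| <= C * `|s - t| &
  pvisc (eball x0 d) v (fun y => h (v y))].
Proof.
have [C [d [C0 d0 dr cmp]]] := tests_compare.
have dB : eball x0 d `<=` eball x0 r by move=> y yd; exact: (lt_le_trans yd dr).
have hN := unit_gradientN hv.
pose S t := [set s | exists x A, [/\ eball x0 d x, utest v x A, \tr A <= T &
  s = \tr A + C * `|t - v x|]].
have x0d : eball x0 d x0 by exact: eball_center.
have S0 t : S t !=set0.
  exists (\tr (r^-1%:M : 'M[R]_n) + C * `|t - v x0|), x0, (r^-1%:M : 'M[R]_n).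
  by split=> //; [exact: (cone_utest r0 hv (dB _ x0d))|rewrite tr_cone].
(* The infimum is finite because every test from above is compared, on the level of [x0], with the
   cone test of [- v] at [x0]. *)
have lb t : has_lbound (S t).
  exists (- T - C * `|t - v x0|) => s [x [A [xd hA trA ->]]].
  have h0 : `|v x0 - v x0| < d by rewrite subrr normr0.
  have := cmp x0 _ x A (v x0) x0d (cone_utest r0 hN (dB _ x0d)) _ xd hA trA h0.
  rewrite tr_cone => /(_ (lexx _)); rewrite subrr normr0 mulr0 subr0 => h1.
  have : C * `|v x0 - v x| <= C * `|t - v x0| + C * `|t - v x|.
    by rewrite -mulrDr ler_wpM2l // [`|t - v x0|]distrC ler_distD.
  by lra.
pose h t := inf (S t).
have h_le t x A : eball x0 d x -> utest v x A -> \tr A <= T ->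
    h t <= \tr A + C * `|t - v x|.
  by move=> xd hA trA; apply: ge_inf => //; exists x, A.
have le_h t a : (forall x A, eball x0 d x -> utest v x A -> \tr A <= T ->
    a <= \tr A + C * `|t - v x|) -> a <= h t.
  by move=> ha; apply: lb_le_inf => // s [x [A [xd hA trA ->]]]; exact: ha.
have hlip s t : h s - h t <= C * `|s - t|.
  rewrite lerBlDr addrC -lerBlDr; apply: le_h => x A xd hA trA.
  have := h_le s x A xd hA trA.
  have : C * `|s - v x| <= C * `|t - v x| + C * `|s - t|.
    by rewrite -mulrDr ler_wpM2l // [X in _ <= X]addrC ler_distD.
  by lra.
exists C, d, h; split=> // [s t|].
  rewrite ler_norml; apply/andP; split; last exact: hlip.
  by have := hlip t s; rewrite distrC; lra.
have small (a b : R) : (forall e, 0 < e -> a <= b + n%:R * (2 * e)) -> a <= b.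
  move=> hab; apply/ler_addgt0Pr => e e0.
  have n1 : 0 < n%:R + 1 :> R by rewrite ltr_wpDl.
  have q0 : 0 < 2 * (n%:R + 1) :> R by rewrite mulr_gt0.
  apply: le_trans (hab (e / (2 * (n%:R + 1))) (divr_gt0 e0 q0)) _.
  rewrite lerD2l (_ : n%:R * _ = e * (n%:R / (n%:R + 1))); last first.
    by field; rewrite gt_eqF.
  by rewrite ler_piMr ?(ltW e0) // ler_pdivrMr // mul1r lerDl.
split=> x phi q xd hphi q0 phx htouch; apply: small => e e0.
  have hA := touch_utest (@open_eball _ _ _ _) hv.1 (r4 (dB _ xd)) hphi q0 phx htouch e0.
  rewrite -(trace_hessian phi x (2 * e)).
  (* At the level of [x] itself the transport term vanishes. A test whose trace exceeds [T] is
     weaker than the cone test, which has trace [T] and replaces it. *)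
  have [trA|trA] := leP (\tr (hessian phi x + (2 * e)%:M)) T.
    by have := h_le (v x) x _ xd hA trA; rewrite subrr normr0 mulr0 addr0.
  have := h_le (v x) x _ xd (cone_utest r0 hv (dB _ xd)).
  rewrite tr_cone subrr normr0 mulr0 addr0 => /(_ (lexx _)) /le_trans; apply.
  exact: ltW.
have hA := touch_utest (@open_eball _ _ _ _) hN.1 (r4 (dB _ xd)) hphi q0 phx htouch e0.
rewrite -(trace_hessian phi x (2 * e)).
have xn : `|v x - v x0| < d by exact: v_near.
have [trA|trA] := leP (\tr (hessian phi x + (2 * e)%:M)) T.
  rewrite lerNl; apply: le_h => x2 A2 x2d hA2 trA2.
  have := cmp x _ x2 A2 (v x) xd hA trA x2d hA2 trA2 xn.
  by rewrite subrr normr0 mulr0 subr0.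
apply: (le_trans _ (ltW trA)); rewrite lerNl; apply: le_h => x2 A2 x2d hA2 trA2.
have := cmp x _ x2 A2 (v x) xd (cone_utest r0 hN (dB _ xd)) _ x2d hA2 trA2 xn.
by rewrite tr_cone subrr normr0 mulr0 subr0; apply.
Qed.

(** The right-hand side [h (v y)] is Lipschitz in [y], since [h] and [v] are; this brings
    [lipschitz_C2] into play. The radius [s] is divided by [n + 1] to fit the ball of radius [n * s]
    required by [pvisc_approx]. *)
Lemma v_C2 : (0 < n)%N -> exists2 rho, 0 < rho & rho <= r /\ C2on (eball x0 rho) v.
Proof.
move=> n0; have [C [d [h [C0 d0 dr hlip hvisc]]]] := laplacian_profile.
have n1 : 0 < n%:R + 1 :> R by rewrite ltr_wpDl.
pose s := d / (n%:R + 1); have s0 : 0 < s by rewrite divr_gt0.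
have sd : s <= d by rewrite ler_pdivrMr // ler_peMr ?(ltW d0) // lerDr.
have subc : ceball x0 (n%:R * s) `<=` eball x0 r.
  move=> y ys; apply: lt_le_trans dr; apply: le_lt_trans ys _.
  by rewrite /s mulrCA gtr_pMr // ltr_pdivrMr // mul1r ltrDl.
have subs : ceball x0 s `<=` ceball x0 (n%:R * s).
  by move=> y; rewrite /ceball /= => /le_trans; apply; rewrite ler_peMl ?ler1n // ltW.
have cv y : eball x0 r y -> {for y, continuous v} by move=> /r4 yr; exact: (hv.1 y yr).1.
have hl x y : eball x0 r x -> eball x0 r y -> `|h (v x) - h (v y)| <= C * enorm (x - y).
  move=> xr yr; apply: le_trans (hlip _ _) _; rewrite ler_wpM2l //.
  exact: v_lip.
have ch y : eball x0 r y -> {for y, continuous (fun y => h (v y))}.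
  move=> yr; apply/cont_enormP => e e0; have C1 : 0 < C + 1 by rewrite ltr_wpDl.
  exists (Num.min (e / (C + 1)) (r - enorm (y - x0))).
    by rewrite lt_min divr_gt0 // subr_gt0.
  move=> z; rewrite lt_min => /andP[ze zr].
  have zr' : eball x0 r z by apply: (eball_sub _ zr); rewrite addrC subrK.
  apply: le_lt_trans (hl _ _ zr' yr) _.
  apply: le_lt_trans (_ : (C + 1) * enorm (z - y) < e).
    by rewrite ler_wpM2r ?enorm_ge0 // lerDl.
  by rewrite mulrC -ltr_pdivlMr.
have hvs : pvisc (eball x0 s) v (fun y => h (v y)).
  have sub : eball x0 s `<=` eball x0 d by move=> y ys; exact: (lt_le_trans ys sd).
  by split=> y phi q /sub; [exact: hvisc.1|exact: hvisc.2].
exists (s / 8); first by rewrite divr_gt0.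
split; first by apply: le_trans dr; move: s0 sd; lra.
apply: (@lipschitz_C2 _ _ v (fun y => h (v y)) x0 s C s0 C0).
- move=> e e0; apply: pvisc_approx => //.
    by move=> y /subc; exact: cv.
  by move=> y /subc; exact: ch.
- by move=> y /subs/subc; exact: cv.
- by move=> y z /subs/subc ? /subs/subc ?; exact: hl.
Qed.

Lemma u_C2 : (0 < n)%N -> exists2 rho, 0 < rho & C2on (eball x0 rho) u.
Proof.
move=> n0; have [rho rho0 [rhor vC2]] := v_C2 n0.
have [vC vCC] := vC2; pose U := eball x0 rho.
have oU : open U by exact: open_eball.
have UB : U `<=` eball x0 r by move=> y yU; exact: (lt_le_trans yU rhor).
pose N := gradient v x0.
have x0r : eball x0 (2 * r) x0 by apply: eball_center; rewrite mulr_gt0.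
have N1 : enorm N = 1 by apply: hv.2; apply: eball_center; rewrite mulr_gt0.
(* The gradient line through [x0] meets level [t] at [z t]; evaluating [laplacian v] there turns it
   into a function of the level alone. *)
pose z t := x0 + (t - v x0) *: N.
have zU t : `|t - v x0| < rho -> U (z t).
  by move=> h; rewrite /U /eball /= addrAC subrr add0r enormZ N1 mulr1.
have vz t : `|t - v x0| < rho -> v (z t) = t.
  move=> h; rewrite /z (unit_line r0 hv x0r) ?[v x0 + _]addrC ?subrK //.
  by move: h rhor r0; lra.
pose p t := G t - F t * laplacian v (z t).
have sub t : `|t - v x0| < rho -> `|t - v x0| < r.
  by move=> h; exact: (lt_le_trans h rhor).
have cp t : `|t - v x0| < rho -> {for t, continuous p}.
  move=> tr; apply: continuousB; first exact/cG/sub.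
  apply: continuousM; first exact/cF/sub.
  by apply: line_cont; exact: (laplacian_cont vC2 (zU t tr)).
have small (a b : R) t : `|t - v x0| < rho ->
   (forall e, 0 < e -> a <= b + F t * (n%:R * (2 * e))) -> a <= b.
  move=> tr hab; apply/ler_addgt0Pr => e e0; have Ft := F0 (sub t tr).
  have n1 : 0 < n%:R + 1 :> R by rewrite ltr_wpDl.
  have q0 : 0 < 2 * (n%:R + 1) * F t by rewrite !mulr_gt0.
  apply: le_trans (hab (e / (2 * (n%:R + 1) * F t)) (divr_gt0 e0 q0)) _.
  rewrite lerD2l (_ : F t * _ = e * (n%:R / (n%:R + 1))); last first.
    by field; rewrite !gt_eqF.
  by rewrite ler_piMr ?(ltW e0) // ler_pdivrMr // mul1r lerDl.
have dF t : `|t - v x0| < rho -> is_derive t 1 F (p t).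
  move=> tr; apply: (@touch_second_derivative _ Psi F p (v x0) rho) => //.
  - by move=> s /sub; exact: dPsi.
  - move=> s c sr hs; apply: (small _ _ s sr) => e e0.
    have hA := C2_utest oU vC2 (zU s sr) e0.
    have := quad_up (UB _ (zU s sr)) (vz s sr) hA hs.
    rewrite trace_hessian mulrDr /p.
    by move: (F s * laplacian _ _) (F s * (n%:R * _)) => a a'; lra.
  - move=> s c sr hs; apply: (small _ _ s sr) => e e0.
    have [vNC2 lN] := C2onN oU vC2.
    have hA := C2_utest oU vNC2 (zU s sr) e0.
    have := quad_low (UB _ (zU s sr)) (vz s sr) hA hs.
    rewrite trace_hessian mulrDr /p (lN _ (zU s sr)) mulrN.
    by move: (F s * laplacian _ _) (F s * (n%:R * _)) => a a'; lra.
  - exact: cp.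
have vn y : U y -> `|v y - v x0| < rho by move=> Uy; exact: v_near.
have [FvC FvE] := C1_comp1 vC (fun y Uy => dF (v y) (vn y Uy)) oU
  (fun y Uy => continuous_comp (vC y Uy).1 (cp (v y) (vn y Uy))).
have [PvC PvE] := C1_comp1 vC (fun y Uy => dPsi (sub _ (vn y Uy))) oU
  (fun y Uy => (FvC y Uy).1).
have uEU y : U y -> u y = Psi (v y) by move=> /UB; exact: uE.
have [uC uCE] := C1on_eq oU uEU PvC.
exists rho; [exact: rho0|split; [exact: uC|move=> i]].
(* Each partial derivative of [u] is now a product of two C^1 functions. *)
have puE y : U y -> partial i u y = F (v y) * partial i v y.
  by move=> Uy; rewrite uCE // PvE.
exact: (C1on_eq oU puE (C1onM oU FvC (vCC i))).1.
Qed.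

End Profile.
End Comparison.

(** * Regularity of the solution *)

Section LocalRegularity.
Variables (R : realType) (n : nat).
Implicit Types (u v : 'rV[R]_n -> R) (x y z : 'rV[R]_n) (U : set 'rV[R]_n).

Lemma within_interior (I : set R) (f : R -> R) (a b t : R) : is_interval I ->
  {within I, continuous f} -> I a -> I b -> a < t < b -> {for t, continuous f}.
Proof.
move=> hI cf Ia Ib /andP[at_ tb].
have sub s : a < s < b -> I s by move=> /andP[? ?]; apply: (hI a b) => //; rewrite !ltW.
apply/(@cvgrPdist_lt _ _ _ (nbhs t) _) => e e0.
have tI : I t by apply: sub; rewrite at_.
have [d d0 dP] := within_eps cf tI e0.
apply/nbhs_ballP; exists (Num.min d (Num.min (t - a) (b - t))) => /=.
  by rewrite !lt_min d0 !subr_gt0 at_.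
move=> s; rewrite /ball /= !lt_min => /and3P[sd sa sb]; rewrite distrC; apply: dP.
  by apply: sub; move: sa sb; rewrite !ltr_norml => /andP[? ?] /andP[? ?]; apply/andP; split; lra.
by rewrite distrC.
Qed.

Lemma gradient_cst (c : R) x : gradient (fun=> c : R) x = 0 :> 'rV[R]_n.
Proof. by apply/rowP => i; rewrite !mxE partial_cst. Qed.

(** Otherwise the constant [u x] would touch [u] from above at [x] and force the gradient to
    vanish. *)
Lemma larger_value U u x r : C1on U u -> U x -> 0 < enorm (gradient u x) -> 0 < r ->
  exists2 y, eball x r y & u x < u y.
Proof.
move=> uC Ux ux r0; have [//|hn] := pselect (exists2 y, eball x r y & u x < u y).
have := touch_gradient uC (@polyf_C1 _ _ (fun=> u x) U (polyf_cst _ (u x))) Ux r0 erefl.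
rewrite gradient_cst => hg; exfalso; move: ux; rewrite -hg ?enorm0 ?ltxx // => y yr.
by rewrite leNgt; apply/negP => uy; apply: hn; exists y.
Qed.

(** [I] may contain an end point, where [f] and [g] are only one-sidedly continuous. A nonzero
    gradient makes [u] take values on both sides of [u x], so the values near [u x] are interior to
    [I]. *)
Lemma image_interior U u x : open U -> C1on U u -> U x -> 0 < enorm (gradient u x) ->
  exists y z, [/\ U y, U z & u y < u x < u z].
Proof.
move=> oU uC Ux ux; have /nbhs_enormP[r r0 rU] : nbhs x U by exact: open_nbhs_nbhs.
have [z zr uz] := larger_value uC Ux ux r0.
have du (i : 'I_n) : derivable u x (delta_mx 0 i) by have [_ /(_ i)[]] := uC x Ux.
have uNx : 0 < enorm (gradient (fun y => - u y) x) by rewrite gradientN // enormN.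
have [y yr uy] := larger_value (C1onN oU uC) Ux uNx r0.
by exists y, z; split; [exact: rU|exact: rU|rewrite uz andbT -ltrN2].
Qed.

Variables (I : set R) (f g : R -> R) (Omega : set 'rV[R]_n) (u : 'rV[R]_n -> R).
Hypotheses (oO : open Omega) (hI : is_interval I) (uI : u @` Omega `<=` I).
Hypotheses (cf : {within I, continuous f}) (cg : {within I, continuous g}).
Hypothesis f0 : forall t, I t -> 0 < f t.
Hypothesis uC : C1on Omega u.
Hypothesis ueq : forall x, Omega x -> enorm (gradient u x) = f (u x).
Hypothesis hu : pvisc Omega u (fun x => g (u x)).

Lemma local_C2 x0 : (0 < n)%N -> Omega x0 ->
  exists2 rho, 0 < rho & C2on (eball x0 rho) u.
Proof.
move=> n0 O0; have uIx x : Omega x -> I (u x) by move=> Ox; exact/uI/imageP.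
have fu x : Omega x -> 0 < f (u x) by move=> Ox; exact/f0/uIx.
have [|ya [yb [Oya Oyb /andP[ua ub]]]] := image_interior oO uC O0.
  by rewrite ueq // fu.
(* Midpoints, so that the closed interval [a, b] lies strictly between two values of [u] and [f] is
   fully continuous on it. *)
pose a := (u ya + u x0) / 2; pose b := (u x0 + u yb) / 2.
have aa : u ya < a by rewrite /a; lra.
have a0 : a < u x0 by rewrite /a; lra.
have b0 : u x0 < b by rewrite /b; lra.
have bb : b < u yb by rewrite /b; lra.
have ab : a < b := lt_trans a0 b0.
have tI t : a <= t <= b -> u ya < t < u yb.
  by move=> /andP[? ?]; rewrite (lt_le_trans aa) //= (le_lt_trans _ bb).
have cfi t : a <= t <= b -> {for t, continuous f}.
  by move=> /tI; apply: (within_interior hI cf (uIx _ Oya) (uIx _ Oyb)).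
have fi t : a <= t <= b -> 0 < f t.
  move=> /tI /andP[? ?]; apply: f0; apply: (hI (uIx _ Oya) (uIx _ Oyb)).
  by rewrite !ltW.
have [Phi dPhi] : exists Phi : R -> R, forall t, a < t < b -> is_derive t 1 Phi (f t)^-1.
  apply: (@antiderivative R (fun t => (f t)^-1)) => // t tab.
  by apply: continuousV; [rewrite gt_eqF // fi|exact: cfi].
have Phi_inj s t : a < s < b -> a < t < b -> Phi s = Phi t -> s = t.
  wlog st : s t / s < t.
    move=> h hs ht e; have [st|st|//] := ltgtP s t; first exact: h.
    by apply/esym; apply: h.
  move=> /andP[sa sb] /andP[ta tb] e.
  have [|c /andP[sc ct]] := @MVT1 R Phi (fun t => (f t)^-1) s t st.
    move=> c /andP[sc ct]; apply: dPhi.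
    by rewrite (lt_le_trans sa sc) (le_lt_trans ct tb).
  rewrite e subrr => /esym/eqP; rewrite mulf_eq0 subr_eq0 (gt_eqF st) orbF invr_eq0.
  by rewrite gt_eqF // fi // !ltW // ?(lt_trans sa) // (lt_trans ct).
have [r r0 rO] : exists2 r, 0 < r & eball x0 (4 * r) `<=` Omega `&` [set y | a < u y < b].
  have /cont_enormP cu := (uC O0).1.
  have d0 : 0 < Num.min (u x0 - a) (b - u x0) by rewrite lt_min !subr_gt0 a0.
  have [d d1 dP] := cu _ d0.
  have /nbhs_enormP[s s0 sO] : nbhs x0 Omega by exact: open_nbhs_nbhs.
  exists (Num.min d s / 4); first by rewrite divr_gt0 // lt_min d1.
  move=> y; rewrite /eball /= mulrC divfK // lt_min => /andP[/dP yd /sO yO]; split=> //.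
  move: yd; rewrite lt_min !ltr_norml => /andP[/andP[? ?] /andP[? ?]].
  by apply/andP; split; lra.
pose B := eball x0 (4 * r); pose v y := Phi (u y).
have BO y : B y -> Omega y by move=> /rO[].
have Bab y : B y -> a < u y < b by move=> /rO[].
have uB : C1on B u by move=> y /BO; exact: uC.
have oB : open B by exact: open_eball.
have cfu x : Omega x -> {for x, continuous (fun y => f (u y))}.
  by move=> Ox; apply: (within_comp cf oO uI Ox); exact: (uC Ox).1.
have cgu x : Omega x -> {for x, continuous (fun y => g (u y))}.
  by move=> Ox; apply: (within_comp cg oO uI Ox); exact: (uC Ox).1.
have [vC vE] : C1on B v /\ forall x i, B x -> partial i v x = (f (u x))^-1 * partial i u x.
  apply: (@C1_comp1 R n Phi (fun t => (f t)^-1)) => // x Bx; first exact: dPhi (Bab x Bx).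
  by apply: continuousV; [rewrite gt_eqF // fu //; exact: BO|exact/cfu/BO].
have gradv x : B x -> gradient v x = (f (u x))^-1 *: gradient u x.
  by move=> Bx; apply/rowP => i; rewrite !mxE vE.
have hv : unit_gradient v x0 r.
  split=> // x Bx; rewrite gradv // enormZ ueq ?gtr0_norm ?invr_gt0; try exact/fu/BO.
    by rewrite mulVf // gt_eqF //; exact/fu/BO.
  exact: BO.
pose N := gradient v x0; pose L t := x0 + (t - v x0) *: N.
have B0 : B x0 by apply: eball_center; rewrite mulr_gt0.
have N1 : enorm N = 1 by exact: hv.2.
have LB t : `|t - v x0| < r -> B (L t).
  move=> tr; rewrite /B /L /eball /= addrC addKr enormZ N1 mulr1.
  by apply: lt_trans tr _; rewrite ltr_pMl // ltr1n.
have x0r : eball x0 r x0 by exact: eball_center.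
have vL t : `|t - v x0| < r -> v (L t) = t.
  move=> tr; have t2 : `|t - v x0| <= 2 * r.
    by apply: ltW; apply: lt_trans tr _; rewrite ltr_pMl // ltr1n.
  have x2 : eball x0 (2 * r) x0 by apply: eball_center; rewrite mulr_gt0.
  by rewrite [LHS](unit_line r0 hv x2 t2) addrC subrK.
have gL t : `|t - v x0| < r -> gradient u (L t) = f (u (L t)) *: N.
  move=> tr; have := unit_line_gradient r0 hv x0r tr; rewrite -/N -/(L t) => <-.
  rewrite gradv; last exact: LB.
  by rewrite scalerA mulfV ?scale1r // gt_eqF //; exact/fu/BO/LB.
(* [Psi] inverts [Phi] without an inverse function theorem: it is [u] along the gradient line
   through [x0]. Since [u y] and [Psi (v y)] have the same image [v y] under [Phi], injectivity
   gives [u = Psi o v]. *)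
pose Psi t := u (L t).
have rB y : eball x0 r y -> B y.
  by move=> yr; apply: lt_trans yr _; rewrite ltr_pMl // ltr1n.
have vx y : eball x0 r y -> `|v y - v x0| < r.
  move=> yr; have By := rB y yr.
  apply: le_lt_trans yr; rewrite ler_norml (unit_lip hv B0 By) andbT.
  by have := unit_lip hv By B0; rewrite enormB lerNl opprB.
have uE y : eball x0 r y -> u y = Psi (v y).
  move=> yr; have Ly := LB _ (vx y yr).
  apply: Phi_inj; [exact/Bab/rB|exact: Bab|].
  by rewrite -/(v y) -/(v (L _)) vL //; exact: vx.
apply: (@u_C2 R n u v x0 r Psi (fun t => f (Psi t)) (fun t => g (Psi t))) => //.
- have [h1 h2] := hu; have rO' y yr := BO y (rB y yr).
  split=> x phi q xr; rewrite -uE //; [exact: (h1 _ _ _ (rO' x xr))|exact: (h2 _ _ _ (rO' x xr))].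
- move=> t tr; have LE s : L s = (x0 - v x0 *: N) + s *: N.
    by rewrite /L scalerBl -addrA [- _ + _]addrC.
  rewrite (_ : Psi = fun s => u ((x0 - v x0 *: N) + s *: N)); last first.
    by apply/funext => s; rewrite -LE.
  apply: (@is_derive_line _ _ u (x0 - v x0 *: N) N _ t).1; rewrite -LE.
  have := @C1_derive _ _ Omega u (L t) N oO uC (BO _ (LB _ tr)).
  by rewrite gL // dotZl -enorm_sqr N1 expr1n mulr1.
- by move=> t tr; exact/fu/BO/LB.
- move=> t tr; apply: (@line_cont _ _ (fun y => f (u y)) x0 N (v x0) t).
  exact/cfu/BO/LB.
- move=> t tr; apply: (@line_cont _ _ (fun y => g (u y)) x0 N (v x0) t).
  exact/cgu/BO/LB.
Qed.

End LocalRegularity.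

(** In dimension zero a constant touches [u] from both sides at the only point, and its gradient is
    0; the two tests give f (u) = 0 up to sign, against f > 0. *)
Lemma dim_gt0 (R : realType) (n : nat) (Omega : set 'rV[R]_n) (u : 'rV[R]_n -> R)
  (f g : R -> R) x0 : (forall x, Omega x -> 0 < f (u x)) ->
  viscosity_solution (@eikonal_op R n f g) Omega u -> Omega x0 -> (0 < n)%N.
Proof.
case: n Omega u x0 => // Omega u x0 f0 [_ visc] O0; exfalso.
have allx y : y = x0 by apply/rowP => -[].
have hC : C2_near x0 (fun=> u x0) by apply: polyf_C2_near; exact: polyf_cst.
have [h1 h2] := visc x0 _ O0 hC.
have {h1} : eikonal_op f g (u x0) (gradient (fun=> u x0) x0) (hessian (fun=> u x0) x0) <= 0.
  by apply: h1; split=> //; apply/nbhs_enormP; exists 1 => // y _; rewrite (allx y).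
have {h2} : 0 <= eikonal_op f g (u x0) (gradient (fun=> u x0) x0) (hessian (fun=> u x0) x0).
  by apply: h2; split=> //; apply/nbhs_enormP; exists 1 => // y _; rewrite (allx y).
rewrite /eikonal_op gradient_cst enorm0 subr0; have := f0 _ O0.
by rewrite /sgn; case: ifP => _; lra.
Qed.

Theorem proposition1p1 (R : realType) (n : nat) (Omega : set 'rV[R]_n)
    (u : 'rV[R]_n -> R) (I : set R) (f g : R -> R)
    (Omega_open : open Omega)
    (I_interval : is_interval I)
    (u_in_I : u @` Omega `<=` I)
    (f_cont : {within I, continuous f})
    (g_cont : {within I, continuous g})
    (f_pos : forall t : R, I t -> 0 < f t)
    (u_eikonal : viscosity_solution (@eikonal_op R n f g) Omega u)
    (u_poisson : viscosity_solution (@poisson_op R n g) Omega u) :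
  Ck 2 Omega u /\
  forall x : 'rV[R]_n, Omega x ->
    enorm (gradient u x) = f (u x) /\ laplacian u x = g (u x).

Proof.
have uIx x : Omega x -> I (u x) by move=> Ox; exact/u_in_I/imageP.
have fu x : Omega x -> 0 < f (u x) by move=> Ox; exact/f_pos/uIx.
have cu x : Omega x -> {for x, continuous u}.
  by apply: (within_open_cont u Omega_open).1; exact: u_poisson.1.
have cfu x : Omega x -> {for x, continuous (fun y => f (u y))}.
  by move=> Ox; exact: (within_comp f_cont Omega_open u_in_I Ox (cu x Ox)).
have cgu x : Omega x -> {for x, continuous (fun y => g (u y))}.
  by move=> Ox; exact: (within_comp g_cont Omega_open u_in_I Ox (cu x Ox)).
have hp := poisson_pvisc u_poisson.
have uC : C1on Omega u.
  (* Positivity of the dimension is available only once [Omega] has a point. *)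
  move=> x Ox; have n0 := dim_gt0 fu u_eikonal Ox.
  exact: (viscosity_C1 n0 Omega_open cu cgu hp Ox).
have ueq := eikonal_pointwise Omega_open uC cfu cgu u_eikonal.
have uCC : C2on Omega u.
  split=> // i x Ox; have n0 := dim_gt0 fu u_eikonal Ox.
  have [rho rho0 [_ uC2]] := local_C2 Omega_open I_interval u_in_I f_cont g_cont
    f_pos uC ueq hp n0 Ox.
  exact: (uC2 i x (eball_center x rho0)).
have uCk : Ck 2 Omega u by apply/Ck2P.
split=> // x Ox; split; first exact: ueq.
(* Being C^2, [u] is itself an admissible test function and touches itself from both sides. *)
have [] := u_poisson.2 x u Ox; first by exists Omega; [split|].
have below : touches_below u u x by split=> //; apply/nbhs_enormP; exists 1.
have above : touches_above u u x by split=> //; apply/nbhs_enormP; exists 1.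
rewrite /poisson_op (_ : \tr _ = laplacian u x); last by apply: eq_bigr => i _; rewrite mxE.
move=> /(_ below) h1 /(_ above) h2.
by apply/eqP; rewrite -subr_eq0 eq_le h1.
Qed.
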